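(* Let $\alpha\in(0,1)$ and let $\beta\in(0,1]$ be either rational or an irrational number of intermediate $\alpha$-type. Then for every $v\in\mathfrak{U}_{\beta,\alpha}$, $$\lim_{n\to\infty}\ln(n)\cdot\mathcal{P}_1^n(v) = \Big(\int_{[0,1]} v\,\mathrm{d}\lambda\Big)\cdot h_1$$ uniformly on every compact subset of $(0,1)\setminus\Omega_1(\beta)$, and there is a set $E$ of Hausdorff dimension $0$ such that the convergence holds pointwise outside $E$. If $\beta$ is pre-periodic with respect to $T_1$ with period length strictly greater than one, then at each point $x$ of the finite set $\Omega_1(\beta)$, $$\liminf_{n\to\infty}\ln(n)\,\mathcal{P}_1^n(v)(x) = \Big(\int v\,\mathrm{d}\lambda\Big)h_1(x)\quad\text{and}\quad \limsup_{n\to\infty}\ln(n)\,\mathcal{P}_1^n(v)(x)=+\infty;$$ if $\beta$ is pre-periodic with respect to $T_1$ with period length one, then at the single point $x$ of $\Omega_1(\beta)$, $\lim_{n\to\infty}\ln(n)\,\mathcal{P}_1^n(v)(x)=+\infty$.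
   Context: $T_1$ is the Farey map: $T_1(x)=\frac{x}{1-x}$ for $0\le x\le1/2$ and $T_1(x)=\frac{1-x}{x}$ for $1/2<x\le1$, with inverse branches $f_{1,0}(x)=\frac{x}{1+x}$, $f_{1,1}(x)=\frac{1}{1+x}$. Its Perron–Frobenius operator is $\mathcal{P}_1(f)=|f_{1,0}'|\cdot f\circ f_{1,0}+|f_{1,1}'|\cdot f\circ f_{1,1}$; $h_1(x)=1/x$; $\lambda$ is Lebesgue measure. $\mathrm{BV}(0,1)$: right-continuous $f:[0,1]\to\mathbb{C}$ with finite total variation and finite sup norm. For $\alpha\in(0,1)$, $\beta\in[0,1]$, $\mathfrak{U}_{\beta,\alpha}$ is the set of positive $v:[0,1]\to[0,+\infty]$ with (a) $v(x)\to+\infty$ as $x\to\beta$ from either side; (b) $v\mathbb{1}_K\in\mathrm{BV}(0,1)$ for every compact $K\subset[0,1]\setminus\{\beta\}$; (c) on some connected relatively open neighbourhood $U$ of $\beta$, $C_1|\beta-x|^{-\alpha}\le v(x)\le C_2|\beta-x|^{-\alpha}$ for constants $C_1,C_2>0$. $\Omega_1(\beta)=\bigcap_{k\ge0}\overline{\{T_1^\ell(\beta):\ell\ge k\}}$. Pre-periodic: $T_1^{n+k}(\beta)=T_1^{n+m+k}(\beta)$ for all $k\ge0$ for some $m\in\mathbb N$, $n\in\mathbb N_0$; minimal such $m$ is the period length. For irrational $\beta=[0;a_1,a_2,\dots]$ (regular continued fraction), for $n\in\mathbb{N}$ and $1\le j\le a_n$ let $s_{n,j}/t_{n,j}=[0;a_1,\dots,a_{n-1},j]$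 in lowest terms. $\beta$ is of intermediate $\alpha$-type if there is $\epsilon>0$ with $\sum_{n\ge1}\sum_{j=1}^{a_n} t_{n,j}^{-2(1-\alpha)+\epsilon}<\infty$.
   Formalization: Condition (b) read literally for every compact K empties the class (K a single point violates right-continuity); it is taken instead for compact intervals K avoiding β, as v finite, bounded, of bounded variation on K and right-continuous on K except at its right endpoint. *)

(* Defs.v *)
From Stdlib Require Import Reals Lra Lia ZArith List.
Open Scope R_scope.

(** Extended nonnegative values [0,+oo]: finite reals or +oo. *)
Inductive ER : Type := Fin (r : R) | PInf.

Definition eadd (e1 e2 : ER) : ER :=
  match e1, e2 with Fin a, Fin b => Fin (a + b) | _, _ => PInf end.

(* scaling by a strictly positive real (only used with c > 0) *)
Definition escale (c : R) (e : ER) : ER :=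
  match e with Fin a => Fin (c * a) | PInf => PInf end.

(* real part: the finite value, 0 at +oo (used only where v is finite) *)
Definition ER_real (e : ER) : R := match e with Fin a => a | PInf => 0 end.

Definition ER_ge (e : ER) (M : R) : Prop := match e with Fin a => M <= a | PInf => True end.
Definition ER_gt (e : ER) (M : R) : Prop := match e with Fin a => M < a | PInf => True end.
Definition ER_lt (e : ER) (M : R) : Prop := match e with Fin a => a < M | PInf => False end.

Definition T1 (x : R) : R :=
  if Rle_dec x (1/2) then x / (1 - x) else (1 - x) / x.

Definition f10 (x : R) : R := x / (1 + x).
Definition f11 (x : R) : R := 1 / (1 + x).

(** Perron-Frobenius operator: |f10'(x)| = |f11'(x)| = 1/(1+x)^2. *)
Definition P1 (f : R -> ER) (x : R) : ER :=
  eadd (escale (/ (1 + x) ^ 2) (f (f10 x))) (escale (/ (1 + x) ^ 2) (f (f11 x))).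

Definition P1n (n : nat) (f : R -> ER) : R -> ER := Nat.iter n P1 f.

Definition h1 (x : R) : R := / x.

Definition lnP (n : nat) (v : R -> ER) (x : R) : ER :=
  match P1n n v x with Fin a => Fin (ln (INR n) * a) | PInf => PInf end.

(** Omega_1(beta) = intersection over k of closure {T_1^l beta : l >= k}. *)
Definition Omega1 (beta x : R) : Prop :=
  forall (k : nat) (eps : R), 0 < eps ->
    exists l : nat, (k <= l)%nat /\ Rabs (Nat.iter l T1 beta - x) < eps.

Definition is_period (beta : R) (m : nat) : Prop :=
  (1 <= m)%nat /\ exists n : nat, forall k : nat,
    Nat.iter (n + k) T1 beta = Nat.iter (n + m + k) T1 beta.

Definition period_length (beta : R) (m : nat) : Prop :=
  is_period beta m /\ forall m', is_period beta m' -> (m <= m')%nat.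

Definition is_rational (x : R) : Prop :=
  exists (p q : Z), q <> 0%Z /\ x = IZR p / IZR q.

Fixpoint cfval (l : list nat) : R :=
  match l with nil => 0 | a :: l' => / (INR a + cfval l') end.

Definition is_cf_expansion (beta : R) (a : nat -> nat) : Prop :=
  (forall n, (1 <= n)%nat -> (1 <= a n)%nat) /\
  forall eps, 0 < eps -> exists N, forall n, (N <= n)%nat ->
    Rabs (cfval (map a (seq 1 n)) - beta) < eps.

Definition cf_denom (l : list nat) (t : nat) : Prop :=
  (0 < t)%nat /\ exists s : Z, Z.gcd s (Z.of_nat t) = 1%Z /\
    cfval l = IZR s / INR t.

Definition cf_nj (a : nat -> nat) (n j : nat) : list nat :=
  map a (seq 1 (n - 1)) ++ (j :: nil).

Definition intermediate_type (alpha beta : R) : Prop :=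
  exists a : nat -> nat, is_cf_expansion beta a /\
  exists eps, 0 < eps /\
  exists t : nat -> nat -> nat,
    (forall n j, (1 <= n)%nat -> (1 <= j <= a n)%nat -> cf_denom (cf_nj a n j) (t n j)) /\
    exists B, forall N : nat,
      sum_f_R0 (fun n =>
        sum_f_R0 (fun j => Rpower (INR (t (S n) (S j))) (- 2 * (1 - alpha) + eps))
                 (a (S n) - 1)) N <= B.

Fixpoint var_sum (f : R -> R) (x : R) (l : list R) : R :=
  match l with nil => 0 | y :: l' => Rabs (f y - f x) + var_sum f y l' end.

Fixpoint incr_in (b x : R) (l : list R) : Prop :=
  match l with nil => True | y :: l' => x <= y /\ y <= b /\ incr_in b y l' end.

Definition BV_on (f : R -> R) (a b : R) : Prop :=
  (exists M, forall x, a <= x <= b -> Rabs (f x) <= M) /\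
  (exists M, forall x l, a <= x <= b -> incr_in b x l -> var_sum f x l <= M) /\
  (forall x, a <= x < b -> forall eps, 0 < eps -> exists d, 0 < d /\
     forall y, x <= y < x + d -> y <= b -> Rabs (f y - f x) < eps).

Definition in_U (beta alpha : R) (v : R -> ER) : Prop :=
  (forall x, 0 <= x <= 1 -> ER_ge (v x) 0) /\
  (forall M, exists d, 0 < d /\ forall x, 0 <= x <= 1 -> 0 < Rabs (x - beta) < d ->
       ER_ge (v x) M) /\
  (* (b) v 1_K in BV for compact (intervals) K in [0,1] \ {beta} *)
  (forall a b, 0 <= a -> a <= b -> b <= 1 -> ~ (a <= beta <= b) ->
       (forall x, a <= x <= b -> exists r, v x = Fin r) /\
       BV_on (fun x => ER_real (v x)) a b) /\
  (exists C1 C2 u1 u2, 0 < C1 /\ 0 < C2 /\ u1 < beta < u2 /\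
     v beta = PInf /\
     forall x, 0 <= x <= 1 -> u1 < x < u2 -> x <> beta ->
       exists r, v x = Fin r /\
         C1 * Rpower (Rabs (beta - x)) (- alpha) <= r <=
         C2 * Rpower (Rabs (beta - x)) (- alpha)).

(** Lebesgue integral of v >= 0 over [0,1] (v is BV, hence Riemann integrable,
    on compacts away from beta): improper Riemann integral around beta. *)
Definition integral_v (v : R -> ER) (beta I : R) : Prop :=
  forall eps, 0 < eps -> exists d0, 0 < d0 /\ forall d, 0 < d < d0 ->
    exists (p1 : Riemann_integrable (fun x => ER_real (v x)) 0 (beta - d))
           (p2 : Riemann_integrable (fun x => ER_real (v x)) (Rmin (beta + d) 1) 1),
      Rabs (RiemannInt p1 + RiemannInt p2 - I) < eps.

(** Hausdorff dimension 0: H^s(E) = 0 for every s > 0. *)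
Definition hausdorff_dim0 (E : R -> Prop) : Prop :=
  forall s delta eps, 0 < s -> 0 < delta -> 0 < eps ->
    exists a b : nat -> R,
      (forall i, a i < b i < a i + delta) /\
      (forall x, E x -> exists i, a i <= x <= b i) /\
      forall N, sum_f_R0 (fun i => Rpower (b i - a i) s) N <= eps.

(* Main.v *)
From Stdlib Require Import Reals Lra Lia Psatz ZArith List Classical ClassicalEpsilon.
From Coquelicot Require Import Coquelicot.
Require Import Defs.
Open Scope R_scope.

(** Conjugating the transfer operator by the invariant density 1/x gives the Markov operator
    Q g x = (g (x/(1+x)) + x g (1/(1+x))) / (1+x), which preserves the cone of nonnegative,
    nondecreasing, concave functions on [0,1]. On the cone, U_n := Q^n g 1 is nonincreasing in n
    and n x/(1+n x) U_n <= Q^n g x <= U_n. As the integral of Q^n g / x does not depend on n,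
    these two bounds give U_n ln n -> int g/x, so ln n Q^n g converges uniformly on every [a,1].
    Differences of the functions min(x,c) and a squeeze extend this to indicators of intervals,
    hence to functions of bounded variation.

    It remains to show that the part of v close to beta contributes little. If beta is rational,
    finitely many steps of the operator move the singularity to 0, where x^-alpha is dominated by
    a function coming from the cone. If beta is irrational, write T^k beta = beta_k and let
    x |-> (A x + B)/(C x + D) be the inverse branch of T^k through beta. One step of the operator
    maps B_k(x) = (C x + D)^(alpha-2) (C beta_k + D)^alpha |x - beta_k|^-alpha to B_(k+1) plus a
    remainder dominated by a cone function times a power of the denominators; the intermediate
    alpha-type makes the remainders summable, with a spare power that absorbs ln n. What is left
    is B_n(x), which tends to 0 unless x is repeatedly very close to beta_n; the exceptional
    points are those x lying within (S_n D_n)^-p exp(-1/beta_n) of beta_n for infinitely many n,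
    where S_n = C + D, D_n = D and p > 0. *)

(** The density 1/x is not integrable, which is the origin of the logarithm: after n steps the
    conserved mass looks like U_n / x on roughly [1/n, 1], hence equals about U_n ln n. Functions of
    bounded variation can be squeezed by combinations of cone elements, but x v(x) is unbounded near
    beta and cone elements are bounded, so the singularity is followed by hand along the orbit.
    Following it along one inverse branch is exact, because a fractional linear f of determinant ±1
    satisfies f x - f y = ± (x - y) / (product of the two denominators); what is lost passes through
    the other branch, whose image keeps a controlled distance from the orbit. The factor
    exp(-1/beta_n) in the exceptional radii answers large partial quotients: they hold the orbit
    near 0 for many steps, during which D_n is constant and S_n grows only linearly, so that small
    powers of the denominators alone need not be summable. For a fixed x > 0 such orbit points are
    far from x, and the factor costs only a constant depending on x. *)

Lemma div_ge a b c : 0 < c -> a * c <= b -> a <= b / c.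
Proof. intros; now apply Rle_div_r. Qed.

Lemma div_le a b c : 0 < c -> a <= b * c -> a / c <= b.
Proof. intros; now apply Rle_div_l. Qed.

Lemma div_lt a b c : 0 < c -> a < b * c -> a / c < b.
Proof. intros; now apply Rlt_div_l. Qed.

(** * The real transfer operator *)

Definition Pr (f : R -> R) (x : R) : R := / (1 + x) ^ 2 * (f (f10 x) + f (f11 x)).
Definition Prn (n : nat) (f : R -> R) : R -> R := Nat.iter n Pr f.
Definition orb (beta : R) (n : nat) : R := Nat.iter n T1 beta.

Lemma f10_range x : 0 < x <= 1 -> 0 < f10 x <= 1/2.
Proof.
  intros [H1 H2]; unfold f10; split.
  - apply Rdiv_lt_0_compat; lra.
  - apply div_le; lra.
Qed.

Lemma f11_range x : 0 < x <= 1 -> 1/2 <= f11 x < 1.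
Proof.
  intros [H1 H2]; unfold f11; split.
  - apply div_ge; lra.
  - apply div_lt; lra.
Qed.

Lemma f10_range0 x : 0 <= x <= 1 -> 0 <= f10 x <= 1/2.
Proof.
  intros [[H1|<-] H2]; [pose proof (f10_range x); lra | unfold f10; lra].
Qed.

Lemma f11_range0 x : 0 <= x <= 1 -> 1/2 <= f11 x <= 1.
Proof.
  intros [[H1|<-] H2]; [pose proof (f11_range x); lra | unfold f11; lra].
Qed.

Lemma T1_f10 x : 0 <= x <= 1 -> T1 (f10 x) = x.
Proof.
  intros H; pose proof (f10_range0 x H); unfold T1.
  destruct (Rle_dec _ _); [|lra]. unfold f10; field; lra.
Qed.

Lemma T1_f11 x : 0 <= x <= 1 -> T1 (f11 x) = x.
Proof.
  intros H; pose proof (f11_range0 x H); unfold T1.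
  destruct (Rle_dec _ _) as [Hl|Hl].
  (* This case is [x = 1]: there [f11 x] is 1/2, which [T1] sends through its left formula. The two
     formulas agree at 1/2. *)
  - assert (E : f11 x = 1/2) by lra.
    assert (E' : 1 / f11 x = 2) by (rewrite E; lra).
    assert (1 / f11 x = 1 + x) by (unfold f11; field; lra).
    rewrite E; lra.
  - unfold f11; field; lra.
Qed.

Lemma T1_range x : 0 <= x <= 1 -> 0 <= T1 x <= 1.
Proof.
  intros H; unfold T1; destruct (Rle_dec _ _); split.
  - apply Rdiv_le_0_compat; lra.
  - apply div_le; lra.
  - apply Rdiv_le_0_compat; lra.
  - apply div_le; lra.
Qed.

Lemma orb_range beta n : 0 <= beta <= 1 -> 0 <= orb beta n <= 1.
Proof.
  intros H; induction n as [|n IH]; [exact H|].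
  change (orb beta (S n)) with (T1 (orb beta n)); apply T1_range, IH.
Qed.

Lemma T1_inv x : 0 <= x <= 1 ->
  x = if Rle_dec x (1/2) then f10 (T1 x) else f11 (T1 x).
Proof.
  intros H; unfold T1; destruct (Rle_dec x (1/2)); unfold f10, f11; field; lra.
Qed.

Lemma Prn_S n f x : Prn (S n) f x = / (1 + x) ^ 2 * (Prn n f (f10 x) + Prn n f (f11 x)).
Proof. reflexivity. Qed.

(** The single infinite value travels along the orbit. At any other point the iterate only involves
    values of [v] away from [beta], so the default 0 of [ER_real] is never consulted. *)
Lemma P1n_fin (v : R -> ER) beta n :
  (forall x, 0 <= x <= 1 -> x <> beta -> exists r, v x = Fin r) ->
  forall x, 0 <= x <= 1 -> orb beta n <> x ->
  P1n n v x = Fin (Prn n (fun y => ER_real (v y)) x).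
Proof.
  intros Hf; induction n as [|n IH]; intros x Hx Hn.
  - destruct (Hf x Hx) as [r Hr]; [intros ->; now apply Hn|].
    unfold P1n, Prn; simpl; now rewrite Hr.
  - pose proof (f10_range0 x Hx); pose proof (f11_range0 x Hx).
    change (P1n (S n) v x) with (P1 (P1n n v) x).
    change (orb beta (S n)) with (T1 (orb beta n)) in Hn.
    unfold P1; rewrite !IH; try lra.
    + unfold escale, eadd; f_equal; rewrite Prn_S; ring.
    + intros E; apply Hn; rewrite E; now apply T1_f11.
    + intros E; apply Hn; rewrite E; now apply T1_f10.
Qed.

Lemma P1n_inf (v : R -> ER) beta n :
  v beta = PInf -> 0 <= beta <= 1 -> P1n n v (orb beta n) = PInf.
Proof.
  intros Hv Hb; induction n as [|n IH]; [exact Hv|].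
  pose proof (orb_range beta n Hb) as Hr.
  change (P1n (S n) v (orb beta (S n))) with (P1 (P1n n v) (T1 (orb beta n))).
  pose proof (T1_inv _ Hr) as E; unfold P1.
  destruct (Rle_dec _ _); rewrite <- E, IH; simpl; [reflexivity|].
  destruct (P1n n v (f10 (T1 (orb beta n)))); reflexivity.
Qed.

Lemma Prn_add n m f : Prn (n + m) f = Prn n (Prn m f).
Proof. unfold Prn; induction n as [|n IH]; simpl; [reflexivity | now rewrite IH]. Qed.

Lemma inv_sq_pos x : 0 <= x -> 0 < / (1 + x) ^ 2.
Proof. intros; apply Rinv_0_lt_compat, pow_lt; lra. Qed.

Lemma Prn_le n f g : (forall y, 0 < y <= 1 -> f y <= g y) ->
  forall x, 0 < x <= 1 -> Prn n f x <= Prn n g x.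
Proof.
  intros H; induction n as [|n IH]; intros x Hx; [now apply H|].
  rewrite !Prn_S; apply Rmult_le_compat_l; [left; apply inv_sq_pos; lra|].
  pose proof (f10_range x Hx); pose proof (f11_range x Hx).
  apply Rplus_le_compat; apply IH; lra.
Qed.

Lemma Prn_plus n f g x : Prn n (fun y => f y + g y) x = Prn n f x + Prn n g x.
Proof.
  revert x; induction n as [|n IH]; intros x; [reflexivity|].
  rewrite !Prn_S, !IH; ring.
Qed.

Lemma Prn_scal n f c x : Prn n (fun y => c * f y) x = c * Prn n f x.
Proof.
  revert x; induction n as [|n IH]; intros x; [reflexivity|].
  rewrite !Prn_S, !IH; ring.
Qed.

Lemma Prn_nonneg n f : (forall y, 0 < y <= 1 -> 0 <= f y) ->
  forall x, 0 < x <= 1 -> 0 <= Prn n f x.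
Proof.
  intros H x Hx; replace 0 with (0 * Prn n f x) by ring.
  rewrite <- Prn_scal; apply Prn_le; auto; intros; rewrite Rmult_0_l; auto.
Qed.

(** * The normalised operator and its invariant cone *)

(* [Q] is [Pr] conjugated by the invariant density [1/x]; it is a Markov operator. *)
Definition Q (g : R -> R) (x : R) : R := (g (f10 x) + x * g (f11 x)) / (1 + x).
Definition Qn (n : nat) (g : R -> R) : R -> R := Nat.iter n Q g.

Lemma Qn_S n g x : Qn (S n) g x = (Qn n g (f10 x) + x * Qn n g (f11 x)) / (1 + x).
Proof. reflexivity. Qed.

Lemma Qn_Prn n f g : (forall y, 0 < y <= 1 -> g y = y * f y) ->
  forall x, 0 < x <= 1 -> Qn n g x = x * Prn n f x.
Proof.
  intros H; induction n as [|n IH]; intros x Hx; [now apply H|].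
  pose proof (f10_range x Hx); pose proof (f11_range x Hx).
  rewrite Qn_S, Prn_S, !IH; try lra. unfold f10, f11; field; lra.
Qed.

Lemma Qn_le n f g : (forall y, 0 < y <= 1 -> f y <= g y) ->
  forall x, 0 < x <= 1 -> Qn n f x <= Qn n g x.
Proof.
  intros H; induction n as [|n IH]; intros x Hx; [now apply H|].
  rewrite !Qn_S; apply Rmult_le_compat_r; [left; apply Rinv_0_lt_compat; lra|].
  pose proof (f10_range x Hx); pose proof (f11_range x Hx).
  apply Rplus_le_compat; [|apply Rmult_le_compat_l; [lra|]]; apply IH; lra.
Qed.

Lemma Qn_lin n f g a b x :
  0 <= x -> Qn n (fun y => a * f y + b * g y) x = a * Qn n f x + b * Qn n g x.
Proof.
  revert x; induction n as [|n IH]; intros x Hx; [reflexivity|].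
  assert (0 <= f10 x) by (unfold f10; apply Rdiv_le_0_compat; lra).
  assert (0 <= f11 x) by (unfold f11; apply Rdiv_le_0_compat; lra).
  rewrite !Qn_S, !IH by auto; field; lra.
Qed.

(** Integrals of [g x / x] start at a positive point, so continuity is stated for [x > 0]; it
    reaches beyond 1 to be two-sided at 1. *)
Record cone (g : R -> R) : Prop := {
  cone_cont : forall x, 0 < x -> continuous g x;
  cone_pos : forall x, 0 <= x <= 1 -> 0 <= g x;
  cone_incr : forall x y, 0 <= x -> x <= y -> y <= 1 -> g x <= g y;
  cone_conc : forall a b t, 0 <= a <= 1 -> 0 <= b <= 1 -> 0 <= t <= 1 ->
    t * g a + (1 - t) * g b <= g (t * a + (1 - t) * b) }.

Lemma convex_comb_range a b t u v : u <= a <= v -> u <= b <= v -> 0 <= t <= 1 ->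
  u <= t * a + (1 - t) * b <= v.
Proof. intros; split; nra. Qed.

Section ConeStep.
Variable g : R -> R.
Hypothesis Hg : cone g.

(* With s = x/(1+x), [Q g x = sym s]; [sym] is concave and symmetric about 1/2,
   hence nondecreasing on [0,1/2]. *)
Let sym (s : R) : R := (1 - s) * g s + s * g (1 - s).

(** The factor [1 - s] decreases while [g] does not, so the cross term
    [t (1 - t) (a - b) (g a - g b)] is nonnegative and the concavity of [g] passes to the
    product. *)
Let half_concave a b t : 0 <= a <= 1 -> 0 <= b <= 1 -> 0 <= t <= 1 ->
  t * ((1 - a) * g a) + (1 - t) * ((1 - b) * g b) <=
  (1 - (t * a + (1 - t) * b)) * g (t * a + (1 - t) * b).
Proof.
  intros Ha Hb Ht.
  pose proof (cone_conc g Hg a b t Ha Hb Ht) as Hc.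
  pose proof (convex_comb_range a b t 0 1 Ha Hb Ht) as Hr.
  set (s := t * a + (1 - t) * b) in *.
  assert (0 <= (a - b) * (g a - g b)).
  { destruct (Rle_dec a b).
    - pose proof (cone_incr g Hg a b); nra.
    - pose proof (cone_incr g Hg b a); nra. }
  assert (Hm : (1 - s) * (t * g a + (1 - t) * g b) <= (1 - s) * g s).
  { apply Rmult_le_compat_l; lra. }
  assert (E : (1 - s) * (t * g a + (1 - t) * g b) =
     t * ((1 - a) * g a) + (1 - t) * ((1 - b) * g b) +
     (t * (1 - t)) * ((a - b) * (g a - g b))) by (unfold s; ring).
  assert (0 <= (t * (1 - t)) * ((a - b) * (g a - g b))).
  { apply Rmult_le_pos; [apply Rmult_le_pos; lra | assumption]. }
  lra.
Qed.

Let sym_concave a b t : 0 <= a <= 1 -> 0 <= b <= 1 -> 0 <= t <= 1 ->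
  t * sym a + (1 - t) * sym b <= sym (t * a + (1 - t) * b).
Proof.
  intros Ha Hb Ht; unfold sym.
  pose proof (half_concave a b t Ha Hb Ht) as H1.
  assert (H2 := half_concave (1 - a) (1 - b) t ltac:(lra) ltac:(lra) Ht).
  replace (t * (1 - a) + (1 - t) * (1 - b)) with (1 - (t * a + (1 - t) * b)) in H2 by ring.
  replace (1 - (1 - (t * a + (1 - t) * b))) with (t * a + (1 - t) * b) in H2 by ring.
  replace (1 - (1 - a)) with a in H2 by ring.
  replace (1 - (1 - b)) with b in H2 by ring.
  lra.
Qed.

Let sym_incr s t : 0 <= s -> s <= t -> t <= 1/2 -> sym s <= sym t.
Proof.
  intros H0 Hst Ht.
  destruct (Req_dec s (1/2)) as [->|Hs]; [replace t with (1/2) by lra; lra|].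
  assert (Hd : 0 < 1 - 2 * s) by lra.
  set (m := (t - s) / (1 - 2 * s)).
  assert (0 <= m <= 1).
  { split; [apply Rdiv_le_0_compat; lra | apply div_le; lra]. }
  assert (Hc := sym_concave (1 - s) s m ltac:(lra) ltac:(lra) ltac:(lra)).
  replace (m * (1 - s) + (1 - m) * s) with t in Hc by (unfold m; field; lra).
  assert (sym (1 - s) = sym s).
  { unfold sym; replace (1 - (1 - s)) with s by ring; ring. }
  nra.
Qed.

Let Q_sym x : 0 <= x -> Q g x = sym (f10 x).
Proof.
  intros; unfold Q, sym.
  replace (f11 x) with (1 - f10 x) by (unfold f10, f11; field; lra).
  generalize (g (f10 x)), (g (1 - f10 x)); intros u v.
  unfold f10; field; lra.
Qed.

Lemma f10_incr x y : 0 <= x -> x <= y -> f10 x <= f10 y.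
Proof.
  intros; unfold f10. apply div_le; [lra|].
  replace (y / (1 + y) * (1 + x)) with ((y * (1 + x)) / (1 + y)) by (field; lra).
  apply div_ge; nra.
Qed.

Lemma f10_concave a b t : 0 <= a -> 0 <= b -> 0 <= t <= 1 ->
  t * f10 a + (1 - t) * f10 b <= f10 (t * a + (1 - t) * b).
Proof.
  intros Ha Hb Ht; unfold f10.
  set (s := t * a + (1 - t) * b). assert (0 <= s) by (unfold s; nra).
  apply Rminus_le.
  replace (t * (a / (1 + a)) + (1 - t) * (b / (1 + b)) - s / (1 + s)) with
    (- (t * (1 - t) * (a - b) ^ 2) / ((1 + a) * (1 + b) * (1 + s))) by
    (unfold s in *; field; lra).
  assert (0 <= t * (1 - t) * (a - b) ^ 2).
  { apply Rmult_le_pos; [nra | apply pow2_ge_0]. }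
  apply div_le; [apply Rlt_gt; repeat apply Rmult_lt_0_compat; lra | lra].
Qed.

Lemma continuous_f10 x : 0 < x -> continuous f10 x.
Proof.
  intros; apply (ex_derive_continuous (V := R_NormedModule)).
  exists (/ (1 + x) ^ 2); unfold f10; auto_derive; [lra | field; lra].
Qed.

Lemma continuous_f11 x : 0 < x -> continuous f11 x.
Proof.
  intros; apply (ex_derive_continuous (V := R_NormedModule)).
  exists (- / (1 + x) ^ 2); unfold f11; auto_derive; [lra | field; lra].
Qed.

(** [Q g] is [sym] after [f10]: a concave function, nondecreasing on [0,1/2], of a concave
    nondecreasing one with values in [0,1/2]. *)
Lemma cone_Q : cone (Q g).
Proof.
  split.
  - intros x Hx. unfold Q, Rdiv.
    assert (0 < f10 x) by (unfold f10; apply Rdiv_lt_0_compat; lra).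
    assert (0 < f11 x) by (unfold f11; apply Rdiv_lt_0_compat; lra).
    apply (continuous_mult (K := R_AbsRing)).
    + apply (continuous_plus (V := R_NormedModule)).
      * apply (continuous_comp f10 g); [now apply continuous_f10 | now apply cone_cont].
      * apply (continuous_mult (K := R_AbsRing)); [apply continuous_id|].
        apply (continuous_comp f11 g); [now apply continuous_f11 | now apply cone_cont].
    + apply (ex_derive_continuous (V := R_NormedModule)).
      exists (- / (1 + x) ^ 2); auto_derive; [lra | field; lra].
  - intros x Hx. pose proof (f10_range0 x Hx); pose proof (f11_range0 x Hx).
    unfold Q; apply Rdiv_le_0_compat; [|lra].
    assert (0 <= g (f10 x)) by (apply cone_pos; auto; lra).
    assert (0 <= g (f11 x)) by (apply cone_pos; auto; lra). nra.
  - intros x y Hx Hxy Hy. rewrite !Q_sym by lra.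
    apply sym_incr; [apply f10_range0; lra | apply f10_incr; lra | apply f10_range0; lra].
  - intros a b t Ha Hb Ht.
    pose proof (convex_comb_range a b t 0 1 Ha Hb Ht) as Hr.
    rewrite !Q_sym by lra.
    pose proof (f10_range0 a Ha) as Ha'; pose proof (f10_range0 b Hb) as Hb'.
    eapply Rle_trans; [apply sym_concave; lra|].
    pose proof (convex_comb_range (f10 a) (f10 b) t _ _ Ha' Hb' Ht).
    apply sym_incr; [lra | apply f10_concave; lra | apply f10_range0; lra].
Qed.

(* Jensen: [Q g x <= g (2x/(1+x)^2)], and [2x/(1+x)^2 <= x] as soon as [(1+x)^2 >= 2]. *)
Lemma Q_le_self x : 1/2 <= x <= 1 -> Q g x <= g x.
Proof.
  intros Hx.
  assert (H0 := f10_range0 x ltac:(lra)); assert (H1 := f11_range0 x ltac:(lra)).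
  assert (Ht : 0 <= / (1 + x) <= 1).
  { split; [left; apply Rinv_0_lt_compat; lra | rewrite <- Rinv_1; apply Rinv_le_contravar; lra]. }
  assert (Hc := cone_conc g Hg (f10 x) (f11 x) (/ (1 + x)) ltac:(lra) ltac:(lra) Ht).
  replace (Q g x) with (/ (1 + x) * g (f10 x) + (1 - / (1 + x)) * g (f11 x))
    by (unfold Q; field; lra).
  eapply Rle_trans; [exact Hc|].
  replace (/ (1 + x) * f10 x + (1 - / (1 + x)) * f11 x) with (2 * x / (1 + x) ^ 2)
    by (unfold f10, f11; field; lra).
  apply cone_incr; auto; [| |lra].
  - apply Rdiv_le_0_compat; [lra | nra].
  - apply div_le; nra.
Qed.

End ConeStep.

Lemma cone_Qn g n : cone g -> cone (Qn n g).
Proof. intros H; induction n as [|n IH]; [exact H | now apply cone_Q]. Qed.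

(** Both branches send 1 to 1/2. By monotonicity [Qn (S n) g 1] is thus a lower bound for [Qn n g]
    on [1/2,1], the range of [f11]. *)
Lemma Qn_half g n : Qn n g (1/2) = Qn (S n) g 1.
Proof.
  rewrite Qn_S; unfold f10, f11.
  replace (1 / (1 + 1)) with (1/2) by lra. field.
Qed.

Lemma Qn_le_top g n x : cone g -> 0 <= x <= 1 -> Qn n g x <= Qn n g 1.
Proof. intros Hg Hx; apply cone_incr; [now apply cone_Qn | lra..]. Qed.

Lemma Qn_top_decr g n m : cone g -> (n <= m)%nat -> Qn m g 1 <= Qn n g 1.
Proof.
  intros Hg; induction 1 as [|m Hm IH]; [lra|].
  eapply Rle_trans; [|exact IH]. apply (Q_le_self _ (cone_Qn g m Hg)); lra.
Qed.

(* In probabilistic terms: starting from x the chain returns to [1/2,1] within n steps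
   with probability nx/(1+nx). *)
Lemma Qn_lower g n : cone g -> forall x, 0 <= x <= 1 ->
  INR n * x / (1 + INR n * x) * Qn n g 1 <= Qn n g x.
Proof.
  intros Hg; induction n as [|n IH]; intros x Hx.
  - simpl; unfold Rdiv; rewrite !Rmult_0_l; now apply (cone_pos g Hg).
  - pose proof (pos_INR n) as Hn.
    pose proof (f10_range0 x Hx) as H0; pose proof (f11_range0 x Hx) as H1.
    set (U := Qn (S n) g 1).
    assert (HU0 : 0 <= U) by (apply cone_pos; [now apply cone_Qn | lra]).
    assert (HU : U <= Qn n g 1) by (apply Qn_top_decr; auto).
    assert (A1 : U <= Qn n g (f11 x)).
    { unfold U; rewrite <- Qn_half; apply cone_incr; [now apply cone_Qn | lra..]. }
    assert (A0 : INR n * f10 x / (1 + INR n * f10 x) * U <= Qn n g (f10 x)).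
    { eapply Rle_trans; [|apply IH; lra]. apply Rmult_le_compat_l; auto.
      apply Rdiv_le_0_compat; nra. }
    rewrite S_INR.
    (* With [p_n x = n x / (1 + n x)] this is the recursion
       [p_(n+1) x = (p_n (f10 x) + x) / (1 + x)]. *)
    replace ((INR n + 1) * x / (1 + (INR n + 1) * x) * U) with
      ((INR n * f10 x / (1 + INR n * f10 x) * U + x * U) / (1 + x)).
    2:{ unfold f10; field; repeat split; nra. }
    rewrite Qn_S; apply Rmult_le_compat_r; [left; apply Rinv_0_lt_compat; lra|].
    apply Rplus_le_compat; [exact A0 | apply Rmult_le_compat_l; lra].
Qed.

(** * Asymptotics on the cone *)

Lemma Rmin_max_range a b x : a <= b -> Rmin a b <= x <= Rmax a b -> a <= x <= b.
Proof. intros H; rewrite Rmin_left, Rmax_right; auto. Qed.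

Lemma Rmin_max_range_lt a b x : a <= b -> Rmin a b < x < Rmax a b -> a < x < b.
Proof. intros H; rewrite Rmin_left, Rmax_right; auto. Qed.

Lemma continuous_Rinv x : x <> 0 -> continuous Rinv x.
Proof.
  intros Hx; apply (ex_derive_continuous (V := R_NormedModule)).
  exists (- / x ^ 2); auto_derive; [auto | field; auto].
Qed.

Lemma continuous_div_id (g : R -> R) x : 0 < x -> continuous g x -> continuous (fun y => g y / y) x.
Proof.
  intros; apply (continuous_mult (K := R_AbsRing)); [auto | apply continuous_Rinv; lra].
Qed.

Lemma ex_RInt_pos (f : R -> R) a b : 0 < a -> a <= b -> (forall x, 0 < x -> continuous f x) ->
  ex_RInt f a b.
Proof.
  intros Ha Hab Hf; apply (ex_RInt_continuous (V := R_CompleteNormedModule)).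
  intros z Hz; apply (Rmin_max_range a b z Hab) in Hz; apply Hf; lra.
Qed.

Lemma RInt_Chasles_R (f : R -> R) a b c : ex_RInt f a b -> ex_RInt f b c ->
  RInt f a c = RInt f a b + RInt f b c.
Proof. intros; symmetry; now apply (RInt_Chasles (V := R_CompleteNormedModule)). Qed.

Lemma RInt_ext_R (f g : R -> R) a b : a <= b -> (forall x, a < x < b -> f x = g x) ->
  RInt f a b = RInt g a b.
Proof.
  intros Hab H; apply (RInt_ext (V := R_CompleteNormedModule)).
  intros x Hx; apply H, Rmin_max_range_lt; auto.
Qed.

(** Change of variables along both branches. [f11] reverses orientation, and the images [f10 c, 1/2]
    and [1/2, f11 c] meet at the common value 1/2 of the branches at 1. *)
Lemma RInt_Pr (f : R -> R) c : (forall x, 0 < x -> continuous f x) -> 0 < c <= 1 ->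
  RInt (Pr f) c 1 = RInt f (f10 c) (f11 c).
Proof.
  intros Hf Hc.
  assert (A0 : is_RInt (fun y => / (1 + y) ^ 2 * f (f10 y)) c 1 (RInt f (f10 c) (f10 1))).
  { apply (is_RInt_comp (V := R_CompleteNormedModule) f f10 (fun y => / (1 + y) ^ 2)).
    - intros x Hx; apply Rmin_max_range in Hx; [|lra].
      apply Hf; unfold f10; apply Rdiv_lt_0_compat; lra.
    - intros x Hx; apply Rmin_max_range in Hx; [|lra]. split.
      + unfold f10; auto_derive; [lra | field; lra].
      + apply (ex_derive_continuous (V := R_NormedModule)).
        exists (- 2 / (1 + x) ^ 3); auto_derive; [nra | field; lra]. }
  assert (A1 : is_RInt (fun y => - / (1 + y) ^ 2 * f (f11 y)) c 1 (RInt f (f11 c) (f11 1))).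
  { apply (is_RInt_comp (V := R_CompleteNormedModule) f f11 (fun y => - / (1 + y) ^ 2)).
    - intros x Hx; apply Rmin_max_range in Hx; [|lra].
      apply Hf; unfold f11; apply Rdiv_lt_0_compat; lra.
    - intros x Hx; apply Rmin_max_range in Hx; [|lra]. split.
      + unfold f11; auto_derive; [lra | field; lra].
      + apply (ex_derive_continuous (V := R_NormedModule)).
        exists (2 / (1 + x) ^ 3); auto_derive; [nra | field; lra]. }
  assert (H10 : f10 1 = 1/2) by (unfold f10; lra).
  assert (H11 : f11 1 = 1/2) by (unfold f11; lra).
  rewrite H10 in A0; rewrite H11 in A1.
  pose proof (f10_range c Hc); pose proof (f11_range c Hc).
  rewrite (RInt_Chasles_R f (f10 c) (1/2) (f11 c)) by (apply ex_RInt_pos; auto; lra).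
  rewrite <- (opp_RInt_swap f (f11 c) (1/2)).
  2:{ apply ex_RInt_swap, ex_RInt_pos; auto; lra. }
  apply is_RInt_unique.
  apply (is_RInt_ext (fun y => minus (/ (1 + y) ^ 2 * f (f10 y)) (- / (1 + y) ^ 2 * f (f11 y)))).
  { intros x _; unfold Pr, minus, plus, opp; simpl; ring. }
  apply (is_RInt_minus (V := R_NormedModule)); assumption.
Qed.

Definition Fn (g : R -> R) (n : nat) (x : R) : R := Qn n g x / x.

Lemma Fn_cont g n x : cone g -> 0 < x -> continuous (Fn g n) x.
Proof.
  intros Hg Hx; apply continuous_div_id; auto. apply cone_cont; auto; now apply cone_Qn.
Qed.

Lemma Fn_pos g n x : cone g -> 0 < x <= 1 -> 0 <= Fn g n x.
Proof.
  intros Hg Hx; unfold Fn; apply Rdiv_le_0_compat; [|lra].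
  apply cone_pos; [now apply cone_Qn | lra].
Qed.

Lemma RInt_Fn_S g n c : cone g -> 0 < c <= 1 ->
  RInt (Fn g (S n)) c 1 = RInt (Fn g n) (f10 c) (f11 c).
Proof.
  intros Hg Hc; rewrite <- RInt_Pr; auto; [|intros; now apply Fn_cont].
  apply RInt_ext_R; [lra|]; intros x Hx.
  unfold Fn, Pr; rewrite Qn_S; unfold f10, f11; field; lra.
Qed.

(** The induction runs over all [c] at once: one step replaces [c,1] by [f10 c, f11 c], which lies
    in [f10 c, 1]. *)
Lemma RInt_Fn_le g I : cone g -> (forall c, 0 < c <= 1 -> RInt (Fn g 0) c 1 <= I) ->
  forall n c, 0 < c <= 1 -> RInt (Fn g n) c 1 <= I.
Proof.
  intros Hg HI n; induction n as [|n IH]; intros c Hc; [now apply HI|].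
  rewrite RInt_Fn_S by auto.
  pose proof (f10_range c Hc); pose proof (f11_range c Hc).
  assert (Hcont : forall x, 0 < x -> continuous (Fn g n) x) by (intros; now apply Fn_cont).
  eapply Rle_trans; [|apply (IH (f10 c)); lra].
  rewrite (RInt_Chasles_R _ (f10 c) (f11 c) 1) by (apply ex_RInt_pos; auto; lra).
  assert (0 <= RInt (Fn g n) (f11 c) 1).
  { apply RInt_ge_0; [lra | apply ex_RInt_pos; auto; lra |].
    intros; apply Fn_pos; auto; lra. }
  lra.
Qed.

(** A step loses only the integral over [f11 c, 1], an interval of length [c / (1 + c)] on which the
    integrand is at most [(1 + c) g 1]; the integral over [f10 c, c] is gained. *)
Lemma RInt_Fn_ge g n c : cone g -> 0 < c <= 1/2 ->
  RInt (Fn g 0) c 1 - INR n * c * g 1 <= RInt (Fn g n) c 1.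
Proof.
  intros Hg Hc; induction n as [|n IH]; [simpl; lra|].
  rewrite RInt_Fn_S by (auto; lra).
  assert (H0 := f10_range c ltac:(lra)); assert (H1 := f11_range c ltac:(lra)).
  assert (f10 c <= c) by (unfold f10; apply div_le; nra).
  assert (Hcont : forall x, 0 < x -> continuous (Fn g n) x) by (intros; now apply Fn_cont).
  rewrite (RInt_Chasles_R _ (f10 c) c (f11 c)) by (apply ex_RInt_pos; auto; lra).
  rewrite (RInt_Chasles_R (Fn g n) c (f11 c) 1) in IH by (apply ex_RInt_pos; auto; lra).
  assert (0 <= RInt (Fn g n) (f10 c) c).
  { apply RInt_ge_0; [lra | apply ex_RInt_pos; auto; lra |].
    intros; apply Fn_pos; auto; lra. }
  assert (RInt (Fn g n) (f11 c) 1 <= c * g 1).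
  { assert (E : RInt (fun _ => (1 + c) * g 1) (f11 c) 1 = c * g 1).
    { rewrite (RInt_const (V := R_CompleteNormedModule)).
      unfold scal; simpl; unfold mult; simpl; unfold f11; field; lra. }
    rewrite <- E. apply RInt_le; [lra | apply ex_RInt_pos; auto; lra | apply ex_RInt_const |].
    intros x Hx; unfold Fn. apply div_le; [lra|].
    assert (Qn n g x <= g 1).
    { eapply Rle_trans; [apply Qn_le_top; auto; lra|]. apply (Qn_top_decr g 0 n); auto; lia. }
    assert (0 <= g 1) by (apply cone_pos; auto; lra).
    assert (1 <= (1 + c) * x).
    { apply Rle_trans with ((1 + c) * f11 c); [right; unfold f11; field; lra|].
      apply Rmult_le_compat_l; lra. }
    nra. }
  rewrite S_INR; lra.
Qed.

Lemma is_RInt_inv_ab a b : 0 < a -> a <= b -> is_RInt Rinv a b (ln b - ln a).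
Proof.
  intros Ha Hab.
  apply (is_RInt_derive (V := R_CompleteNormedModule) ln Rinv);
    intros x Hx; apply Rmin_max_range in Hx; try lra.
  - apply is_derive_Reals, derivable_pt_lim_ln; lra.
  - apply continuous_Rinv; lra.
Qed.

Lemma is_RInt_inv c : 0 < c <= 1 -> is_RInt Rinv c 1 (- ln c).
Proof.
  intros Hc; replace (- ln c) with (ln 1 - ln c) by (rewrite ln_1; ring).
  apply is_RInt_inv_ab; lra.
Qed.

Lemma ln_1p_le u : 0 <= u -> ln (1 + u) <= u.
Proof.
  intros; rewrite <- (ln_exp u) at 2; apply ln_le; [lra | apply exp_ineq1_le].
Qed.

Lemma le_of_le_small x y k : 0 <= k -> (forall c, 0 < c <= 1 -> x <= y + k * c) -> x <= y.
Proof.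
  intros Hk H; apply le_epsilon; intros e He.
  destruct (Rle_dec (e / (k + 1)) 1).
  - specialize (H (e / (k + 1)) ltac:(split; [apply Rdiv_lt_0_compat; lra | auto])).
    assert (k * (e / (k + 1)) <= e).
    { replace (k * (e / (k + 1))) with (k * e / (k + 1)) by (field; lra). apply div_le; nra. }
    lra.
  - specialize (H 1 ltac:(lra)).
    assert (k + 1 <= e).
    { apply Rnot_le_lt in n. apply Rmult_lt_compat_r with (r := k + 1) in n; [|lra].
      replace (e / (k + 1) * (k + 1)) with e in n by (field; lra). lra. }
    lra.
Qed.

(** Dividing [Qn_lower] by x and integrating over [c,1] gives [U_n (ln (1 + n) - ln (1 + n c)) <= I]
    with [U_n = Qn n g 1]; then c tends to 0. *)
Theorem cone_upper g I n : cone g -> (forall c, 0 < c <= 1 -> RInt (Fn g 0) c 1 <= I) ->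
  Qn n g 1 * ln (1 + INR n) <= I.
Proof.
  intros Hg HI. pose proof (pos_INR n) as Hn.
  assert (HU : 0 <= Qn n g 1) by (apply cone_pos; [now apply cone_Qn | lra]).
  apply (le_of_le_small _ _ (Qn n g 1 * INR n)); [nra|]. intros c Hc.
  assert (A : is_RInt (fun x => Qn n g 1 * (INR n / (1 + INR n * x))) c 1
     (Qn n g 1 * (ln (1 + INR n) - ln (1 + INR n * c)))).
  { apply (is_RInt_scal (V := R_NormedModule)).
    replace (ln (1 + INR n) - ln (1 + INR n * c)) with
      (minus (ln (1 + INR n * 1)) (ln (1 + INR n * c)))
      by (rewrite Rmult_1_r; reflexivity).
    apply (is_RInt_derive (V := R_CompleteNormedModule) (fun x => ln (1 + INR n * x)));
      intros x Hx; apply Rmin_max_range in Hx; try lra; assert (0 < 1 + INR n * x) by nra.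
    - auto_derive; [lra | field; lra].
    - apply (ex_derive_continuous (V := R_NormedModule)). auto_derive; lra. }
  assert (B := RInt_Fn_le g I Hg HI n c Hc).
  assert (D : RInt (fun x => Qn n g 1 * (INR n / (1 + INR n * x))) c 1 <= RInt (Fn g n) c 1).
  { apply RInt_le; [lra | eexists; apply A | apply ex_RInt_pos; [lra..|] |].
    - intros; now apply Fn_cont.
    - intros x Hx; unfold Fn. apply div_ge; [lra|].
      eapply Rle_trans; [|apply Qn_lower; auto; lra]. right; field. nra. }
  rewrite (is_RInt_unique _ _ _ _ A) in D.
  assert (ln (1 + INR n * c) <= INR n * c) by (apply ln_1p_le; nra).
  nra.
Qed.

Lemma ln_large M : exists N : nat, forall n, (N <= n)%nat -> M <= ln (INR n) /\ (1 <= n)%nat.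
Proof.
  destruct (INR_unbounded (exp M)) as [N HN]. exists (S N); intros n Hn.
  split; [|lia]. apply le_INR in Hn; rewrite S_INR in Hn.
  rewrite <- (ln_exp M); apply ln_le; [apply exp_pos | lra].
Qed.

Definition unif_lim (g : R -> R) (L : R) : Prop :=
  forall a eps, 0 < a -> 0 < eps -> exists N : nat, forall n, (N <= n)%nat ->
    forall x, a <= x <= 1 -> Rabs (ln (INR n) * Qn n g x - L) < eps.

(** The cut-off is [c = 1 / (L n)]. In n steps at most [n c g 1 = g 1 / L] is lost, and the mass on
    [c,1] is at most [U_n (ln L + ln n)], where [U_n ln L] is negligible by [cone_upper]. *)
Lemma cone_lower g I : cone g ->
  (forall c, 0 < c <= 1 -> RInt (Fn g 0) c 1 <= I) ->
  (forall e, 0 < e -> exists c0, 0 < c0 /\ forall c, 0 < c <= 1 -> c <= c0 ->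
     I - e <= RInt (Fn g 0) c 1) ->
  forall e, 0 < e -> exists N : nat, forall n, (N <= n)%nat -> I - e <= Qn n g 1 * ln (INR n).
Proof.
  intros Hg HI HI2 e He.
  assert (Hg1 : 0 <= g 1) by (apply cone_pos; auto; lra).
  destruct (HI2 (e/4) ltac:(lra)) as [c0 [Hc0 Hc]].
  set (L := 1 + 4 * g 1 / e).
  assert (HL0 : 0 <= 4 * g 1 / e) by (apply Rdiv_le_0_compat; lra).
  assert (HL : 1 <= L) by (unfold L; lra).
  assert (HLg : g 1 / L <= e / 4).
  { apply div_le; [lra|]. unfold L.
    replace (e / 4 * (1 + 4 * g 1 / e)) with (e/4 + g 1) by (field; lra). lra. }
  assert (HlnL : 0 <= ln L) by (rewrite <- ln_1; apply ln_le; lra).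
  assert (HI0 : 0 <= I).
  { eapply Rle_trans; [|apply (HI 1); lra].
    rewrite RInt_point; unfold zero; simpl; lra. }
  (* Large enough that [U_n ln L <= I ln L / ln n] falls below [e / 4]. *)
  destruct (ln_large (4 * (I * ln L) / e + 1)) as [N1 HN1].
  destruct (INR_unbounded (/ c0 + 2)) as [N2 HN2].
  exists (N1 + N2)%nat; intros n Hn.
  assert (Hn1 : / c0 + 2 <= INR n).
  { apply Rle_trans with (INR N2); [lra | apply le_INR; lia]. }
  assert (0 < / c0) by (now apply Rinv_0_lt_compat).
  destruct (HN1 n ltac:(lia)) as [Hln _].
  assert (HLn : 2 <= L * INR n) by nra.
  set (c := / (L * INR n)).
  assert (Hc1 : 0 < c <= 1/2).
  { unfold c; split; [apply Rinv_0_lt_compat; lra|].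
    replace (1/2) with (/2) by lra. apply Rinv_le_contravar; lra. }
  assert (Hcc : c <= c0).
  { unfold c. rewrite <- (Rinv_inv c0). apply Rinv_le_contravar; nra. }
  specialize (Hc c ltac:(lra) Hcc).
  pose proof (RInt_Fn_ge g n c Hg Hc1) as A.
  assert (B : RInt (Fn g n) c 1 <= Qn n g 1 * - ln c).
  { assert (D : is_RInt (fun x => Qn n g 1 * / x) c 1 (Qn n g 1 * - ln c)).
    { apply (is_RInt_scal (V := R_NormedModule)), is_RInt_inv; lra. }
    rewrite <- (is_RInt_unique _ _ _ _ D).
    apply RInt_le; [lra | apply ex_RInt_pos; [lra..|] | eexists; apply D |].
    - intros; now apply Fn_cont.
    - intros x Hx; unfold Fn, Rdiv; apply Rmult_le_compat_r.
      + left; apply Rinv_0_lt_compat; lra.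
      + apply Qn_le_top; auto; lra. }
  assert (E1 : INR n * c * g 1 = g 1 / L) by (unfold c; field; split; lra).
  assert (E2 : - ln c = ln L + ln (INR n)).
  { unfold c; rewrite ln_Rinv, ln_mult; lra. }
  rewrite E1 in A; rewrite E2 in B.
  assert (HU : 0 <= Qn n g 1) by (apply cone_pos; [now apply cone_Qn | lra]).
  pose proof (cone_upper g I n Hg HI) as HU2.
  assert (Hln2 : ln (INR n) <= ln (1 + INR n)) by (apply ln_le; lra).
  assert (Hx : 0 <= 4 * (I * ln L) / e) by (apply Rdiv_le_0_compat; nra).
  assert (HUL : Qn n g 1 * ln L <= e / 4).
  { assert (HU3 : Qn n g 1 * ln (INR n) <= I) by nra.
    apply Rmult_le_reg_r with (ln (INR n)); [lra|].
    apply Rle_trans with (I * ln L); [nra|].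
    apply Rle_trans with (e / 4 * (4 * (I * ln L) / e + 1)); [|apply Rmult_le_compat_l; lra].
    replace (e / 4 * (4 * (I * ln L) / e + 1)) with (I * ln L + e / 4) by (field; lra). lra. }
  lra.
Qed.

Theorem cone_unif_lim g I : cone g ->
  (forall c, 0 < c <= 1 -> RInt (Fn g 0) c 1 <= I) ->
  (forall e, 0 < e -> exists c0, 0 < c0 /\ forall c, 0 < c <= 1 -> c <= c0 ->
     I - e <= RInt (Fn g 0) c 1) ->
  unif_lim g I.
Proof.
  intros Hg HI HI2 a eps Ha He.
  destruct (cone_lower g I Hg HI HI2 (eps/2) ltac:(lra)) as [N1 HN1].
  assert (HI0 : 0 <= I).
  { eapply Rle_trans; [|apply (HI 1); lra].
    rewrite RInt_point; unfold zero; simpl; lra. }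
  destruct (INR_unbounded (4 * I / (eps * a) + 1)) as [N2 HN2].
  exists (N1 + N2)%nat; intros n Hn x Hx.
  specialize (HN1 n ltac:(lia)).
  assert (H0 : 0 <= 4 * I / (eps * a)) by (apply Rdiv_le_0_compat; nra).
  assert (Hn1 : 4 * I / (eps * a) + 1 <= INR n).
  { apply Rle_trans with (INR N2); [lra | apply le_INR; lia]. }
  assert (HU : 0 <= Qn n g 1) by (apply cone_pos; [now apply cone_Qn | lra]).
  pose proof (cone_upper g I n Hg HI) as HU2.
  assert (Hln0 : 0 <= ln (INR n)) by (rewrite <- ln_1; apply ln_le; lra).
  assert (Hln2 : ln (INR n) <= ln (1 + INR n)) by (apply ln_le; lra).
  assert (HU3 : Qn n g 1 * ln (INR n) <= I) by nra.
  assert (Ht := Qn_le_top g n x Hg ltac:(lra)).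
  assert (Hl := Qn_lower g n Hg x ltac:(lra)).
  assert (Hup : ln (INR n) * Qn n g x <= I) by nra.
  set (q := INR n * x / (1 + INR n * x)) in *.
  (* The deficit [1 - q = 1 / (1 + n x)] is at most [1 / (n a)], uniformly in [x >= a]. *)
  assert (Hq : (1 - q) * I <= eps / 4).
  { replace (1 - q) with (/ (1 + INR n * x)) by (unfold q; field; nra).
    rewrite Rmult_comm. apply div_le; [nra|].
    apply Rle_trans with (eps / 4 * ((4 * I / (eps * a)) * a)).
    - right; field; lra.
    - apply Rmult_le_compat_l; [lra|]. nra. }
  assert (Hq0 : 0 <= 1 - q).
  { replace (1 - q) with (/ (1 + INR n * x)) by (unfold q; field; nra).
    left; apply Rinv_0_lt_compat; nra. }
  assert (Hlow : q * (Qn n g 1 * ln (INR n)) <= ln (INR n) * Qn n g x) by nra.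
  apply Rabs_def1; [lra|].
  assert ((1 - q) * (Qn n g 1 * ln (INR n)) <= eps / 4).
  { eapply Rle_trans; [|exact Hq]. apply Rmult_le_compat_l; lra. }
  lra.
Qed.

(** * Step functions and powers *)

Lemma unif_lim_ext f g L : (forall y, 0 < y <= 1 -> f y = g y) -> unif_lim f L -> unif_lim g L.
Proof.
  intros H Hf a eps Ha He; destruct (Hf a eps Ha He) as [N HN].
  exists N; intros n Hn x Hx.
  replace (Qn n g x) with (Qn n f x); [now apply HN|].
  apply Rle_antisym; apply Qn_le; try lra; intros y Hy; rewrite (H y Hy); lra.
Qed.

Lemma unif_lim_lin f g A B a b : unif_lim f A -> unif_lim g B ->
  unif_lim (fun y => a * f y + b * g y) (a * A + b * B).
Proof.
  intros Hf Hg c eps Hc He.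
  pose proof (Rabs_pos a) as Ha; pose proof (Rabs_pos b) as Hb.
  set (M := Rabs a + Rabs b + 1).
  assert (HM : 0 < M) by (unfold M; lra).
  assert (HeM : 0 < eps / M) by (apply Rdiv_lt_0_compat; lra).
  destruct (Hf c (eps / M) Hc HeM) as [N1 H1]; destruct (Hg c (eps / M) Hc HeM) as [N2 H2].
  exists (N1 + N2)%nat; intros n Hn x Hx.
  rewrite Qn_lin by lra.
  specialize (H1 n ltac:(lia) x Hx); specialize (H2 n ltac:(lia) x Hx).
  set (u := ln (INR n) * Qn n f x - A) in *; set (v := ln (INR n) * Qn n g x - B) in *.
  replace (ln (INR n) * (a * Qn n f x + b * Qn n g x) - (a * A + b * B)) with (a * u + b * v)
    by (unfold u, v; ring).
  eapply Rle_lt_trans; [apply Rabs_triang|]. rewrite !Rabs_mult.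
  apply Rle_lt_trans with (Rabs a * (eps / M) + Rabs b * (eps / M)).
  - apply Rplus_le_compat; apply Rmult_le_compat_l; lra.
  - replace eps with (M * (eps / M)) at 3 by (field; lra).
    unfold M at 3; lra.
Qed.

Lemma unif_lim_scal f A a : unif_lim f A -> unif_lim (fun y => a * f y) (a * A).
Proof.
  intros H. replace (a * A) with (a * A + 0 * A) by ring.
  apply unif_lim_ext with (fun y => a * f y + 0 * f y); [intros; ring|].
  now apply unif_lim_lin.
Qed.

Lemma unif_lim_plus f g A B : unif_lim f A -> unif_lim g B ->
  unif_lim (fun y => f y + g y) (A + B).
Proof.
  intros Hf Hg. replace (A + B) with (1 * A + 1 * B) by ring.
  apply unif_lim_ext with (fun y => 1 * f y + 1 * g y); [intros; ring|].
  now apply unif_lim_lin.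
Qed.

Lemma unif_lim_squeeze g L :
  (forall e, 0 < e -> exists g1 I1, (forall y, 0 < y <= 1 -> g1 y <= g y) /\
     unif_lim g1 I1 /\ L - e <= I1) ->
  (forall e, 0 < e -> exists g2 I2, (forall y, 0 < y <= 1 -> g y <= g2 y) /\
     unif_lim g2 I2 /\ I2 <= L + e) ->
  unif_lim g L.
Proof.
  intros H1 H2 a eps Ha He.
  destruct (H1 (eps/2) ltac:(lra)) as (g1 & I1 & Hl & Hu1 & HI1).
  destruct (H2 (eps/2) ltac:(lra)) as (g2 & I2 & Hr & Hu2 & HI2).
  destruct (Hu1 a (eps/2) Ha ltac:(lra)) as [N1 HN1].
  destruct (Hu2 a (eps/2) Ha ltac:(lra)) as [N2 HN2].
  exists (N1 + N2 + 1)%nat; intros n Hn x Hx.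
  specialize (HN1 n ltac:(lia) x Hx); specialize (HN2 n ltac:(lia) x Hx).
  apply Rabs_def2 in HN1; apply Rabs_def2 in HN2.
  assert (A1 := Qn_le n _ _ Hl x ltac:(lra)); assert (A2 := Qn_le n _ _ Hr x ltac:(lra)).
  assert (Hln0 : 0 <= ln (INR n)).
  { rewrite <- ln_1; apply ln_le; [lra|]. apply (le_INR 1); lia. }
  apply Rmult_le_compat_l with (r := ln (INR n)) in A1; auto.
  apply Rmult_le_compat_l with (r := ln (INR n)) in A2; auto.
  apply Rabs_def1; lra.
Qed.

(** * Limits for truncations, indicators and powers *)

Lemma Rmin_continuous c x : continuous (fun y => Rmin y c) x.
Proof.
  apply (continuous_ext (fun y => (y + c - Rabs (y - c)) / 2)).
  { intros y; unfold Rmin, Rabs; destruct (Rle_dec y c), (Rcase_abs (y - c)); lra. }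
  unfold Rdiv; apply (continuous_mult (K := R_AbsRing)); [|apply continuous_const].
  apply (continuous_minus (V := R_NormedModule)).
  - apply (continuous_plus (V := R_NormedModule)); [apply continuous_id | apply continuous_const].
  - apply (continuous_comp (fun y => y - c) Rabs).
    + apply (continuous_minus (V := R_NormedModule)); [apply continuous_id | apply continuous_const].
    + apply continuous_Rabs.
Qed.

Lemma cone_min c : 0 <= c -> cone (fun x => Rmin x c).
Proof.
  intros Hc; split.
  - intros; apply Rmin_continuous.
  - intros x Hx; apply Rmin_glb; lra.
  - intros x y _ H _; apply Rle_min_compat_r; exact H.
  - intros a b t Ha Hb Ht.
    pose proof (Rmin_l a c); pose proof (Rmin_r a c).
    pose proof (Rmin_l b c); pose proof (Rmin_r b c).
    apply Rmin_glb; nra.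
Qed.

(** The limit is the integral of [Rmin x c / x]: the part over (0,c] contributes [c], the part over
    [c,1] contributes [- c ln c]. *)
Lemma unif_lim_min c : 0 < c <= 1 -> unif_lim (fun x => Rmin x c) (c - c * ln c).
Proof.
  intros Hc.
  assert (Hlnc : ln c <= 0) by (rewrite <- ln_1; apply ln_le; lra).
  assert (Hup : forall e, c <= e <= 1 -> is_RInt (Fn (fun x => Rmin x c) 0) e 1 (- (c * ln e))).
  { intros e He. apply (is_RInt_ext (fun x => scal c (/ x))).
    - intros x Hx; apply Rmin_max_range_lt in Hx; [|lra].
      unfold Fn, Qn; simpl; rewrite Rmin_right by lra; reflexivity.
    - replace (- (c * ln e)) with (scal c (- ln e)) by (unfold scal; simpl; unfold mult; simpl; ring).
      apply (is_RInt_scal (V := R_NormedModule)), is_RInt_inv; lra. }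
  assert (Hlo : forall e, 0 < e <= c -> RInt (Fn (fun x => Rmin x c) 0) e 1 = c - c * ln c - e).
  { intros e He. apply is_RInt_unique.
    replace (c - c * ln c - e) with (plus (c - e) (- (c * ln c))) by (unfold plus; simpl; ring).
    apply (is_RInt_Chasles (V := R_NormedModule)) with c; [|apply Hup; lra].
    apply (is_RInt_ext (fun x => 1)).
    - intros x Hx; apply Rmin_max_range_lt in Hx; [|lra].
      unfold Fn, Qn; simpl; rewrite Rmin_left by lra.
      change (@eq R 1 (x / x)); field; lra.
    - replace (c - e) with (scal (c - e) 1) by (unfold scal; simpl; unfold mult; simpl; ring).
      apply (is_RInt_const (V := R_NormedModule)). }
  apply cone_unif_lim; [apply cone_min; lra | |].
  - intros e He; destruct (Rle_dec e c).
    + rewrite Hlo; lra.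
    + assert (Hce : c <= e <= 1) by lra.
      rewrite (is_RInt_unique _ _ _ _ (Hup e Hce)).
      assert (ln c <= ln e) by (apply ln_le; lra). nra.
  - intros e He; exists (Rmin c e); split; [apply Rmin_glb_lt; lra|].
    intros c' Hc' Hl. pose proof (Rmin_l c e); pose proof (Rmin_r c e).
    rewrite Hlo; lra.
Qed.

Definition ind (c x : R) : R := if Rle_dec c x then 1 else 0.

Lemma ln_le_sub u : 0 < u -> ln u <= u - 1.
Proof.
  intros; rewrite <- (ln_exp (u - 1)); apply ln_le; auto.
  pose proof (exp_ineq1_le (u - 1)); lra.
Qed.

Lemma ln_diff_le p q : 0 < p -> 0 < q -> p * (ln q - ln p) <= q - p.
Proof.
  intros Hp Hq. assert (H := ln_le_sub (q / p) ltac:(apply Rdiv_lt_0_compat; lra)).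
  rewrite ln_div in H by lra.
  apply Rmult_le_compat_l with (r := p) in H; [|lra].
  replace (p * (q / p - 1)) with (q - p) in H by (field; lra). lra.
Qed.

Lemma unif_lim_zero : unif_lim (fun _ => 0) 0.
Proof.
  assert (H := unif_lim_scal _ _ 0 (unif_lim_min 1 ltac:(lra))).
  rewrite Rmult_0_l in H; eapply unif_lim_ext; [|exact H]; intros; simpl; ring.
Qed.

(** [(Rmin y q - Rmin y p) / (q - p)] is the ramp from 0 at [p] to 1 at [q], and its limit lies
    between [- ln q] and [- ln p]. A ramp starting at [c] is a minorant, a ramp ending at [c] a
    majorant. *)
Lemma unif_lim_ind c : 0 < c <= 1 -> unif_lim (ind c) (- ln c).
Proof.
  intros Hc.
  set (J := fun c => c - c * ln c).
  assert (HD : forall p q, 0 < p <= 1 -> 0 < q <= 1 ->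
     unif_lim (fun y => / (q - p) * Rmin y q + - / (q - p) * Rmin y p)
       (/ (q - p) * J q + - / (q - p) * J p)).
  { intros; apply unif_lim_lin; now apply unif_lim_min. }
  apply unif_lim_squeeze; intros e He.
  (* For [c = 1] no ramp fits to the right of [c]; the zero function serves, since [- ln 1 = 0]. *)
  - destruct (Req_dec c 1) as [->|Hc1].
    { exists (fun _ => 0), 0; repeat split; [|apply unif_lim_zero | rewrite ln_1; lra].
      intros; unfold ind; destruct (Rle_dec _ _); lra. }
    (* The first bound keeps [q] below 1, the second makes [- ln q >= - ln c - e]. *)
    set (q := Rmin ((1 + c) / 2) (c * (1 + e))).
    assert (Hq : c < q) by (apply Rmin_glb_lt; nra).
    assert (Hq1 : q <= (1 + c) / 2) by apply Rmin_l.
    assert (Hq2 : q <= c * (1 + e)) by apply Rmin_r.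
    assert (Hi : 0 < / (q - c)) by (apply Rinv_0_lt_compat; lra).
    eexists _, _; split; [|split; [apply (HD c q); lra|]].
    + intros y Hy; unfold ind.
      replace (/ (q - c) * Rmin y q + - / (q - c) * Rmin y c) with
        ((Rmin y q - Rmin y c) / (q - c)) by (field; lra).
      apply div_le; [lra|].
      unfold Rmin; destruct (Rle_dec y q), (Rle_dec y c), (Rle_dec c y); lra.
    + unfold J.
      assert (A := ln_diff_le c q ltac:(lra) ltac:(lra)).
      apply Rle_trans with (- ln q).
      * assert (ln q <= ln (c * (1 + e))) by (apply ln_le; lra).
        rewrite ln_mult in H by lra.
        assert (ln (1 + e) <= e) by (apply ln_1p_le; lra). lra.
      * replace (/ (q - c) * (q - q * ln q) + - / (q - c) * (c - c * ln c)) with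
          ((q - q * ln q - (c - c * ln c)) / (q - c)) by (field; lra).
        apply div_ge; [lra|]. nra.
  - set (p := c / (1 + e)).
    assert (Hp0 : 0 < p) by (apply Rdiv_lt_0_compat; lra).
    assert (Hpc : p < c) by (apply div_lt; nra).
    eexists _, _; split; [|split; [apply (HD p c); lra|]].
    + intros y Hy; unfold ind.
      replace (/ (c - p) * Rmin y c + - / (c - p) * Rmin y p) with
        ((Rmin y c - Rmin y p) / (c - p)) by (field; lra).
      apply div_ge; [lra|].
      unfold Rmin; destruct (Rle_dec y c), (Rle_dec y p), (Rle_dec c y); lra.
    + unfold J.
      assert (A := ln_diff_le c p ltac:(lra) ltac:(lra)).
      apply Rle_trans with (- ln p).
      * replace (/ (c - p) * (c - c * ln c) + - / (c - p) * (p - p * ln p)) with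
          ((c - c * ln c - (p - p * ln p)) / (c - p)) by (field; lra).
        apply div_le; [lra|]. nra.
      * unfold p; rewrite ln_div by lra.
        assert (ln (1 + e) <= e) by (apply ln_1p_le; lra). lra.
Qed.

(* [Rpower 0 s = 1] in the standard library, whence the case distinction. *)
Definition pw (s x : R) : R := if Rle_dec x 0 then 0 else Rpower x s.

Lemma pw_pos s x : 0 < x -> pw s x = Rpower x s.
Proof. intros; unfold pw; destruct (Rle_dec x 0); lra. Qed.

Lemma Rpower_pos x s : 0 < Rpower x s.
Proof. apply exp_pos. Qed.

(** The tangent at 1 of the concave function [u^s]. It comes from [1 + y <= exp y] at
    [y = (1 - s) ln u] and [y = - s ln u], with weights [s] and [1 - s] chosen so that the
    logarithms cancel. *)
Lemma Rpower_bernoulli u s : 0 < u -> 0 <= s <= 1 -> Rpower u s <= 1 + s * (u - 1).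
Proof.
  intros Hu Hs; unfold Rpower. set (L := ln u).
  assert (E : u = exp L) by (unfold L; now rewrite exp_ln).
  rewrite E at 1.
  assert (A := exp_ineq1_le ((1 - s) * L)); assert (B := exp_ineq1_le (- (s * L))).
  assert (Hp := exp_pos (s * L)).
  assert (EA : exp L = exp (s * L) * exp ((1 - s) * L)) by (rewrite <- exp_plus; f_equal; ring).
  assert (EB : 1 = exp (s * L) * exp (- (s * L))).
  { rewrite <- exp_plus, Rplus_opp_r; now rewrite exp_0. }
  apply Rmult_le_compat_l with (r := exp (s * L)) in A; [|lra].
  apply Rmult_le_compat_l with (r := exp (s * L)) in B; [|lra].
  rewrite <- EA in A; rewrite <- EB in B.
  apply Rmult_le_compat_l with (r := s) in A; [|lra].
  apply Rmult_le_compat_l with (r := 1 - s) in B; [|lra].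
  lra.
Qed.

Lemma continuous_Rpower s x : 0 < x -> continuous (fun y => Rpower y s) x.
Proof.
  intros; apply (ex_derive_continuous (V := R_NormedModule)).
  exists (s * Rpower x (s - 1)). apply is_derive_Reals, derivable_pt_lim_power; auto.
Qed.

Lemma cone_pw s : 0 < s <= 1 -> cone (pw s).
Proof.
  intros Hs; split.
  - intros x Hx. apply (continuous_ext_loc _ (fun y => Rpower y s)).
    + exists (mkposreal x Hx); intros y Hy.
      unfold ball in Hy; simpl in Hy; unfold AbsRing_ball, abs, minus, plus, opp in Hy; simpl in Hy.
      apply Rabs_def2 in Hy. symmetry; apply pw_pos; lra.
    + now apply continuous_Rpower.
  - intros x Hx; unfold pw; destruct (Rle_dec x 0); [lra | left; apply Rpower_pos].
  - intros x y Hx Hxy Hy; unfold pw; destruct (Rle_dec x 0), (Rle_dec y 0); try lra.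
    + left; apply Rpower_pos.
    + apply Rle_Rpower_l; lra.
  - assert (H1 : forall a, 0 <= a -> pw s a <= 1 + s * (a - 1)).
    { intros a Ha; unfold pw; destruct (Rle_dec a 0); [nra|].
      apply Rpower_bernoulli; lra. }
    (* Homogeneity rescales the convex combination to the value 1, where the tangent inequality [H1]
       proves concavity. *)
    assert (Hsc : forall m a, 0 < m -> 0 <= a -> pw s (m * a) = pw s m * pw s a).
    { intros m a Hm [Ha|<-].
      - rewrite !pw_pos by nra. now rewrite Rpower_mult_distr.
      - rewrite Rmult_0_r; unfold pw at 1 3; destruct (Rle_dec 0 0); lra. }
    intros a b t Ha Hb Ht.
    pose proof (convex_comb_range a b t 0 1 Ha Hb Ht) as Hr.
    set (m := t * a + (1 - t) * b) in *.
    destruct (Req_dec m 0) as [Hm|Hm].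
    + assert (Hta : t * pw s a = 0).
      { assert (t * a = 0) by (unfold m in Hm; nra).
        destruct (Rmult_integral _ _ H) as [->| ->]; [ring|].
        unfold pw; destruct (Rle_dec 0 0); lra. }
      assert (Htb : (1 - t) * pw s b = 0).
      { assert ((1 - t) * b = 0) by (unfold m in Hm; nra).
        destruct (Rmult_integral _ _ H) as [->| ->]; [ring|].
        unfold pw; destruct (Rle_dec 0 0); lra. }
      rewrite Hta, Htb; unfold pw; destruct (Rle_dec m 0); [lra|].
      pose proof (Rpower_pos m s); lra.
    + assert (Hm0 : 0 < m) by lra.
      assert (Ha' : 0 <= a / m) by (apply Rdiv_le_0_compat; lra).
      assert (Hb' : 0 <= b / m) by (apply Rdiv_le_0_compat; lra).
      replace a with (m * (a / m)) at 1 by (field; lra).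
      replace b with (m * (b / m)) at 1 by (field; lra).
      rewrite !Hsc by auto.
      assert (Hpm : 0 < pw s m) by (rewrite pw_pos by auto; apply Rpower_pos).
      assert (A := H1 (a / m) Ha'); assert (B := H1 (b / m) Hb').
      assert (E : t * (a / m) + (1 - t) * (b / m) = 1) by (unfold m; field; exact Hm).
      assert (t * pw s (a / m) + (1 - t) * pw s (b / m) <= 1) by nra.
      nra.
Qed.

Lemma is_RInt_Rpower s a b : s <> 0 -> 0 < a <= b ->
  is_RInt (fun x => Rpower x (s - 1)) a b ((Rpower b s - Rpower a s) / s).
Proof.
  intros Hs Hab.
  replace ((Rpower b s - Rpower a s) / s) with (minus (Rpower b s / s) (Rpower a s / s))
    by (unfold minus, plus, opp; simpl; field; auto).
  apply (is_RInt_derive (V := R_CompleteNormedModule) (fun x => Rpower x s / s));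
    intros x Hx; apply Rmin_max_range in Hx; try lra.
  - replace (Rpower x (s - 1)) with (scal (/ s) (s * Rpower x (s - 1)))
      by (unfold scal; simpl; unfold mult; simpl; field; auto).
    apply (is_derive_ext (fun x => scal (/ s) (Rpower x s))).
    { intros t; unfold scal; simpl; unfold mult; simpl. unfold Rdiv; apply Rmult_comm. }
    apply is_derive_scal, is_derive_Reals, derivable_pt_lim_power; lra.
  - apply continuous_Rpower; lra.
Qed.

(** The value [/ s] is the integral of [x^(s-1)] over (0,1]. Being uniform in [n] and [x], these
    bounds control every error term dominated by a power. *)
Lemma Qn_pw_bound s n x : 0 < s <= 1 -> 0 < x <= 1 ->
  Qn n (pw s) x <= 1 /\ ln (1 + INR n) * Qn n (pw s) x <= / s.
Proof.
  intros Hs Hx.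
  pose proof (cone_pw s Hs) as Hc.
  assert (A := Qn_le_top (pw s) n x Hc ltac:(lra)).
  assert (E1 : pw s 1 = 1).
  { rewrite pw_pos by lra; unfold Rpower; rewrite ln_1, Rmult_0_r; apply exp_0. }
  split.
  - assert (B := Qn_top_decr (pw s) 0 n Hc ltac:(lia)).
    change (Qn 0 (pw s) 1) with (pw s 1) in B; lra.
  - assert (B : Qn n (pw s) 1 * ln (1 + INR n) <= / s).
    { apply cone_upper; auto. intros c Hcc.
      assert (D := is_RInt_Rpower s c 1 ltac:(lra) Hcc).
      rewrite (RInt_ext_R (Fn (pw s) 0) (fun x => Rpower x (s - 1)) c 1); [|lra|].
      - rewrite (is_RInt_unique _ _ _ _ D).
        replace (Rpower 1 s) with 1 by (rewrite <- pw_pos by lra; auto).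
        pose proof (Rpower_pos c s). apply div_le; [lra|].
        rewrite Rinv_l by lra; lra.
      - intros y Hy; unfold Fn, Qn; simpl; rewrite pw_pos by lra.
        unfold Rminus; rewrite Rpower_plus, Rpower_Ropp, Rpower_1 by lra; reflexivity. }
    assert (0 <= ln (1 + INR n)).
    { rewrite <- ln_1; apply ln_le; [lra|]. pose proof (pos_INR n); lra. }
    nra.
Qed.

(** * Functions of bounded variation *)

(** A partition of [p,q) listed from the left. The pieces are half-open, as right-continuity
    suggests: a jump at the end of a piece belongs to the next one. *)
Inductive chop (f : R -> R) (e q : R) : R -> Prop :=
| chop_last p : p <= q -> (forall x, p <= x < q -> Rabs (f x - f p) <= e) -> chop f e q p
| chop_cons p c : p <= c -> (forall x, p <= x < c -> Rabs (f x - f p) <= e) ->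
    chop f e q c -> chop f e q p.

Lemma chop_le f e q p : chop f e q p -> p <= q.
Proof. induction 1; lra. Qed.

(** Greedy subdivision. The cut [c] is the supremum of the points up to which [f] stays within [e]
    of [f p]; by right-continuity [f] has moved by at least [e] at [c]. Each cut thus uses up
    variation [e], and [k] with [M <= k e] bounds their number. *)
Lemma BV_chop f p q e : 0 < e -> p <= q -> BV_on f p q -> chop f e q p.
Proof.
  intros He Hpq (_ & [M HM] & Hrc).
  destruct (INR_unbounded (M / e)) as [k Hk].
  assert (HV : M <= INR k * e).
  { apply Rmult_lt_compat_r with (r := e) in Hk; auto.
    replace (M / e * e) with M in Hk by (field; lra). lra. }
  clear Hk; revert M p HM HV Hpq Hrc.
  induction k as [|k IH]; intros M p HM HV Hpq Hrc.
  - apply chop_last; auto. intros x Hx.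
    assert (H := HM p (x :: nil) ltac:(lra) ltac:(simpl; lra)).
    simpl in H, HV; lra.
  - set (S := fun x => p <= x <= q /\ forall y, p <= y < x -> Rabs (f y - f p) <= e).
    destruct (completeness S) as [c [Hub Hlub]].
    { exists q; intros x [Hx _]; lra. }
    { exists p; split; [lra | intros; lra]. }
    assert (Hpc : p <= c) by (apply Hub; split; [lra | intros; lra]).
    assert (Hcq : c <= q) by (apply Hlub; intros x [Hx _]; lra).
    assert (Hc : forall y, p <= y < c -> Rabs (f y - f p) <= e).
    { intros y Hy. apply NNPP; intros Hn.
      enough (c <= y) by lra.
      apply Hlub; intros x [Hx Hx2]. apply Rnot_lt_le; intros Hlt; apply Hn, Hx2; lra. }
    destruct (Req_dec c q) as [->|Hne]; [apply chop_last; auto|].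
    assert (Hjump : e <= Rabs (f c - f p)).
    { apply Rnot_lt_le; intros Hlt.
      destruct (Hrc c ltac:(lra) (e - Rabs (f c - f p)) ltac:(lra)) as [d [Hd Hd2]].
      set (x := Rmin q (c + d)).
      assert (c < x) by (apply Rmin_glb_lt; lra).
      pose proof (Rmin_l q (c + d)); pose proof (Rmin_r q (c + d)); fold x in H0, H1.
      enough (x <= c) by lra. apply Hub; split; [lra|].
      intros y Hy; destruct (Rlt_le_dec y c); [apply Hc; lra|].
      specialize (Hd2 y ltac:(lra) ltac:(lra)).
      replace (f y - f p) with ((f y - f c) + (f c - f p)) by ring.
      eapply Rle_trans; [apply Rabs_triang|]; lra. }
    apply chop_cons with c; auto.
    apply (IH (M - e)); auto; [| rewrite S_INR in HV; lra | intros; apply Hrc; auto; lra].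
    intros x l Hx Hl.
    assert (H := HM p (c :: x :: l) ltac:(lra)). simpl in H.
    pose proof (Rabs_pos (f x - f c)).
    specialize (H ltac:(repeat split; auto; lra)). lra.
Qed.

Lemma BV_mult_id f p q : 0 <= p -> q <= 1 -> BV_on f p q -> BV_on (fun x => x * f x) p q.
Proof.
  intros Hp Hq ([M HM] & [V HV] & Hrc); repeat split.
  - exists M; intros x Hx. rewrite Rabs_mult, (Rabs_pos_eq x) by lra.
    specialize (HM x Hx); pose proof (Rabs_pos (f x)); nra.
  - exists (V + Rabs M); intros x l Hx Hl.
    apply Rle_trans with (var_sum f x l + Rabs M * (q - x)).
    2:{ specialize (HV x l Hx Hl); pose proof (Rabs_pos M); nra. }
    clear HV; revert x Hx Hl; induction l as [|y l IH]; intros x Hx Hl.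
    { simpl; pose proof (Rabs_pos M); nra. }
    simpl in Hl; destruct Hl as (Hxy & Hyq & Hl); simpl.
    specialize (IH y ltac:(lra) Hl).
    assert (Rabs (y * f y - x * f x) <= Rabs (f y - f x) + Rabs M * (y - x)).
    { replace (y * f y - x * f x) with (x * (f y - f x) + (y - x) * f y) by ring.
      eapply Rle_trans; [apply Rabs_triang|]. rewrite !Rabs_mult, (Rabs_pos_eq x), (Rabs_pos_eq (y - x)) by lra.
      specialize (HM y ltac:(lra)). pose proof (Rle_abs M). pose proof (Rabs_pos (f y - f x)). nra. }
    lra.
  - intros x Hx eps He.
    destruct (Hrc x Hx (eps / 2) ltac:(lra)) as [d [Hd Hd2]].
    assert (HM0 : 0 <= M) by (specialize (HM x ltac:(lra)); pose proof (Rabs_pos (f x)); lra).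
    exists (Rmin d (eps / 2 / (M + 1))); split.
    { apply Rmin_glb_lt; auto. apply Rdiv_lt_0_compat; lra. }
    intros y Hy Hyq.
    pose proof (Rmin_l d (eps / 2 / (M + 1))); pose proof (Rmin_r d (eps / 2 / (M + 1))).
    specialize (Hd2 y ltac:(lra) Hyq).
    replace (y * f y - x * f x) with (x * (f y - f x) + (y - x) * f y) by ring.
    eapply Rle_lt_trans; [apply Rabs_triang|].
    rewrite !Rabs_mult, (Rabs_pos_eq x), (Rabs_pos_eq (y - x)) by lra.
    specialize (HM y ltac:(lra)). pose proof (Rabs_pos (f y - f x)).
    assert ((y - x) * (M + 1) <= eps / 2).
    { replace (eps / 2) with (eps / 2 / (M + 1) * (M + 1)) by (field; lra).
      apply Rmult_le_compat_r; lra. }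
    assert ((y - x) * Rabs (f y) <= (y - x) * M) by (apply Rmult_le_compat_l; lra).
    nra.
Qed.

(** * Integrability and limits by approximation with step functions *)

Lemma ex_RInt_ext_R (f g : R -> R) a b : a <= b -> (forall x, a < x < b -> f x = g x) ->
  ex_RInt f a b -> ex_RInt g a b.
Proof.
  intros Hab H; apply ex_RInt_ext; intros x Hx; apply H, Rmin_max_range_lt; auto.
Qed.

Lemma chop_step f e q p : chop f e q p ->
  exists s, ex_RInt s p q /\ forall x, p <= x < q -> Rabs (f x - s x) <= e.
Proof.
  induction 1 as [p Hpq Hp | p c Hpc Hp Hc (s & Hs1 & Hs2)].
  - exists (fun _ => f p); split; auto. apply ex_RInt_const.
  - pose proof (chop_le _ _ _ _ Hc).
    exists (fun x => if Rlt_dec x c then f p else s x); split.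
    + apply ex_RInt_Chasles with c.
      * apply (ex_RInt_ext_R (fun _ => f p)); auto; [|apply ex_RInt_const].
        intros x Hx; destruct (Rlt_dec x c); lra.
      * apply (ex_RInt_ext_R s); auto.
        intros x Hx; destruct (Rlt_dec x c); lra.
    + intros x Hx; destruct (Rlt_dec x c); [apply Hp | apply Hs2]; lra.
Qed.

Lemma ex_RInt_unif (f : R -> R) p q : p <= q ->
  (forall e, 0 < e -> exists s, ex_RInt s p q /\ forall x, p <= x < q -> Rabs (f x - s x) <= e) ->
  ex_RInt f p q.
Proof.
  intros Hpq H.
  assert (H' : forall n : nat, exists sl : (R -> R) * R, is_RInt (fst sl) p q (snd sl) /\
     forall x, Rabs (fst sl x - f x) <= / (INR n + 1)).
  { intros n. pose proof (pos_INR n).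
    destruct (H (/ (INR n + 1))) as (s & [l Hl] & Hs).
    { apply Rinv_0_lt_compat; lra. }
    (* [filterlim_RInt] is applied with uniform convergence on the whole line, so [s] is replaced by
       [f] outside (p,q), which leaves its integral unchanged. *)
    exists (fun x => if Rlt_dec p x then if Rlt_dec x q then s x else f x else f x, l); simpl.
    split.
    - apply (is_RInt_ext s); auto. intros x Hx; apply Rmin_max_range_lt in Hx; auto.
      destruct (Rlt_dec p x), (Rlt_dec x q); lra.
    - intros x. assert (Rabs (f x - f x) <= / (INR n + 1)).
      { rewrite Rminus_diag, Rabs_R0; left; apply Rinv_0_lt_compat; lra. }
      destruct (Rlt_dec p x), (Rlt_dec x q); auto. rewrite Rabs_minus_sym; apply Hs; lra. }
  set (F := fun n => proj1_sig (constructive_indefinite_description _ (H' n))).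
  assert (HF : forall n, is_RInt (fst (F n)) p q (snd (F n)) /\
     forall x, Rabs (fst (F n) x - f x) <= / (INR n + 1)).
  { intros n; unfold F; apply proj2_sig. }
  destruct (filterlim_RInt (V := R_CompleteNormedModule) (fun n => fst (F n)) p q
     eventually eventually_filter f (fun n => snd (F n))) as (l & _ & Hl).
  - intros n; apply HF.
  - intros P [eps HP]. destruct (INR_unbounded (/ eps)) as [N HN].
    exists N; intros n Hn. apply HP; intros x.
    change (Rabs (fst (F n) x - f x) < eps).
    eapply Rle_lt_trans; [apply HF|].
    pose proof (cond_pos eps). apply le_INR in Hn.
    rewrite <- (Rinv_inv eps). apply Rinv_lt_contravar; [|lra].
    assert (0 < / eps) by (now apply Rinv_0_lt_compat). nra.
  - now exists l.
Qed.

Lemma BV_ex_RInt f p q : p <= q -> BV_on f p q -> ex_RInt f p q.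
Proof.
  intros Hpq Hf; apply ex_RInt_unif; auto; intros e He.
  apply chop_step; apply BV_chop; auto.
Qed.

Definition pqind (p q x : R) : R := ind p x - ind q x.

Lemma pqind_in p q x : p <= x < q -> pqind p q x = 1.
Proof. intros; unfold pqind, ind; destruct (Rle_dec p x), (Rle_dec q x); lra. Qed.

Lemma pqind_out p q x : p <= q -> ~ (p <= x < q) -> pqind p q x = 0.
Proof. intros; unfold pqind, ind; destruct (Rle_dec p x), (Rle_dec q x); lra. Qed.

Lemma unif_lim_pqind p q : 0 < p <= q -> q <= 1 -> unif_lim (pqind p q) (ln q - ln p).
Proof.
  intros Hp Hq.
  replace (ln q - ln p) with (1 * - ln p + - 1 * - ln q) by ring.
  apply unif_lim_ext with (fun y => 1 * ind p y + - 1 * ind q y).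
  { intros; unfold pqind; ring. }
  apply unif_lim_lin; apply unif_lim_ind; lra.
Qed.

Lemma chop_step_lim G e q p : chop G e q p -> 0 < p -> q <= 1 ->
  exists s L, is_RInt (fun x => s x / x) p q L /\ unif_lim s L /\
    (forall x, p <= x < q -> Rabs (G x - s x) <= e) /\
    (forall x, ~ (p <= x < q) -> s x = 0).
Proof.
  intros H Hp Hq; revert Hp.
  assert (Hone : forall p c, 0 < p <= c -> c <= q ->
     is_RInt (fun x => G p * pqind p c x / x) p c (G p * (ln c - ln p)) /\
     unif_lim (fun x => G p * pqind p c x) (G p * (ln c - ln p))).
  { intros p0 c Hp Hc; split.
    - apply (is_RInt_ext (fun x => scal (G p0) (/ x))).
      + intros x Hx; apply Rmin_max_range_lt in Hx; [|lra].
        rewrite pqind_in by lra. unfold scal; simpl; unfold mult; simpl.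
        unfold Rdiv; now rewrite Rmult_1_r.
      + apply (is_RInt_scal (V := R_NormedModule)), is_RInt_inv_ab; lra.
    - apply unif_lim_scal, unif_lim_pqind; lra. }
  induction H as [p Hpq Hx | p c Hpc Hx Hc IH]; intros Hp.
  - destruct (Hone p q ltac:(lra) ltac:(lra)) as [A B].
    exists (fun x => G p * pqind p q x), (G p * (ln q - ln p)); repeat split; auto.
    + intros x Hx'; rewrite pqind_in, Rmult_1_r; auto.
    + intros x Hx'; rewrite pqind_out; auto; ring.
  - destruct IH as (s & L & Hs1 & Hs2 & Hs3 & Hs4); [lra|].
    pose proof (chop_le _ _ _ _ Hc).
    destruct (Hone p c ltac:(lra) ltac:(lra)) as [A B].
    exists (fun x => G p * pqind p c x + s x), (G p * (ln c - ln p) + L); repeat split.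
    + apply (is_RInt_Chasles (V := R_NormedModule)) with c.
      * eapply is_RInt_ext; [|exact A].
        intros x Hx'; apply Rmin_max_range_lt in Hx'; [|lra].
        change (@eq R (G p * pqind p c x / x) ((G p * pqind p c x + s x) / x)).
        rewrite Hs4 by lra; now rewrite Rplus_0_r.
      * eapply is_RInt_ext; [|exact Hs1].
        intros x Hx'; apply Rmin_max_range_lt in Hx'; [|lra].
        change (@eq R (s x / x) ((G p * pqind p c x + s x) / x)).
        rewrite pqind_out by lra; now rewrite Rmult_0_r, Rplus_0_l.
    + now apply unif_lim_plus.
    + intros x Hx'; destruct (Rlt_le_dec x c).
      * rewrite pqind_in, Hs4 by lra. rewrite Rmult_1_r, Rplus_0_r. apply Hx; lra.
      * rewrite pqind_out by lra. rewrite Rmult_0_r, Rplus_0_l. apply Hs3; lra.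
    + intros x Hx'; rewrite pqind_out, Hs4 by lra; ring.
Qed.

Lemma RInt_dist (f s w : R -> R) a b L W : a <= b -> ex_RInt f a b -> is_RInt s a b L ->
  is_RInt w a b W -> (forall x, a < x < b -> Rabs (f x - s x) <= w x) ->
  Rabs (RInt f a b - L) <= W.
Proof.
  intros Hab Hf Hs Hw H.
  pose proof (is_RInt_plus (V := R_NormedModule) _ _ _ _ _ _ Hs Hw) as Hp.
  pose proof (is_RInt_minus (V := R_NormedModule) _ _ _ _ _ _ Hs Hw) as Hm.
  assert (A : RInt f a b <= plus L W).
  { rewrite <- (is_RInt_unique (V := R_CompleteNormedModule) _ _ _ _ Hp).
    apply RInt_le; auto; [eexists; exact Hp|].
    intros x Hx; specialize (H x Hx); apply Rabs_le_between in H.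
    change (f x <= s x + w x); lra. }
  assert (B : minus L W <= RInt f a b).
  { rewrite <- (is_RInt_unique (V := R_CompleteNormedModule) _ _ _ _ Hm).
    apply RInt_le; auto; [eexists; exact Hm|].
    intros x Hx; specialize (H x Hx); apply Rabs_le_between in H.
    change (s x - w x <= f x); lra. }
  change (RInt f a b <= L + W) in A; change (L - W <= RInt f a b) in B.
  apply Rabs_le_between; lra.
Qed.

(** Since [Q] acts on [x f x], it is this product that is approximated by step functions. An error
    [e] on [p,q) becomes [e / x] in the integral of [f], hence the factor [K = ln q - ln p]. *)
Lemma BV_unif_lim f p q : 0 < p <= q -> q <= 1 -> BV_on f p q ->
  unif_lim (fun x => pqind p q x * (x * f x)) (RInt f p q).
Proof.
  intros Hp Hq Hf.
  assert (Hint : ex_RInt f p q) by (apply BV_ex_RInt; auto; lra).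
  assert (Hl : 0 <= ln q - ln p) by (assert (ln p <= ln q) by (apply ln_le; lra); lra).
  set (K := ln q - ln p) in *.
  assert (Happ : forall e, 0 < e -> exists s L, unif_lim s L /\
      Rabs (RInt f p q - L) <= e * K /\
      (forall x, Rabs (pqind p q x * (x * f x) - s x) <= e * pqind p q x)).
  { intros e He.
    destruct (chop_step_lim (fun x => x * f x) e q p) as (s & L & H1 & H2 & H3 & H4); try lra.
    { apply BV_chop; auto; [lra|]. apply BV_mult_id; auto; lra. }
    exists s, L; split; [auto|split].
    - apply (RInt_dist f (fun x => s x / x) (fun x => e * / x) p q); auto; [lra | |].
      + apply (is_RInt_scal (V := R_NormedModule)), is_RInt_inv_ab; lra.
      + intros x Hx; specialize (H3 x ltac:(lra)); simpl in H3.
        change (e * / x) with (e / x); apply div_ge; [lra|].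
        replace (Rabs (f x - s x / x) * x) with (Rabs (x * f x - s x)); auto.
        replace (x * f x - s x) with ((f x - s x / x) * x) by (field; lra).
        now rewrite Rabs_mult, (Rabs_pos_eq x) by lra.
    - intros x; destruct (classic (p <= x < q)) as [Hx|Hx].
      + rewrite pqind_in by auto. rewrite Rmult_1_l, Rmult_1_r. now apply H3.
      + rewrite pqind_out, H4 by (auto; lra). rewrite Rmult_0_l, Rmult_0_r, Rminus_diag, Rabs_R0; lra. }
  apply unif_lim_squeeze; intros e He; set (e' := e / (2 * K + 1));
    assert (He' : 0 < e') by (apply Rdiv_lt_0_compat; lra);
    assert (HeK : e' * K <= e / 2) by
      (unfold e'; replace (e / (2 * K + 1) * K) with (e * K / (2 * K + 1)) by (field; lra); apply div_le; nra);
    destruct (Happ e' He') as (s & L & H1 & H2 & H3);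
    apply Rabs_le_between in H2.
  - exists (fun y => 1 * s y + - e' * pqind p q y), (1 * L + - e' * K); repeat split.
    + intros y Hy; specialize (H3 y); apply Rabs_le_between in H3; lra.
    + apply unif_lim_lin; auto. apply unif_lim_pqind; lra.
    + lra.
  - exists (fun y => 1 * s y + e' * pqind p q y), (1 * L + e' * K); repeat split.
    + intros y Hy; specialize (H3 y); apply Rabs_le_between in H3; lra.
    + apply unif_lim_lin; auto. apply unif_lim_pqind; lra.
    + lra.
Qed.

(** * Reduction to the singular part *)

(** The value 0 at [d = 0] agrees with the default of [ER_real] at the pole of [v]. *)
Definition sing (alpha d : R) : R := if Req_dec_T d 0 then 0 else Rpower (Rabs d) (- alpha).

Definition wsing (alpha b delta x : R) : R :=
  if Rlt_dec (Rabs (x - b)) delta then sing alpha (x - b) else 0.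

Lemma sing_pos alpha d : 0 <= sing alpha d.
Proof. unfold sing; destruct (Req_dec_T d 0); [lra | left; apply Rpower_pos]. Qed.

Lemma wsing_pos alpha b delta x : 0 <= wsing alpha b delta x.
Proof. unfold wsing; destruct (Rlt_dec _ _); [apply sing_pos | lra]. Qed.

(* [err n x] measures how close x is to the n-th point of the orbit of beta. *)
Definition Sing_ok (alpha beta : R) (err : nat -> R -> R) : Prop :=
  forall a eps, 0 < a -> 0 < eps -> exists delta N kappa, 0 < delta /\ 0 < kappa /\
    forall n, (N <= n)%nat -> forall x, a <= x <= 1 -> err n x <= kappa ->
      ln (INR n) * Prn n (wsing alpha beta delta) x <= eps.

Lemma is_RInt_sing_left alpha beta p q : 0 < alpha < 1 -> 0 < p <= q ->
  is_RInt (fun x => Rpower (Rabs (beta - x)) (- alpha)) (beta - q) (beta - p)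
    ((Rpower q (1 - alpha) - Rpower p (1 - alpha)) / (1 - alpha)).
Proof.
  intros Ha Hpq.
  assert (A := is_RInt_Rpower (1 - alpha) p q ltac:(lra) Hpq).
  set (l := (Rpower q (1 - alpha) - Rpower p (1 - alpha)) / (1 - alpha)) in *.
  assert (B : is_RInt (fun x => Rpower x (1 - alpha - 1)) (-1 * (beta - q) + beta) (-1 * (beta - p) + beta) (opp l)).
  { replace (-1 * (beta - q) + beta) with q by ring.
    replace (-1 * (beta - p) + beta) with p by ring.
    now apply (is_RInt_swap (V := R_NormedModule)). }
  apply (is_RInt_comp_lin (V := R_NormedModule)) in B.
  apply (is_RInt_scal (V := R_NormedModule) _ _ _ (-1)) in B.
  replace l with (scal (-1) (opp l)) by (unfold scal, opp; simpl; unfold mult; simpl; ring).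
  eapply is_RInt_ext; [|exact B].
  intros x Hx; apply Rmin_max_range_lt in Hx; [|lra].
  rewrite Rabs_pos_eq by lra. unfold scal; simpl; unfold mult; simpl.
  replace (-1 * x + beta) with (beta - x) by ring.
  replace (1 - alpha - 1) with (- alpha) by ring.
  match goal with |- ?u = ?v => change (@eq R u v) end; ring.
Qed.

Lemma is_RInt_sing_right alpha beta p q : 0 < alpha < 1 -> 0 < p <= q ->
  is_RInt (fun x => Rpower (Rabs (beta - x)) (- alpha)) (beta + p) (beta + q)
    ((Rpower q (1 - alpha) - Rpower p (1 - alpha)) / (1 - alpha)).
Proof.
  intros Ha Hpq.
  assert (A := is_RInt_Rpower (1 - alpha) p q ltac:(lra) Hpq).
  set (l := (Rpower q (1 - alpha) - Rpower p (1 - alpha)) / (1 - alpha)) in *.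
  assert (B : is_RInt (fun x => Rpower x (1 - alpha - 1)) (1 * (beta + p) + - beta) (1 * (beta + q) + - beta) l).
  { replace (1 * (beta + p) + - beta) with p by ring.
    replace (1 * (beta + q) + - beta) with q by ring. exact A. }
  apply (is_RInt_comp_lin (V := R_NormedModule)) in B.
  eapply is_RInt_ext; [|exact B].
  intros x Hx; apply Rmin_max_range_lt in Hx; [|lra].
  rewrite Rabs_minus_sym, Rabs_pos_eq by lra. unfold scal; simpl; unfold mult; simpl.
  replace (1 * x + - beta) with (x - beta) by ring.
  replace (1 - alpha - 1) with (- alpha) by ring.
  match goal with |- ?u = ?v => change (@eq R u v) end; ring.
Qed.

Lemma RInt_le_is (f w : R -> R) a b W : a <= b -> ex_RInt f a b -> is_RInt w a b W ->
  (forall x, a < x < b -> f x <= w x) -> RInt f a b <= W.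
Proof.
  intros Hab Hf Hw H; rewrite <- (is_RInt_unique _ _ _ _ Hw).
  apply RInt_le; auto. now exists W.
Qed.

Section Reduction.
Variables (alpha beta : R) (v : R -> ER).
Hypothesis Halpha : 0 < alpha < 1.
Hypothesis Hbeta : 0 < beta <= 1.
Hypothesis HU : in_U beta alpha v.

Let vr (x : R) : R := ER_real (v x).

Lemma in_U_finite x : 0 <= x <= 1 -> x <> beta -> exists r, v x = Fin r.
Proof.
  intros Hx Hb; destruct HU as (_ & _ & H & _).
  destruct (H x x) as [H1 _]; try lra. apply H1; lra.
Qed.

Lemma in_U_PInf : v beta = PInf.
Proof. destruct HU as (_ & _ & _ & (C1 & C2 & u1 & u2 & _ & _ & _ & H & _)); exact H. Qed.

Let vr_beta : vr beta = 0.
Proof. unfold vr; now rewrite in_U_PInf. Qed.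

Let vr_pos x : 0 <= x <= 1 -> 0 <= vr x.
Proof.
  intros Hx; destruct HU as (H & _); specialize (H x Hx); unfold vr.
  destruct (v x); simpl in *; lra.
Qed.

Let vr_BV a b : 0 <= a -> a <= b -> b <= 1 -> ~ (a <= beta <= b) -> BV_on vr a b.
Proof.
  intros; destruct HU as (_ & _ & H' & _). now apply H'.
Qed.

(** Cutting at 1 includes [beta = 1]: then [rp d = 1] and the piece on the right is a point. *)
Let rp (d : R) : R := Rmin (beta + d) 1.

Let rp_range d : 0 < d -> beta <= rp d <= 1 /\ (beta < 1 -> beta < rp d) /\ rp d <= beta + d.
Proof.
  intros; unfold rp; repeat split; [apply Rmin_glb; lra | apply Rmin_r | | apply Rmin_l].
  intros; apply Rmin_glb_lt; lra.
Qed.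

Let vr_intL a d : 0 <= a -> 0 < d -> a <= beta - d -> ex_RInt vr a (beta - d).
Proof. intros; apply BV_ex_RInt; auto; apply vr_BV; lra. Qed.

Let vr_intR d b : 0 < d -> rp d <= b -> b <= 1 -> ex_RInt vr (rp d) b.
Proof.
  intros Hd Hb Hb1; destruct (rp_range d Hd) as (H1 & H2 & _).
  destruct (Req_dec beta 1) as [E|E].
  - replace b with (rp d) by lra. apply ex_RInt_point.
  - apply BV_ex_RInt; auto; apply vr_BV; lra.
Qed.

Let GL c d (x : R) : R := pqind c (beta - d) x * (x * vr x).
Let GR d (x : R) : R := pqind (rp d) 1 x * (x * vr x).

Let GL_lim c d : 0 < c -> 0 < d -> c <= beta - d -> unif_lim (GL c d) (RInt vr c (beta - d)).
Proof. intros; apply BV_unif_lim; try lra. apply vr_BV; lra. Qed.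

Let GR_lim d : 0 < d -> unif_lim (GR d) (RInt vr (rp d) 1).
Proof.
  intros Hd; destruct (rp_range d Hd) as (H1 & H2 & _).
  destruct (Req_dec beta 1) as [E|E].
  - replace (rp d) with 1 by lra. rewrite RInt_point.
    apply unif_lim_ext with (fun _ => 0); [|apply unif_lim_zero].
    intros y Hy; unfold GR; rewrite pqind_out; lra.
  - apply BV_unif_lim; try lra. apply vr_BV; lra.
Qed.

(** Nonincreasing in [d] on (0, beta] and, because [alpha < 1], bounded as [d] tends to 0; its
    supremum over small [d] is the improper integral of [v]. *)
Let F (d : R) : R := RInt vr 0 (beta - d) + RInt vr (rp d) 1.

Let rp_incr d d' : d <= d' -> rp d <= rp d'.
Proof. intros; unfold rp; apply Rle_min_compat_r; lra. Qed.

Let F_split d d' : 0 < d -> d <= d' -> d' <= beta ->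
  F d = F d' + (RInt vr (beta - d') (beta - d) + RInt vr (rp d) (rp d')).
Proof.
  intros H1 H2 H3; pose proof (rp_incr d d' H2).
  destruct (rp_range d H1) as (A1 & _). destruct (rp_range d' ltac:(lra)) as (A2 & _).
  unfold F.
  rewrite (RInt_Chasles_R vr 0 (beta - d') (beta - d)) by (apply vr_intL; lra).
  rewrite (RInt_Chasles_R vr (rp d) (rp d') 1) by (apply vr_intR; lra). ring.
Qed.

Let F_decr d d' : 0 < d -> d <= d' -> d' <= beta -> F d' <= F d.
Proof.
  intros H1 H2 H3; rewrite (F_split d d') by auto; pose proof (rp_incr d d' H2).
  destruct (rp_range d H1) as (A1 & _). destruct (rp_range d' ltac:(lra)) as (A2 & _).
  assert (0 <= RInt vr (beta - d') (beta - d)).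
  { apply RInt_ge_0; [lra | apply vr_intL; lra | intros; apply vr_pos; lra]. }
  assert (0 <= RInt vr (rp d) (rp d')).
  { apply RInt_ge_0; [lra | apply vr_intR; lra | intros; apply vr_pos; lra]. }
  lra.
Qed.

Let near_beta : exists C2 d0, 0 < C2 /\ 0 < d0 < beta /\ forall x, 0 <= x <= 1 ->
  Rabs (x - beta) <= d0 -> x <> beta -> vr x <= C2 * Rpower (Rabs (beta - x)) (- alpha).
Proof.
  destruct HU as (_ & _ & _ & (C1 & C2 & u1 & u2 & _ & HC2 & Hu & _ & H)).
  exists C2, (Rmin (beta / 2) (Rmin ((beta - u1) / 2) ((u2 - beta) / 2))).
  set (m := Rmin ((beta - u1) / 2) ((u2 - beta) / 2)).
  pose proof (Rmin_l ((beta - u1) / 2) ((u2 - beta) / 2)) as M1.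
  pose proof (Rmin_r ((beta - u1) / 2) ((u2 - beta) / 2)) as M2. fold m in M1, M2.
  pose proof (Rmin_l (beta / 2) m) as M3; pose proof (Rmin_r (beta / 2) m) as M4.
  split; [auto|split].
  - split; [|lra]. apply Rmin_glb_lt; [lra|]. unfold m; apply Rmin_glb_lt; lra.
  - intros x Hx Hd Hne. apply Rabs_le_between in Hd.
    destruct (H x) as (r & Hr & _ & Hr2); auto; [lra|].
    unfold vr; rewrite Hr; simpl; lra.
Qed.

Let F_bound : exists d0 B, 0 < d0 <= beta /\ forall d, 0 < d <= d0 -> F d <= B.
Proof.
  destruct near_beta as (C2 & d0 & HC2 & Hd0 & Hnear).
  set (K := C2 * (Rpower d0 (1 - alpha) / (1 - alpha))).
  assert (HK0 : 0 <= Rpower d0 (1 - alpha) / (1 - alpha)).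
  { apply Rdiv_le_0_compat; [left; apply Rpower_pos | lra]. }
  exists d0, (F d0 + (K + K)); split; [lra|]. intros d Hd.
  rewrite (F_split d d0) by lra. apply Rplus_le_compat_l.
  assert (HK : forall q, 0 < q <= d0 -> d <= q ->
     C2 * ((Rpower q (1 - alpha) - Rpower d (1 - alpha)) / (1 - alpha)) <= K).
  { intros q Hq _; unfold K; apply Rmult_le_compat_l; [lra|].
    apply Rmult_le_compat_r; [left; apply Rinv_0_lt_compat; lra|].
    pose proof (Rpower_pos d (1 - alpha)).
    assert (Rpower q (1 - alpha) <= Rpower d0 (1 - alpha)) by (apply Rle_Rpower_l; lra). lra. }
  destruct (rp_range d ltac:(lra)) as (A1 & A1' & A1''). destruct (rp_range d0 ltac:(lra)) as (A2 & _ & A2').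
  assert (A3 := rp_incr d d0 ltac:(lra)).
  apply Rplus_le_compat.
  - eapply Rle_trans; [|apply (HK d0); lra].
    eapply RInt_le_is; [lra | apply vr_intL; lra | |].
    + apply (is_RInt_scal (V := R_NormedModule)), is_RInt_sing_left; lra.
    + intros x Hx; apply Hnear; [lra | rewrite Rabs_minus_sym, Rabs_pos_eq; lra | lra].
  - destruct (Rle_dec (beta + d) 1) as [Hd1|Hd1].
    + set (q := rp d0 - beta).
      assert (E : rp d = beta + d) by (unfold rp; apply Rmin_left; lra).
      eapply Rle_trans; [|apply (HK q); unfold q; lra].
      replace (rp d0) with (beta + q) by (unfold q; ring). rewrite E.
      eapply RInt_le_is; [unfold q; lra | | |].
      * rewrite <- E; apply vr_intR; unfold q; lra.
      * apply (is_RInt_scal (V := R_NormedModule)), is_RInt_sing_right; unfold q; lra.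
      * unfold q; intros x Hx; apply Hnear; [lra | rewrite Rabs_pos_eq; lra | lra].
    + assert (E : rp d = 1) by (unfold rp; apply Rmin_right; lra).
      replace (rp d0) with 1 by lra. rewrite E, RInt_point.
      change (0 <= K); unfold K; nra.
Qed.

Let int_small d : 0 < d < beta -> exists M, 0 < M /\
   (forall x, 0 <= x <= beta - d -> vr x <= M) /\
   forall c, 0 < c <= beta - d -> RInt vr 0 (beta - d) - M * c <= RInt vr c (beta - d).
Proof.
  intros Hd. destruct (vr_BV 0 (beta - d)) as ([M HM] & _ & _); try lra.
  exists (Rabs M + 1). pose proof (Rabs_pos M). split; [lra|].
  assert (HM' : forall x, 0 <= x <= beta - d -> vr x <= Rabs M + 1).
  { intros x Hx; specialize (HM x Hx). pose proof (Rle_abs (vr x)); pose proof (Rle_abs M); lra. }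
  split; [exact HM'|]. intros c Hc.
  rewrite (RInt_Chasles_R vr 0 c (beta - d)).
  2:{ apply (ex_RInt_Chasles_1 (V := R_CompleteNormedModule)) with (beta - d); [lra | apply vr_intL; lra]. }
  2:{ apply vr_intL; lra. }
  assert (RInt vr 0 c <= c * (Rabs M + 1)).
  { apply (RInt_le_is vr (fun _ => Rabs M + 1)); [lra | | |].
    - apply (ex_RInt_Chasles_1 (V := R_CompleteNormedModule)) with (beta - d); [lra | apply vr_intL; lra].
    - replace (c * (Rabs M + 1)) with (scal (c - 0) (Rabs M + 1)) by (unfold scal; simpl; unfold mult; simpl; ring).
      apply (is_RInt_const (V := R_NormedModule)).
    - intros; apply HM'; lra. }
  lra.
Qed.

(** The lower bound simply discards [v] near [beta] and near 0. The upper bound has to pay for what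
    was discarded, and only there does the control [Sing_ok] of the singular part enter. *)
Theorem singular_reduction : exists I : R, integral_v v beta I /\
  (forall a eps, 0 < a -> 0 < eps -> exists N : nat, forall n, (N <= n)%nat ->
     forall x, a <= x <= 1 -> I * / x - eps < ln (INR n) * Prn n vr x) /\
  (forall err, Sing_ok alpha beta err ->
     forall a eps, 0 < a -> 0 < eps -> exists (N : nat) kappa, 0 < kappa /\
     forall n, (N <= n)%nat -> forall x, a <= x <= 1 -> err n x <= kappa ->
       ln (INR n) * Prn n vr x < I * / x + eps).
Proof.
  destruct F_bound as (d0 & B & Hd0 & HB).
  destruct (completeness (fun y => exists d, 0 < d <= d0 /\ y = F d)) as [I [Hub Hlub]].
  { exists B; intros y (d & Hd & ->); auto. }
  { exists (F d0), d0; split; lra. }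
  assert (HI : forall d, 0 < d <= d0 -> F d <= I) by (intros d Hd; apply Hub; eauto).
  assert (HI2 : forall e, 0 < e -> exists d1, 0 < d1 <= d0 /\ I - e < F d1).
  { intros e He; apply NNPP; intros Hn. enough (I <= I - e) by lra.
    apply Hlub; intros y (d & Hd & ->). apply Rnot_lt_le; intros Hlt; apply Hn; eauto. }
  exists I; split; [|split].
  - intros eps He. destruct (HI2 eps He) as (d1 & Hd1 & HF). exists d1; split; [lra|].
    intros d Hd.
    assert (E1 : ex_RInt vr 0 (beta - d)) by (apply vr_intL; lra).
    assert (E2 : ex_RInt vr (Rmin (beta + d) 1) 1).
    { apply (vr_intR d); [lra | apply rp_range; lra | lra]. }
    exists (ex_RInt_Reals_0 _ _ _ E1), (ex_RInt_Reals_0 _ _ _ E2).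
    rewrite <- !RInt_Reals. fold vr. change (Rabs (F d - I) < eps).
    assert (F d1 <= F d) by (apply F_decr; lra).
    assert (F d <= I) by (apply HI; lra). apply Rabs_def1; lra.
  - intros a eps Ha He.
    destruct (HI2 (eps * a / 4) ltac:(nra)) as (d2 & Hd2 & HF2).
    set (d := Rmin d2 (beta / 2)).
    assert (Hd : 0 < d <= d0 /\ d < beta).
    { pose proof (Rmin_l d2 (beta / 2)); pose proof (Rmin_r d2 (beta / 2)).
      unfold d; repeat split; [apply Rmin_glb_lt|..]; lra. }
    assert (HF : I - eps * a / 4 < F d).
    { eapply Rlt_le_trans; [exact HF2|]. apply F_decr; [lra | apply Rmin_l | lra]. }
    destruct (int_small d ltac:(lra)) as (M & HM & _ & Hsm).
    set (c := Rmin (beta - d) (eps * a / 4 / M)).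
    assert (Hc : 0 < c <= beta - d).
    { split; [|apply Rmin_l]. apply Rmin_glb_lt; [lra|]. apply Rdiv_lt_0_compat; [nra | auto]. }
    assert (HMc : M * c <= eps * a / 4).
    { apply Rle_trans with (M * (eps * a / 4 / M)); [|right; field; lra].
      apply Rmult_le_compat_l; [lra | apply Rmin_r]. }
    specialize (Hsm c Hc).
    assert (HG : unif_lim (fun y => GL c d y + GR d y) (RInt vr c (beta - d) + RInt vr (rp d) 1)).
    { apply unif_lim_plus; [apply GL_lim; lra | apply GR_lim; lra]. }
    destruct (HG a (eps * a / 4) Ha ltac:(nra)) as [N HN].
    exists (N + 1)%nat; intros n Hn x Hx.
    specialize (HN n ltac:(lia) x Hx). apply Rabs_def2 in HN.
    assert (Hle : Qn n (fun y => GL c d y + GR d y) x <= Qn n (fun y => y * vr y) x).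
    { apply Qn_le; [|lra]. intros y Hy; unfold GL, GR.
      assert (0 <= y * vr y) by (apply Rmult_le_pos; [lra | apply vr_pos; lra]).
      destruct (rp_range d ltac:(lra)) as (A1 & A2 & _).
      destruct (Rlt_le_dec y (beta - d)).
      - rewrite (pqind_out (rp d)) by lra.
        destruct (Rle_dec c y); [rewrite pqind_in | rewrite pqind_out]; lra.
      - rewrite (pqind_out c) by lra.
        destruct (classic (rp d <= y < 1)); [rewrite pqind_in | rewrite pqind_out]; lra. }
    rewrite (Qn_Prn n vr (fun y => y * vr y)) in Hle by (auto; lra).
    assert (Hln0 : 0 <= ln (INR n)).
    { rewrite <- ln_1; apply ln_le; [lra|]. apply (le_INR 1); lia. }
    apply Rmult_le_compat_l with (r := ln (INR n)) in Hle; auto.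
    unfold F in HF.
    assert (Hf : I - eps * a < x * (ln (INR n) * Prn n vr x)) by nra.
    apply Rmult_lt_reg_l with x; [lra|].
    replace (x * (I * / x - eps)) with (I - eps * x) by (field; lra). nra.
  - intros err Herr a eps Ha He.
    destruct near_beta as (C2 & d1 & HC2 & Hd1 & Hnear).
    destruct (Herr a (eps * a / 8 / C2) Ha ltac:(apply Rdiv_lt_0_compat; nra))
      as (ds & N1 & kappa & Hds & Hk & HS).
    set (d := Rmin d0 (Rmin (ds / 2) d1)).
    assert (Hd : 0 < d /\ d <= d0 /\ d <= ds / 2 /\ d <= d1).
    { pose proof (Rmin_l d0 (Rmin (ds / 2) d1)); pose proof (Rmin_r d0 (Rmin (ds / 2) d1)).
      pose proof (Rmin_l (ds / 2) d1); pose proof (Rmin_r (ds / 2) d1).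
      unfold d; repeat split; [|lra..]. repeat apply Rmin_glb_lt; lra. }
    destruct (int_small d ltac:(lra)) as (M & HM & HMb & _).
    (* Below [c <= k^2] one has [y vr y <= M y <= M k sqrt y]; by [Qn_pw_bound] with exponent 1/2
       this contributes at most [2 M k = eps a / 8]. *)
    set (k := eps * a / 16 / M).
    assert (Hk0 : 0 < k) by (apply Rdiv_lt_0_compat; [nra | auto]).
    set (c := Rmin (beta - d) (k * k)).
    assert (Hc : 0 < c <= beta - d).
    { split; [|apply Rmin_l]. apply Rmin_glb_lt; [lra | nra]. }
    assert (Hsq : sqrt c <= k).
    { rewrite <- (sqrt_square k) by lra. apply sqrt_le_1_alt, Rmin_r. }
    destruct (rp_range d ltac:(lra)) as (A1 & A2 & A3).
    (* The half-open intervals miss the point 1. It is restored by [ind 1], whose limit is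
       [- ln 1 = 0]. *)
    set (G := fun y => (GL c d y + GR d y) + vr 1 * ind 1 y).
    set (L := RInt vr c (beta - d) + RInt vr (rp d) 1).
    assert (HG : unif_lim G L).
    { replace L with (L + vr 1 * - ln 1) by (rewrite ln_1; ring).
      apply unif_lim_plus; [apply unif_lim_plus; [apply GL_lim; lra | apply GR_lim; lra]|].
      apply unif_lim_scal, unif_lim_ind; lra. }
    assert (HL : L <= I).
    { apply Rle_trans with (F d); [|apply HI; lra]. unfold F, L.
      assert (Hi : ex_RInt vr 0 c) by (apply (ex_RInt_Chasles_1 (V := R_CompleteNormedModule)) with (beta - d); [lra | apply vr_intL; lra]).
      rewrite (RInt_Chasles_R vr 0 c (beta - d)) by (auto; apply vr_intL; lra).
      assert (0 <= RInt vr 0 c) by (apply RInt_ge_0; [lra | auto | intros; apply vr_pos; lra]).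
      lra. }
    destruct (HG a (eps * a / 4) Ha ltac:(nra)) as [N2 HN2].
    exists (N1 + N2 + 1)%nat, kappa; split; auto. intros n Hn x Hx Hex.
    specialize (HN2 n ltac:(lia) x Hx). apply Rabs_def2 in HN2.
    specialize (HS n ltac:(lia) x Hx Hex).
    (* The majorant consists of the regular part [G], a square root for [y < c] and the singular
       part. The coefficients 1 give it the shape of [Qn_lin], applied twice. *)
    assert (Hle : Qn n (fun y => y * vr y) x <=
      Qn n (fun y => 1 * (fun y => 1 * G y + (M * k) * pw (1/2) y) y
                     + C2 * (fun y => y * wsing alpha beta ds y) y) x).
    { apply Qn_le; [|lra]. intros y Hy.
      assert (Hv : 0 <= y * vr y) by (apply Rmult_le_pos; [lra | apply vr_pos; lra]).
      assert (Hw : 0 <= C2 * (y * wsing alpha beta ds y)).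
      { apply Rmult_le_pos; [lra|]. apply Rmult_le_pos; [lra | apply wsing_pos]. }
      assert (Hpw : 0 <= M * k * pw (1/2) y).
      { apply Rmult_le_pos; [nra|]. rewrite pw_pos by lra; left; apply Rpower_pos. }
      assert (Hi1 : 0 <= vr 1 * ind 1 y).
      { apply Rmult_le_pos; [apply vr_pos; lra|]. unfold ind; destruct (Rle_dec 1 y); lra. }
      assert (HGL : 0 <= GL c d y).
      { unfold GL; apply Rmult_le_pos; auto.
        destruct (classic (c <= y < beta - d)); [rewrite pqind_in | rewrite pqind_out]; lra. }
      assert (HGR : 0 <= GR d y).
      { unfold GR; apply Rmult_le_pos; auto.
        destruct (classic (rp d <= y < 1)); [rewrite pqind_in | rewrite pqind_out]; lra. }
      unfold G.
      destruct (Rlt_le_dec y c) as [Hyc|Hyc].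
      { assert (y * vr y <= M * k * pw (1/2) y).
        { rewrite pw_pos by lra. replace (1/2) with (/2) by lra. rewrite Rpower_sqrt by lra.
          assert (vr y <= M) by (apply HMb; lra).
          assert (sqrt y <= sqrt c) by (apply sqrt_le_1_alt; lra).
          pose proof (sqrt_pos y). pose proof (sqrt_def y ltac:(lra)) as Esq.
          assert (y * vr y <= y * M) by (apply Rmult_le_compat_l; lra).
          assert (sqrt y * sqrt y <= k * sqrt y) by (apply Rmult_le_compat_r; lra).
          assert (M * (sqrt y * sqrt y) <= M * (k * sqrt y)) by (apply Rmult_le_compat_l; lra).
          rewrite Esq in *. lra. }
        lra. }
      destruct (Rlt_le_dec y (beta - d)) as [Hyd|Hyd].
      { assert (GL c d y = y * vr y) by (unfold GL; rewrite pqind_in; lra). lra. }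
      destruct (Req_dec y 1) as [Hy1|Hy1].
      { assert (vr 1 * ind 1 y = y * vr y).
        { rewrite Hy1; unfold ind; destruct (Rle_dec 1 1); lra. }
        lra. }
      destruct (Rle_dec (rp d) y) as [Hyr|Hyr].
      { assert (GR d y = y * vr y) by (unfold GR; rewrite pqind_in; lra). lra. }
      assert (vr y <= C2 * wsing alpha beta ds y).
      { assert (Rabs (y - beta) <= d).
        { apply Rabs_le_between; unfold rp in *; split; [lra|].
          apply Rnot_le_lt in Hyr. pose proof (Rmin_l (beta + d) 1); lra. }
        unfold wsing; destruct (Rlt_dec _ _); [|lra].
        unfold sing; destruct (Req_dec_T (y - beta) 0) as [E|E].
        - replace y with beta by lra. rewrite vr_beta; lra.
        - rewrite Rabs_minus_sym. apply Hnear; lra. }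
      assert (y * vr y <= C2 * (y * wsing alpha beta ds y)) by nra. lra. }
    rewrite Qn_lin, Qn_lin in Hle by lra.
    rewrite (Qn_Prn n vr (fun y => y * vr y)) in Hle by (auto; lra).
    rewrite (Qn_Prn n (wsing alpha beta ds) (fun y => y * wsing alpha beta ds y)) in Hle by (auto; lra).
    assert (Hln0 : 0 <= ln (INR n)).
    { rewrite <- ln_1; apply ln_le; [lra|]. apply (le_INR 1); lia. }
    apply Rmult_le_compat_l with (r := ln (INR n)) in Hle; auto.
    destruct (Qn_pw_bound (1/2) n x ltac:(lra) ltac:(lra)) as [_ Hp].
    replace (/ (1/2)) with 2 in Hp by lra.
    assert (Hp0 : 0 <= Qn n (pw (1/2)) x).
    { apply cone_pos; [apply cone_Qn, cone_pw; lra | lra]. }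
    assert (Hln2 : ln (INR n) <= ln (1 + INR n)).
    { apply ln_le; [|lra]. apply (lt_INR 0); lia. }
    assert (Hp2 : ln (INR n) * Qn n (pw (1/2)) x <= 2) by nra.
    assert (HMk : M * k = eps * a / 16) by (unfold k; field; lra).
    assert (T1 : M * k * (ln (INR n) * Qn n (pw (1/2)) x) <= eps * a / 8) by (rewrite HMk; nra).
    set (W := ln (INR n) * Prn n (wsing alpha beta ds) x) in *.
    assert (T2 : C2 * (x * W) <= eps * a / 8).
    { assert (HW0 : 0 <= W).
      { apply Rmult_le_pos; auto. apply Prn_nonneg; [intros; apply wsing_pos | lra]. }
      apply Rle_trans with (C2 * W); [apply Rmult_le_compat_l; nra|].
      apply Rle_trans with (C2 * (eps * a / 8 / C2)); [apply Rmult_le_compat_l; lra | right; field; lra]. }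
    assert (Hf : x * (ln (INR n) * Prn n vr x) < I + eps * a).
    { unfold W in T2. nra. }
    apply Rmult_lt_reg_l with x; [lra|].
    replace (x * (I * / x + eps)) with (I + eps * x) by (field; lra). nra.
Qed.

End Reduction.

(** * The singular part for rational [beta] *)

Lemma f10_sub x y : 0 <= x -> 0 <= y -> f10 x - f10 y = (x - y) / ((1 + x) * (1 + y)).
Proof. intros; unfold f10; field; lra. Qed.

Lemma f11_sub x y : 0 <= x -> 0 <= y -> f11 x - f11 y = - (x - y) / ((1 + x) * (1 + y)).
Proof. intros; unfold f11; field; lra. Qed.

Lemma f11_f10_sub x y : 0 <= x -> 0 <= y -> f11 x - f10 y = (1 - x * y) / ((1 + x) * (1 + y)).
Proof. intros; unfold f10, f11; field; lra. Qed.

Lemma Rpower_div_base x y s : 0 < x -> 0 < y -> Rpower (x / y) s = Rpower x s * Rpower y (- s).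
Proof.
  intros; unfold Rdiv. rewrite <- Rpower_mult_distr by (auto; now apply Rinv_0_lt_compat).
  f_equal. unfold Rpower; f_equal. rewrite ln_Rinv by auto; ring.
Qed.

Lemma Rpower_anti x y s : 0 < x <= y -> 0 <= s -> Rpower y (- s) <= Rpower x (- s).
Proof.
  intros; rewrite !Rpower_Ropp. apply Rinv_le_contravar; [apply Rpower_pos|].
  apply Rle_Rpower_l; lra.
Qed.

Lemma Rpower_le_1_anti x s t : 0 < x <= 1 -> s <= t -> Rpower x t <= Rpower x s.
Proof.
  intros Hx Hst; unfold Rpower.
  assert (ln x <= 0) by (rewrite <- ln_1; apply ln_le; lra).
  assert (t * ln x <= s * ln x) by nra.
  destruct H0 as [H0| ->]; [left; now apply exp_increasing | lra].
Qed.

Lemma Rpower_one_base s : Rpower 1 s = 1.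
Proof. unfold Rpower; rewrite ln_1, Rmult_0_r; apply exp_0. Qed.

Lemma sing_opp alpha d : sing alpha (- d) = sing alpha d.
Proof.
  unfold sing; rewrite Rabs_Ropp.
  destruct (Req_dec_T (- d) 0), (Req_dec_T d 0); try reflexivity; lra.
Qed.

Lemma sing_div alpha d k : 0 < k -> sing alpha (d / k) = Rpower k alpha * sing alpha d.
Proof.
  intros Hk; unfold sing.
  destruct (Req_dec_T d 0) as [->|Hd].
  - destruct (Req_dec_T (0 / k) 0) as [_|H]; [ring | exfalso; apply H; field; lra].
  - destruct (Req_dec_T (d / k) 0) as [H|_].
    + exfalso; apply Hd. replace d with (d / k * k) by (field; lra). rewrite H; ring.
    + unfold Rdiv at 1; rewrite Rabs_mult, (Rabs_pos_eq (/ k)) by (left; now apply Rinv_0_lt_compat).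
      change (Rabs d * / k) with (Rabs d / k).
      rewrite Rpower_div_base by (auto; now apply Rabs_pos_lt).
      rewrite Ropp_involutive; ring.
Qed.

Lemma sing_le alpha d m : 0 < alpha -> 0 < m <= Rabs d -> sing alpha d <= Rpower m (- alpha).
Proof.
  intros Ha Hm; unfold sing; destruct (Req_dec_T d 0); [left; apply Rpower_pos|].
  apply Rpower_anti; lra.
Qed.

Lemma inv_sq_le1 x : 0 <= x -> / (1 + x) ^ 2 <= 1.
Proof. intros; rewrite <- Rinv_1; apply Rinv_le_contravar; nra. Qed.

Lemma branch_dist x y (f : R -> R) : f = f10 \/ f = f11 -> 0 <= x <= 1 -> 0 <= y <= 1 ->
  (f x - f y = (x - y) / ((1 + x) * (1 + y)) \/ f x - f y = - (x - y) / ((1 + x) * (1 + y))) /\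
  Rabs (x - y) <= 4 * Rabs (f x - f y).
Proof.
  intros Hf Hx Hy.
  assert (HK : 0 < (1 + x) * (1 + y) <= 4) by nra.
  assert (E : f x - f y = (x - y) / ((1 + x) * (1 + y)) \/ f x - f y = - (x - y) / ((1 + x) * (1 + y))).
  { destruct Hf as [->| ->]; [left; apply f10_sub | right; apply f11_sub]; lra. }
  split; auto.
  assert (E' : Rabs (f x - f y) = Rabs (x - y) / ((1 + x) * (1 + y))).
  { destruct E as [->| ->]; unfold Rdiv; rewrite Rabs_mult, ?Rabs_Ropp, (Rabs_pos_eq (/ _)); auto;
      left; apply Rinv_0_lt_compat; lra. }
  rewrite E'. pose proof (Rabs_pos (x - y)).
  replace (4 * (Rabs (x - y) / ((1 + x) * (1 + y)))) with (4 * Rabs (x - y) / ((1 + x) * (1 + y))) by (field; lra).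
  apply div_ge; [lra|]. nra.
Qed.

(** An equality rather than an estimate, because the branches are fractional linear; the exact
    propagation of [Bsing] rests on it. *)
Lemma sing_branch alpha x y (f : R -> R) : f = f10 \/ f = f11 -> 0 <= x <= 1 -> 0 <= y <= 1 ->
  sing alpha (f x - f y) = Rpower ((1 + x) * (1 + y)) alpha * sing alpha (x - y).
Proof.
  intros Hf Hx Hy.
  assert (0 < (1 + x) * (1 + y)) by nra.
  destruct (branch_dist x y f Hf Hx Hy) as [[->| ->] _]; rewrite sing_div by auto; auto.
  now rewrite sing_opp.
Qed.

Lemma wsing_branch alpha x y (f : R -> R) delta : 0 < alpha < 1 -> f = f10 \/ f = f11 ->
  0 <= x <= 1 -> 0 <= y <= 1 ->
  wsing alpha (f y) delta (f x) <= Rpower 4 alpha * wsing alpha y (4 * delta) x.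
Proof.
  intros Ha Hf Hx Hy; unfold wsing.
  pose proof (Rpower_pos 4 alpha). pose proof (sing_pos alpha (x - y)).
  destruct (branch_dist x y f Hf Hx Hy) as [_ Hd].
  destruct (Rlt_dec (Rabs (f x - f y)) delta).
  - destruct (Rlt_dec (Rabs (x - y)) (4 * delta)); [|lra].
    rewrite (sing_branch alpha x y f) by auto. apply Rmult_le_compat_r; auto.
    apply Rle_Rpower_l; [lra | split; nra].
  - destruct (Rlt_dec (Rabs (x - y)) (4 * delta)); nra.
Qed.

(** A window of radius at most the distance from [beta] to 1/2 meets the range of one branch only.
    The point 1/2 itself lies in both ranges and is the image of 1 under both, whence the factor
    2. *)
Lemma Pr_wsing alpha beta : 0 < alpha < 1 -> 0 <= beta <= 1 ->
  exists d1, 0 < d1 /\ forall delta, delta <= d1 -> forall x, 0 < x <= 1 ->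
    Pr (wsing alpha beta delta) x <= 2 * Rpower 4 alpha * wsing alpha (T1 beta) (4 * delta) x.
Proof.
  intros Ha Hb.
  exists (if Req_dec_T beta (1/2) then 1 else Rabs (beta - 1/2)); split.
  { destruct (Req_dec_T _ _); [lra | apply Rabs_pos_lt; lra]. }
  intros delta Hd x Hx.
  pose proof (f10_range x Hx) as R0; pose proof (f11_range x Hx) as R1.
  pose proof (T1_range beta Hb) as RT. pose proof (T1_inv beta Hb) as E.
  assert (Hw0 : 0 <= Rpower 4 alpha * wsing alpha (T1 beta) (4 * delta) x).
  { apply Rmult_le_pos; [left; apply Rpower_pos | apply wsing_pos]. }
  assert (A : forall f, (f = f10 \/ f = f11) -> (beta = f (T1 beta) \/ delta <= Rabs (f x - beta)) ->
     wsing alpha beta delta (f x) <= Rpower 4 alpha * wsing alpha (T1 beta) (4 * delta) x).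
  { intros f Hf [Hfb|Hfb].
    - rewrite Hfb at 1. apply wsing_branch; auto; lra.
    - unfold wsing at 1; destruct (Rlt_dec _ _); lra. }
  assert (A0 : wsing alpha beta delta (f10 x) <= Rpower 4 alpha * wsing alpha (T1 beta) (4 * delta) x).
  { apply A; auto. destruct (Req_dec_T beta (1/2)) as [Eb|Eb].
    - left; destruct (Rle_dec beta (1/2)); [auto | lra].
    - destruct (Rle_dec beta (1/2)); [now left|]. right.
      rewrite Rabs_minus_sym. rewrite Rabs_pos_eq in * by lra. lra. }
  assert (A1 : wsing alpha beta delta (f11 x) <= Rpower 4 alpha * wsing alpha (T1 beta) (4 * delta) x).
  { apply A; auto. destruct (Req_dec_T beta (1/2)) as [Eb|Eb].
    - left. rewrite Eb. unfold T1; destruct (Rle_dec (1/2) (1/2)); [|lra]. unfold f11; field.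
    - destruct (Rle_dec beta (1/2)); [|now left]. right.
      rewrite Rabs_minus_sym in Hd. rewrite Rabs_pos_eq in * by lra. lra. }
  unfold Pr. assert (Hi := inv_sq_le1 x ltac:(lra)). assert (Hi0 := inv_sq_pos x ltac:(lra)).
  assert (0 <= wsing alpha beta delta (f10 x)) by apply wsing_pos.
  assert (0 <= wsing alpha beta delta (f11 x)) by apply wsing_pos. nra.
Qed.

(** Induction on the number of steps the orbit takes to reach 0, where multiplication by [x] turns
    the singularity into the bounded power [x^(1 - alpha)]. *)
Lemma rational_sing_aux alpha m : 0 < alpha < 1 -> forall beta, 0 <= beta <= 1 -> orb beta m = 0 ->
  forall eps, 0 < eps -> exists d1 N, 0 < d1 /\ forall delta, 0 < delta <= d1 ->
    forall n, (N <= n)%nat -> forall x, 0 < x <= 1 ->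
    ln (INR n) * (x * Prn n (wsing alpha beta delta) x) <= eps.
Proof.
  intros Ha; induction m as [|m IH]; intros beta Hb Hm eps He.
  - unfold orb in Hm; simpl in Hm; subst beta.
    (* [y^(1 - alpha) = y^eta y^eta <= delta^eta y^eta]: one half supplies the smallness, the other
       an element of the cone. Then [d1^eta = eps eta] compensates the [/ eta] of [Qn_pw_bound]. *)
    set (eta := (1 - alpha) / 2). assert (Heta : 0 < eta <= 1) by (unfold eta; lra).
    set (d1 := Rpower (eps * eta) (/ eta)).
    exists d1, 1%nat; split; [apply Rpower_pos|].
    intros delta Hd n Hn x Hx.
    assert (Hde : Rpower delta eta <= eps * eta).
    { apply Rle_trans with (Rpower d1 eta); [apply Rle_Rpower_l; lra|].
      unfold d1; rewrite Rpower_mult, Rinv_l, Rpower_1 by nra; lra. }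
    rewrite <- (Qn_Prn n (wsing alpha 0 delta) (fun y => y * wsing alpha 0 delta y)) by auto.
    assert (Hle : Qn n (fun y => y * wsing alpha 0 delta y) x <=
       Qn n (fun y => Rpower delta eta * pw eta y + 0 * pw eta y) x).
    { apply Qn_le; auto. intros y Hy. rewrite pw_pos by lra.
      pose proof (Rpower_pos delta eta); pose proof (Rpower_pos y eta).
      unfold wsing; destruct (Rlt_dec _ _) as [Hlt|_]; [|nra].
      rewrite Rminus_0_r in *. rewrite Rabs_pos_eq in Hlt by lra.
      unfold sing; destruct (Req_dec_T y 0); [nra|]. rewrite Rabs_pos_eq by lra.
      replace (y * Rpower y (- alpha)) with (Rpower y eta * Rpower y eta).
      - assert (Rpower y eta <= Rpower delta eta) by (apply Rle_Rpower_l; lra). nra.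
      - rewrite <- (Rpower_1 y) at 3 by lra. rewrite <- !Rpower_plus. f_equal; unfold eta; field. }
    rewrite Qn_lin in Hle by lra.
    destruct (Qn_pw_bound eta n x Heta Hx) as [_ Hp].
    assert (Hln : 0 <= ln (INR n) <= ln (1 + INR n)).
    { assert (1 <= INR n) by (apply (le_INR 1); auto).
      split; [rewrite <- ln_1; apply ln_le; lra | apply ln_le; lra]. }
    assert (Hp0 : 0 <= Qn n (pw eta) x) by (apply cone_pos; [apply cone_Qn, cone_pw; auto | lra]).
    apply Rle_trans with (Rpower delta eta * (ln (INR n) * Qn n (pw eta) x)); [nra|].
    assert (Hp2 : ln (INR n) * Qn n (pw eta) x <= / eta) by nra.
    apply Rle_trans with (Rpower delta eta * / eta).
    { apply Rmult_le_compat_l; auto. left; apply Rpower_pos. }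
    apply Rle_trans with (eps * eta * / eta); [|right; field; lra].
    apply Rmult_le_compat_r; auto. left; apply Rinv_0_lt_compat; lra.
  - assert (Hm' : orb (T1 beta) m = 0).
    { rewrite <- Hm. unfold orb. clear. induction m as [|m IH]; simpl; [reflexivity | now rewrite IH]. }
    (* [Pr_wsing] costs [2 * Rpower 4 alpha], and [ln (n + 1) <= 2 ln n] costs another 2. *)
    set (K := 4 * Rpower 4 alpha). assert (HK : 0 < K) by (unfold K; pose proof (Rpower_pos 4 alpha); lra).
    destruct (IH (T1 beta) (T1_range beta Hb) Hm' (eps / K)) as (d1 & N & Hd1 & HN).
    { apply Rdiv_lt_0_compat; lra. }
    destruct (Pr_wsing alpha beta Ha Hb) as (d2 & Hd2 & HP).
    (* One step widens the window by 4. [N + 3] leaves a predecessor of at least 2, as the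
       comparison of logarithms requires. *)
    exists (Rmin (d1 / 4) d2), (N + 3)%nat; split; [apply Rmin_glb_lt; lra|].
    intros delta Hd n Hn x Hx.
    pose proof (Rmin_l (d1 / 4) d2); pose proof (Rmin_r (d1 / 4) d2).
    destruct n as [|n]; [lia|].
    replace (S n) with (n + 1)%nat by lia. rewrite Prn_add.
    specialize (HN (4 * delta) ltac:(lra) n ltac:(lia) x Hx).
    assert (Hle : Prn n (Prn 1 (wsing alpha beta delta)) x <=
       2 * Rpower 4 alpha * Prn n (wsing alpha (T1 beta) (4 * delta)) x).
    { rewrite <- Prn_scal. apply Prn_le; auto. intros y Hy; apply HP; auto; lra. }
    set (W := Prn n (wsing alpha (T1 beta) (4 * delta)) x) in *.
    assert (HW : 0 <= W) by (apply Prn_nonneg; auto; intros; apply wsing_pos).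
    assert (Hn2 : 2 <= INR n) by (apply (le_INR 2); lia).
    assert (Hln : 0 <= ln (INR (n + 1)) <= 2 * ln (INR n)).
    { rewrite plus_INR; simpl (INR 1). split; [rewrite <- ln_1; apply ln_le; lra|].
      replace (2 * ln (INR n)) with (ln (INR n) + ln (INR n)) by ring.
      rewrite <- ln_mult by lra. apply ln_le; nra. }
    apply Rle_trans with (K * (ln (INR n) * (x * W))).
    2:{ apply Rle_trans with (K * (eps / K)); [apply Rmult_le_compat_l; lra | right; field; lra]. }
    apply Rle_trans with (ln (INR (n + 1)) * (x * (2 * Rpower 4 alpha * W))).
    { apply Rmult_le_compat_l; [lra|]. apply Rmult_le_compat_l; lra. }
    pose proof (Rpower_pos 4 alpha).
    apply Rle_trans with (2 * ln (INR n) * (x * (2 * Rpower 4 alpha * W))).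
    { apply Rmult_le_compat_r; [|lra]. repeat apply Rmult_le_pos; lra. }
    unfold K; right; ring.
Qed.

(** The subtractive Euclidean algorithm: [a / b] goes to [a / (b - a)] or [(b - a) / a], so the sum
    of numerator and denominator drops from [a + b] to [b]. *)
Lemma rational_orbit beta : 0 <= beta <= 1 -> is_rational beta -> exists m, orb beta m = 0.
Proof.
  intros Hb (p & q & Hq & E).
  assert (H : exists a b : nat, (0 < b)%nat /\ beta = INR a / INR b).
  { exists (Z.abs_nat p), (Z.abs_nat q); split; [lia|].
    rewrite !INR_IZR_INZ, !Zabs2Nat.id_abs, !abs_IZR.
    assert (IZR q <> 0) by (now apply not_0_IZR).
    rewrite <- Rabs_div by auto. rewrite <- E, Rabs_pos_eq; lra. }
  clear E Hq p q. destruct H as (a & b & Hb0 & E).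
  remember (a + b)%nat as s eqn:Hs. revert a b beta Hb Hb0 E Hs.
  induction s as [s IH] using lt_wf_ind; intros a b beta Hb Hb0 E Hs.
  assert (HbR : 0 < INR b) by (now apply (lt_INR 0)).
  destruct (Nat.eq_dec a 0) as [->|Ha].
  { exists 0%nat; unfold orb; simpl; rewrite E; simpl; unfold Rdiv; ring. }
  assert (Hab : (a <= b)%nat).
  { apply INR_le. assert (INR a = beta * INR b) by (rewrite E; field; lra). nra. }
  assert (HaR : 0 < INR a) by (apply (lt_INR 0); lia).
  assert (Hnext : exists m, orb (T1 beta) m = 0).
  { pose proof (T1_range beta Hb). unfold T1 in *. destruct (Rle_dec beta (1/2)) as [Hl|Hl].
    - assert (Ha2 : (2 * a <= b)%nat).
      { apply INR_le. rewrite mult_INR; simpl (INR 2).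
        assert (INR a = beta * INR b) by (rewrite E; field; lra). nra. }
      assert (HbaR : 0 < INR b - INR a) by (rewrite <- minus_INR by auto; apply (lt_INR 0); lia).
      apply (IH b ltac:(lia) a (b - a)%nat); auto; try lia.
      rewrite minus_INR by auto. rewrite E; field; lra.
    - apply (IH b ltac:(lia) (b - a)%nat a); auto; try lia.
      rewrite minus_INR by auto. rewrite E; field; lra. }
  destruct Hnext as [m Hm]. exists (S m). rewrite <- Hm. unfold orb.
  clear. induction m as [|m IH]; simpl; [reflexivity | now rewrite <- IH].
Qed.

Theorem rational_Sing_ok alpha beta : 0 < alpha < 1 -> 0 <= beta <= 1 -> is_rational beta ->
  Sing_ok alpha beta (fun _ _ => 0).
Proof.
  intros Ha Hb Hr a eps Ha0 He.
  destruct (rational_orbit beta Hb Hr) as [m Hm].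
  destruct (rational_sing_aux alpha m Ha beta Hb Hm (eps * a) ltac:(nra)) as (d & N & Hd & H).
  exists d, (N + 1)%nat, 1; repeat split; [auto | lra |].
  intros n Hn x Hx _. specialize (H d ltac:(lra) n ltac:(lia) x ltac:(lra)).
  assert (0 <= ln (INR n)) by (rewrite <- ln_1; apply ln_le; [lra | apply (le_INR 1); lia]).
  assert (0 <= Prn n (wsing alpha beta d) x) by (apply Prn_nonneg; [intros; apply wsing_pos | lra]).
  assert (0 <= ln (INR n) * Prn n (wsing alpha beta d) x) by nra.
  nra.
Qed.

(** * The singular part for irrational [beta] *)

(* The inverse branch of T1^k through beta is x |-> (A x + B)/(C x + D) with
   (A,B) = [mob beta (1,0) k] and (C,D) = [mob beta (0,1) k]. *)
Fixpoint mob (beta : R) (p : nat * nat) (k : nat) : nat * nat :=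
  match k with
  | O => p
  | S k' => let (c, d) := mob beta p k' in
      if Rle_dec (orb beta k') (1/2) then (c + d, d)%nat else (d, c + d)%nat
  end.

Definition denC (beta : R) (k : nat) : R := INR (fst (mob beta (0, 1)%nat k)).
Definition denD (beta : R) (k : nat) : R := INR (snd (mob beta (0, 1)%nat k)).
Definition denS (beta : R) (k : nat) : R := denC beta k + denD beta k.

(** Up to a factor 2, a lower bound for [C x + D] on the half of [0,1] opposite to [orb beta k]:
    that half is [1/2,1] in the first case and [0,1/2] in the second. *)
Definition denM (beta : R) (k : nat) : R :=
  if Rle_dec (orb beta k) (1/2) then denS beta k else denD beta k.

Lemma den_step beta k :
  (orb beta k <= 1/2 -> denC beta (S k) = denC beta k + denD beta k /\ denD beta (S k) = denD beta k) /\
  (~ orb beta k <= 1/2 -> denC beta (S k) = denD beta k /\ denD beta (S k) = denC beta k + denD beta k).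
Proof.
  unfold denC, denD; simpl; destruct (mob beta (0, 1)%nat k) as [c d]; simpl.
  destruct (Rle_dec (orb beta k) (1/2)); simpl; rewrite plus_INR; tauto.
Qed.

Lemma denS_step beta k : denS beta (S k) = denS beta k + denD beta k.
Proof.
  unfold denS; destruct (den_step beta k) as [H0 H1].
  destruct (Rle_dec (orb beta k) (1/2)) as [H|H];
    [destruct (H0 H) as [-> ->] | destruct (H1 H) as [-> ->]]; ring.
Qed.

Lemma denC_pos beta k : 0 <= denC beta k.
Proof. apply pos_INR. Qed.

Lemma denD_ge1 beta k : 1 <= denD beta k.
Proof.
  induction k as [|k IH]; [unfold denD; simpl; lra|].
  pose proof (denC_pos beta k). destruct (den_step beta k) as [H0 H1].
  destruct (Rle_dec (orb beta k) (1/2)) as [Hl|Hl];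
    [destruct (H0 Hl) as [_ ->] | destruct (H1 Hl) as [_ ->]]; lra.
Qed.

Lemma denS_ge beta k : INR k + 1 <= denS beta k.
Proof.
  induction k as [|k IH]; [unfold denS, denC, denD; simpl; lra|].
  rewrite denS_step, S_INR. pose proof (denD_ge1 beta k); lra.
Qed.

Lemma denD_le_S beta k : denD beta k <= denS beta k.
Proof. unfold denS; pose proof (denC_pos beta k); lra. Qed.

Fixpoint bsum (f : nat -> R) (n : nat) : R :=
  match n with O => 0 | S m => bsum f m + f m end.

Lemma bsum_incr f n m : (forall k, 0 <= f k) -> (n <= m)%nat -> bsum f n <= bsum f m.
Proof. intros H; induction 1 as [|m _ IH]; [lra|]. simpl; specialize (H m); lra. Qed.

Lemma bsum_tail f B : (forall k, 0 <= f k) -> (forall n, bsum f n <= B) ->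
  forall e, 0 < e -> exists K, forall n, (K <= n)%nat -> bsum f n - bsum f K <= e.
Proof.
  intros Hf HB e He.
  destruct (completeness (fun y => exists n, y = bsum f n)) as [s [Hub Hlub]].
  { exists B; intros y [n ->]; auto. }
  { exists 0, 0%nat; reflexivity. }
  assert (exists K, s - e < bsum f K) as [K HK].
  { apply NNPP; intros Hn. enough (s <= s - e) by lra.
    apply Hlub; intros y [n ->]. apply Rnot_lt_le; intros Hlt; apply Hn; eauto. }
  exists K; intros n Hn. assert (bsum f n <= s) by (apply Hub; eauto). lra.
Qed.

Lemma ln_le_Rpower u s : 0 < u -> 0 < s -> ln u <= Rpower u s / s.
Proof.
  intros Hu Hs; apply div_ge; auto. rewrite Rmult_comm, <- ln_Rpower.
  pose proof (ln_le_sub (Rpower u s) (Rpower_pos u s)); lra.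
Qed.

Section Irrational.
Variables (alpha beta eta : R).
Hypothesis Halpha : 0 < alpha < 1.
Hypothesis Hirr : forall k, 0 < orb beta k < 1 /\ orb beta k <> 1/2.
Hypothesis Heta : 0 < eta.
(** The exponents split [2 - alpha = sigma + theta]. The power [sigma] feeds the summable series;
    [theta] outweighs the power [alpha] of the denominators by the spare [eta], and [theta < 1]
    makes [x * x^-theta] a cone function. *)
Let theta := alpha + eta.
Hypothesis Htheta : theta < 1.
Let sigma := 2 - 2 * alpha - eta.

Let b := orb beta.
Let C := denC beta.
Let D := denD beta.
Let S_ := denS beta.

Let den_bounds k x : 0 <= x <= 1 -> 1 <= D k /\ D k <= C k * x + D k /\
  S_ k * x <= C k * x + D k <= S_ k.
Proof.
  intros Hx; unfold S_, denS. fold (C k) (D k).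
  assert (0 <= C k) by apply denC_pos. assert (1 <= D k) by apply denD_ge1. repeat split; nra.
Qed.

(** Let [phi] be the inverse branch. Then [|phi' x| = (C x + D)^-2] and [phi x - phi y = ± (x - y) /
    ((C x + D) (C y + D))], so for [x <> b k] this is [|phi' x| |phi x - beta|^-alpha], the part of
    the iterate that stays on the branch through [beta]. *)
Definition Bsing (k : nat) (x : R) : R :=
  Rpower (C k * x + D k) (alpha - 2) * Rpower (C k * b k + D k) alpha * sing alpha (x - b k).

Let Bsing_pos k x : 0 <= Bsing k x.
Proof.
  unfold Bsing; repeat apply Rmult_le_pos; try (left; apply Rpower_pos). apply sing_pos.
Qed.

Let br k := if Rle_dec (b k) (1/2) then f10 else f11.
Let cobr k := if Rle_dec (b k) (1/2) then f11 else f10.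

Let br_cases k : br k = f10 \/ br k = f11.
Proof. unfold br; destruct (Rle_dec _ _); auto. Qed.

Let br_next k : b k = br k (b (S k)).
Proof.
  unfold br. change (b (S k)) with (T1 (b k)).
  destruct (Hirr k) as [Hk _]. fold (b k) in Hk.
  pose proof (T1_inv (b k) ltac:(lra)) as E. destruct (Rle_dec _ _); exact E.
Qed.

Let Pr_br f k x : Pr f x = / (1 + x) ^ 2 * f (br k x) + / (1 + x) ^ 2 * f (cobr k x).
Proof. unfold Pr, br, cobr; destruct (Rle_dec _ _); ring. Qed.

Let den_br k x : 0 <= x -> C k * br k x + D k = (C (S k) * x + D (S k)) / (1 + x).
Proof.
  intros Hx; unfold C, D, br. destruct (den_step beta k) as [H0 H1].
  fold (b k) in H0, H1.
  destruct (Rle_dec (b k) (1/2)) as [H|H].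
  - destruct (H0 H) as [-> ->]; unfold f10; field; lra.
  - destruct (H1 H) as [-> ->]; unfold f11; field; lra.
Qed.

Let Bsing_step k x : 0 <= x <= 1 -> / (1 + x) ^ 2 * Bsing k (br k x) = Bsing (S k) x.
Proof.
  intros Hx; unfold Bsing. set (y := b (S k)).
  assert (Hy : 0 < y < 1) by apply Hirr.
  rewrite (br_next k). fold y. rewrite !den_br by lra.
  rewrite (sing_branch alpha x y) by (auto; lra).
  destruct (den_bounds (S k) x Hx) as (B1 & B2 & _).
  destruct (den_bounds (S k) y ltac:(lra)) as (_ & B3 & _).
  rewrite !Rpower_div_base by lra. rewrite <- Rpower_mult_distr by lra.
  replace (/ (1 + x) ^ 2) with (Rpower (1 + x) (- (2))).
  2:{ rewrite Rpower_Ropp; f_equal. replace 2 with (INR 2) by (simpl; ring). apply Rpower_pow; lra. }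
  assert (E1 : Rpower (1 + x) (- (2)) * Rpower (1 + x) (- (alpha - 2)) * Rpower (1 + x) alpha = 1).
  { rewrite <- !Rpower_plus. replace (- (2) + - (alpha - 2) + alpha) with 0 by ring. apply Rpower_O; lra. }
  assert (E2 : Rpower (1 + y) (- alpha) * Rpower (1 + y) alpha = 1).
  { rewrite <- Rpower_plus, Rplus_opp_l. apply Rpower_O; lra. }
  set (u := Rpower (1 + x) (- (2))) in *. set (u' := Rpower (1 + x) (- (alpha - 2))) in *.
  set (u'' := Rpower (1 + x) alpha) in *. set (w := Rpower (1 + y) (- alpha)) in *.
  set (w' := Rpower (1 + y) alpha) in *.
  set (X := Rpower (C (S k) * x + D (S k)) (alpha - 2)). set (Y := Rpower (C (S k) * y + D (S k)) alpha).
  transitivity (X * Y * sing alpha (x - y) * (u * u' * u'') * (w * w')); [ring|].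
  rewrite E1, E2; ring.
Qed.

Let cobr_sub k x : 0 <= x <= 1 ->
  Rabs (cobr k x - b k) = (1 - x * b (S k)) / ((1 + x) * (1 + b (S k))).
Proof.
  intros Hx. set (y := b (S k)). assert (Hy : 0 < y < 1) by apply Hirr.
  rewrite (br_next k); fold y.
  assert (0 <= (1 - x * y) / ((1 + x) * (1 + y))) by (apply Rdiv_le_0_compat; nra).
  unfold br, cobr; destruct (Rle_dec _ _).
  - rewrite f11_f10_sub by lra. now rewrite Rabs_pos_eq.
  - rewrite Rabs_minus_sym, f11_f10_sub by lra. rewrite (Rmult_comm y x), (Rmult_comm (1 + y)). now rewrite Rabs_pos_eq.
Qed.

Let cobr_far k x m : 0 <= x <= 1 -> m <= 1 - x * b (S k) -> m / 4 <= Rabs (cobr k x - b k).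
Proof.
  intros Hx Hm; rewrite cobr_sub by auto. assert (Hy : 0 < b (S k) < 1) by apply Hirr.
  apply Rle_trans with ((1 - x * b (S k)) / 4); [lra|].
  assert (0 <= 1 - x * b (S k)) by nra.
  apply Rmult_le_compat_l; auto. apply Rinv_le_contravar; nra.
Qed.

(** The singularity at 1 allows for [b k] close to 1/2, the value of the opposite branch at 1; the
    one at 0 allows for small denominators near 0. *)
Definition thfun (y : R) : R := Rpower (y * (1 - y)) (- theta).

Let J k := Rpower (denM beta k) (- sigma) * Rpower (S_ k) (- eta).

Let pow4 : Rpower (1/4) (- alpha) <= 4.
Proof.
  replace (1/4) with (/4) by lra. unfold Rpower; rewrite ln_Rinv by lra.
  replace (- alpha * - ln 4) with (alpha * ln 4) by ring. fold (Rpower 4 alpha).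
  rewrite <- (Rpower_1 4) at 2 by lra. apply Rle_Rpower; lra.
Qed.

(** The opposite preimage keeps distance at least [(1 - y) / 4] from [b k], which gives the power of
    [1 - y]. If [b k > 1/2], that preimage is [f10 y], and near 0 the denominator falls from [S_]
    towards [D]. Bounding it below by [D] with exponent [sigma] and by [S_ y / 2] with exponent
    [theta] costs [y^-theta]. *)
Let psi_bound k y : 0 < y < 1 ->
  / (1 + y) ^ 2 * Bsing k (cobr k y) <= 16 * J k * thfun y.
Proof.
  intros Hy.
  assert (Hb' : 0 < b (S k) < 1) by apply Hirr.
  assert (Hb : 0 < b k < 1) by apply Hirr.
  assert (Hs : sing alpha (cobr k y - b k) <= 4 * Rpower (1 - y) (- theta)).
  { assert (Hf := cobr_far k y (1 - y) ltac:(lra) ltac:(nra)).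
    eapply Rle_trans; [apply (sing_le alpha _ ((1 - y) * (1/4))); lra|].
    rewrite <- Rpower_mult_distr by lra.
    assert (Rpower (1 - y) (- alpha) <= Rpower (1 - y) (- theta)).
    { apply Rpower_le_1_anti; [lra | unfold theta; lra]. }
    pose proof (Rpower_pos (1 - y) (- alpha)); pose proof (Rpower_pos (1/4) (- alpha)). nra. }
  destruct (den_bounds k (b k) ltac:(lra)) as (B1 & B2 & B3 & B4).
  assert (HS1 : 1 <= S_ k) by lra.
  assert (Hbk : Rpower (C k * b k + D k) alpha <= Rpower (S_ k) alpha).
  { apply Rle_Rpower_l; lra. }
  assert (Hz : Rpower (C k * cobr k y + D k) (alpha - 2) * Rpower (S_ k) alpha <=
     4 * J k * Rpower y (- theta)).
  { assert (Hy1 : 1 <= Rpower y (- theta)).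
    { rewrite <- (Rpower_one_base (- theta)). apply Rpower_anti; unfold theta; lra. }
    unfold J, denM, cobr. fold (b k) (S_ k) (D k). destruct (Rle_dec (b k) (1/2)) as [Hl|Hl].
    - assert (Hr := f11_range y ltac:(lra)).
      destruct (den_bounds k (f11 y) ltac:(lra)) as (_ & _ & G1 & _).
      assert (A : Rpower (C k * f11 y + D k) (alpha - 2) <= 4 * Rpower (S_ k) (alpha - 2)).
      { replace (alpha - 2) with (- (2 - alpha)) by ring.
        eapply Rle_trans; [apply (Rpower_anti (S_ k * / 2)); nra|].
        rewrite <- Rpower_mult_distr by lra. rewrite Rmult_comm.
        apply Rmult_le_compat_r; [left; apply Rpower_pos|].
        unfold Rpower; rewrite ln_Rinv by lra.
        replace (- (2 - alpha) * - ln 2) with ((2 - alpha) * ln 2) by ring.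
        change (Rpower 2 (2 - alpha) <= 4).
        replace 4 with (Rpower 2 2). { apply Rle_Rpower; lra. }
        replace 2 with (INR 2) at 2 by (simpl; ring). rewrite Rpower_pow; lra. }
      assert (E : Rpower (S_ k) (alpha - 2) * Rpower (S_ k) alpha =
                  Rpower (S_ k) (- sigma) * Rpower (S_ k) (- eta)).
      { rewrite <- !Rpower_plus; f_equal; unfold sigma; ring. }
      rewrite Rmult_assoc, <- E.
      pose proof (Rpower_pos (S_ k) alpha). pose proof (Rpower_pos (S_ k) (alpha - 2)).
      apply Rle_trans with (4 * Rpower (S_ k) (alpha - 2) * Rpower (S_ k) alpha).
      { apply Rmult_le_compat_r; lra. }
      assert (0 < Rpower (S_ k) (alpha - 2) * Rpower (S_ k) alpha) by nra. nra.
    - assert (Hr := f10_range y ltac:(lra)).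
      assert (Hfy : y / 2 <= f10 y).
      { unfold f10; apply Rmult_le_compat_l; [lra|]. apply Rinv_le_contravar; lra. }
      destruct (den_bounds k (f10 y) ltac:(lra)) as (G0 & G1 & G2 & _).
      set (z := C k * f10 y + D k) in *.
      replace (alpha - 2) with (- sigma + - theta) by (unfold sigma, theta; ring).
      rewrite Rpower_plus.
      assert (A1 : Rpower z (- sigma) <= Rpower (D k) (- sigma)).
      { apply Rpower_anti; [lra | unfold sigma, theta in *; lra]. }
      assert (A2 : Rpower z (- theta) <= 4 * (Rpower (S_ k) (- theta) * Rpower y (- theta))).
      { eapply Rle_trans; [apply (Rpower_anti (S_ k * y * /2)); [|unfold theta; lra]|].
        - split; [|nra]. repeat apply Rmult_lt_0_compat; lra.
        - rewrite <- !Rpower_mult_distr by (try lra; nra). rewrite Rmult_comm.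
          apply Rmult_le_compat_r.
          { left; apply Rmult_lt_0_compat; apply Rpower_pos. }
          unfold Rpower; rewrite ln_Rinv by lra.
          replace (- theta * - ln 2) with (theta * ln 2) by ring. change (Rpower 2 theta <= 4).
          apply Rle_trans with (Rpower 2 1); [apply Rle_Rpower; lra | rewrite Rpower_1; lra]. }
      assert (E : Rpower (S_ k) (- theta) * Rpower (S_ k) alpha = Rpower (S_ k) (- eta)).
      { rewrite <- Rpower_plus; f_equal; unfold theta; ring. }
      rewrite <- E.
      pose proof (Rpower_pos (S_ k) alpha). pose proof (Rpower_pos z (- sigma)).
      pose proof (Rpower_pos z (- theta)).
      apply Rle_trans with (Rpower (D k) (- sigma) * (4 * (Rpower (S_ k) (- theta) * Rpower y (- theta))) * Rpower (S_ k) alpha).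
      { apply Rmult_le_compat_r; [lra|]. apply Rmult_le_compat; lra. }
      right; ring. }
  unfold thfun. rewrite <- Rpower_mult_distr by lra.
  assert (Hi := inv_sq_le1 y ltac:(lra)). assert (Hi0 := inv_sq_pos y ltac:(lra)).
  pose proof (Bsing_pos k (cobr k y)).
  apply Rle_trans with (1 * Bsing k (cobr k y)); [apply Rmult_le_compat_r; lra|].
  rewrite Rmult_1_l; unfold Bsing.
  pose proof (Rpower_pos (C k * cobr k y + D k) (alpha - 2)). pose proof (sing_pos alpha (cobr k y - b k)).
  pose proof (Rpower_pos (C k * b k + D k) alpha). pose proof (Rpower_pos (1 - y) (- theta)).
  apply Rle_trans with ((4 * J k * Rpower y (- theta)) * (4 * Rpower (1 - y) (- theta))); [|right; ring].
  apply Rmult_le_compat; auto; [apply Rmult_le_pos; lra|].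
  eapply Rle_trans; [|exact Hz]. apply Rmult_le_compat_l; lra.
Qed.

(** As [f11 x = 1 - f10 x], both terms contain [x / (1 + x)^2]: one more step removes the
    singularity at 1. The power [(1 + x)^(2 theta)] is absorbed by the Jacobian since
    [theta < 1]. *)
Let Pr_thfun x : 0 < x <= 1 -> Pr thfun x <= 2 * Rpower x (- theta).
Proof.
  intros Hx; unfold Pr, thfun.
  replace (f10 x * (1 - f10 x)) with (x / (1 + x) ^ 2) by (unfold f10; field; lra).
  replace (f11 x * (1 - f11 x)) with (x / (1 + x) ^ 2) by (unfold f11; field; lra).
  assert (H2 : 0 < (1 + x) ^ 2) by nra.
  rewrite Rpower_div_base by lra. rewrite Ropp_involutive.
  assert (Rpower ((1 + x) ^ 2) theta <= (1 + x) ^ 2).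
  { rewrite <- (Rpower_1 ((1 + x) ^ 2)) at 2 by lra. apply Rle_Rpower; [nra | lra]. }
  pose proof (Rpower_pos x (- theta)).
  replace (/ (1 + x) ^ 2 * (Rpower x (- theta) * Rpower ((1 + x) ^ 2) theta + Rpower x (- theta) * Rpower ((1 + x) ^ 2) theta))
    with (2 * Rpower x (- theta) * (Rpower ((1 + x) ^ 2) theta) / (1 + x) ^ 2) by (field; lra).
  apply div_le; auto. apply Rmult_le_compat_l; lra.
Qed.

(* The logarithm is absorbed either by the decay of the iterates (m large) or by the
   spare factor [denS ^ -eta] (k large). *)
Let log_absorb : exists K0, 0 < K0 /\ forall m k x, 0 < x <= 1 ->
  Rpower (INR k + 1) (- eta) *
    (ln (INR (m + k + 2)) * (x * Prn m (fun y => Rpower y (- theta)) x)) <= K0.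
Proof.
  assert (Hs : 0 < 1 - theta <= 1) by (unfold theta in *; lra).
  exists (2 / (1 - theta) + 2 + / eta).
  assert (I1 : 0 < 2 / (1 - theta)) by (apply Rdiv_lt_0_compat; lra).
  assert (I2 : 0 < / eta) by (now apply Rinv_0_lt_compat).
  split; [lra|]. intros m k x Hx.
  assert (Hln1 : 0 <= ln 2 <= 1).
  { split; [rewrite <- ln_1; apply ln_le; lra|]. pose proof (ln_le_sub 2); lra. }
  rewrite <- (Qn_Prn m _ (pw (1 - theta))); auto.
  2:{ intros y Hy; rewrite pw_pos by lra. rewrite <- (Rpower_1 y) at 2 by lra.
      rewrite <- Rpower_plus; reflexivity. }
  destruct (Qn_pw_bound (1 - theta) m x Hs Hx) as [H1 H2].
  assert (H0 : 0 <= Qn m (pw (1 - theta)) x) by (apply cone_pos; [apply cone_Qn, cone_pw; auto | lra]).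
  set (q := Qn m (pw (1 - theta)) x) in *.
  pose proof (pos_INR m) as Hm; pose proof (pos_INR k) as Hk.
  assert (Hr1 : Rpower (INR k + 1) (- eta) <= 1).
  { apply Rle_trans with (Rpower 1 (- eta)); [apply Rpower_anti; lra | rewrite Rpower_one_base; lra]. }
  pose proof (Rpower_pos (INR k + 1) (- eta)) as Hr0.
  replace (INR (m + k + 2)) with ((INR m + 1) + (INR k + 1)) by (rewrite !plus_INR; simpl; ring).
  assert (Hn0 : 0 <= ln (INR m + 1 + (INR k + 1))) by (rewrite <- ln_1; apply ln_le; lra).
  destruct (le_lt_dec k m) as [Hkm|Hkm].
  - apply le_INR in Hkm.
    apply Rle_trans with (ln (INR m + 1 + (INR k + 1)) * q).
    { rewrite <- (Rmult_1_l (ln _ * q)) at 2. apply Rmult_le_compat_r; auto. now apply Rmult_le_pos. }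
    assert (ln (INR m + 1 + (INR k + 1)) <= ln 2 + ln (1 + INR m)).
    { rewrite <- ln_mult by lra. apply ln_le; lra. }
    apply Rle_trans with ((ln 2 + ln (1 + INR m)) * q); [now apply Rmult_le_compat_r|].
    replace (2 / (1 - theta)) with (/ (1 - theta) + / (1 - theta)) in * by (field; lra). nra.
  - apply lt_INR in Hkm.
    assert (Hl : ln (INR m + 1 + (INR k + 1)) <= 1 + ln (INR k + 1)).
    { apply Rle_trans with (ln 2 + ln (INR k + 1)); [|lra]. rewrite <- ln_mult by lra. apply ln_le; lra. }
    assert (Hl2 := ln_le_Rpower (INR k + 1) eta ltac:(lra) Heta).
    apply Rle_trans with (Rpower (INR k + 1) (- eta) * (1 + Rpower (INR k + 1) eta / eta)).
    { apply Rmult_le_compat_l; [lra|]. nra. }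
    assert (E : Rpower (INR k + 1) (- eta) * Rpower (INR k + 1) eta = 1).
    { rewrite <- Rpower_plus, Rplus_opp_l, Rpower_O; lra. }
    replace (Rpower (INR k + 1) (- eta) * (1 + Rpower (INR k + 1) eta / eta)) with
      (Rpower (INR k + 1) (- eta) + (Rpower (INR k + 1) (- eta) * Rpower (INR k + 1) eta) * / eta) by (field; lra).
    rewrite E. lra.
Qed.

Let Mk k := Rpower (denM beta k) (- sigma).

(** On the branch through [beta] a step yields the next [Bsing] exactly; the other branch, after one
    further step, is at most [32 J k y^-theta]. That further step is why the last [Pr] remains
    unexpanded here. *)
Let Prn_Bsing : exists K1, 0 < K1 /\ forall j k x, 0 < x <= 1 ->
  ln (INR (k + j + 1)) * (x * Prn (S j) (Bsing k) x) <=
  ln (INR (k + j + 1)) * (x * Pr (Bsing (k + j)) x) + K1 * (bsum Mk (k + j) - bsum Mk k).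
Proof.
  destruct log_absorb as (K0 & HK0 & HL).
  exists (32 * K0); split; [lra|].
  (* [k] rises as [j] falls, so [k + j + 1] and hence the logarithm stay the same throughout. *)
  induction j as [|j IH]; intros k x Hx.
  - rewrite Nat.add_0_r. change (Prn 1 (Bsing k) x) with (Pr (Bsing k) x). lra.
  - specialize (IH (S k) x Hx).
    replace (S k + j)%nat with (k + S j)%nat in IH by lia.
    set (n := (k + S j + 1)%nat) in *.
    assert (Hn0 : 0 <= ln (INR n)).
    { rewrite <- ln_1; apply ln_le; [lra|]. apply (le_INR 1); unfold n; lia. }
    assert (Hsplit : Prn (S (S j)) (Bsing k) x <=
       Prn (S j) (Bsing (S k)) x + 32 * J k * Prn j (fun y => Rpower y (- theta)) x).
    { replace (S (S j)) with (S j + 1)%nat by lia. rewrite Prn_add.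
      apply Rle_trans with (Prn (S j) (fun y => Bsing (S k) y + / (1 + y) ^ 2 * Bsing k (cobr k y)) x).
      { apply Prn_le; auto. intros y Hy. change (Prn 1 (Bsing k) y) with (Pr (Bsing k) y).
        rewrite (Pr_br (Bsing k) k y), Bsing_step by lra. lra. }
      rewrite Prn_plus. apply Rplus_le_compat_l.
      replace (S j) with (j + 1)%nat by lia. rewrite Prn_add, <- Prn_scal.
      apply Prn_le; auto. intros y Hy.
      assert (HJ : 0 < J k) by (unfold J; apply Rmult_lt_0_compat; apply Rpower_pos).
      apply Rle_trans with (16 * J k * Pr thfun y).
      2:{ pose proof (Pr_thfun y Hy). nra. }
      change (Prn 1 ?f y) with (Pr f y). unfold Pr.
      pose proof (f10_range y Hy); pose proof (f11_range y Hy).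
      assert (G0 := psi_bound k (f10 y) ltac:(lra)). assert (G1 := psi_bound k (f11 y) ltac:(lra)).
      assert (Hi0 := inv_sq_pos y ltac:(lra)).
      apply Rle_trans with (/ (1 + y) ^ 2 * (16 * J k * thfun (f10 y) + 16 * J k * thfun (f11 y))); [|right; ring].
      apply Rmult_le_compat_l; lra. }
    specialize (HL j k x Hx). replace (j + k + 2)%nat with n in HL by (unfold n; lia).
    set (p := Prn j (fun y => Rpower y (- theta)) x) in *.
    assert (Hp : 0 <= p) by (apply Prn_nonneg; auto; intros; left; apply Rpower_pos).
    assert (HS : Rpower (S_ k) (- eta) <= Rpower (INR k + 1) (- eta)).
    { apply Rpower_anti; [|lra]. split; [pose proof (pos_INR k); lra | apply denS_ge]. }
    assert (HM := Rpower_pos (denM beta k) (- sigma)). fold (Mk k) in HM.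
    assert (Hlp : 0 <= ln (INR n) * (x * p)) by (repeat apply Rmult_le_pos; lra).
    assert (HJ : J k * (ln (INR n) * (x * p)) <= Mk k * K0).
    { unfold J; fold (Mk k). rewrite Rmult_assoc. apply Rmult_le_compat_l; [lra|].
      eapply Rle_trans; [|exact HL]. apply Rmult_le_compat_r; auto. }
    assert (Hm : ln (INR n) * (x * Prn (S (S j)) (Bsing k) x) <=
       ln (INR n) * (x * (Prn (S j) (Bsing (S k)) x + 32 * J k * p))).
    { apply Rmult_le_compat_l; auto. apply Rmult_le_compat_l; lra. }
    simpl (bsum Mk (S k)) in IH. lra.
Qed.

(** The remainders of the first [k] steps are not small, but a narrow window produces none: it stays
    on the branch through [beta]. The series of remainders may therefore start at a large index. *)
Let localize k : forall e, 0 < e -> exists delta, 0 < delta /\ forall x, 0 < x <= 1 ->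
  Prn k (wsing alpha beta delta) x <= if Rlt_dec (Rabs (x - b k)) e then Bsing k x else 0.
Proof.
  induction k as [|k IH]; intros e He.
  - exists e; split; auto. intros x Hx. change (Prn 0 ?f x) with (f x).
    unfold wsing, Bsing, b, orb; simpl. destruct (Rlt_dec _ _); [|lra].
    unfold C, D, denC, denD; simpl. rewrite !Rmult_0_l, !Rplus_0_l, !Rpower_one_base; lra.
  - destruct (Hirr k) as [Hb Hne]; fold (b k) in Hb, Hne.
    (* [e / 4] allows for the expansion by at most 4 in one step; the distance to 1/2 keeps the
       opposite preimage outside the window. *)
    set (e1 := Rmin (e / 4) (Rabs (b k - 1/2))).
    assert (He1 : 0 < e1) by (apply Rmin_glb_lt; [lra | apply Rabs_pos_lt; lra]).
    destruct (IH e1 He1) as (delta & Hd & H). exists delta; split; auto.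
    intros x Hx. change (Prn (S k) ?f x) with (Pr (Prn k f) x). rewrite (Pr_br _ k).
    pose proof (f10_range x Hx) as R0; pose proof (f11_range x Hx) as R1.
    assert (Hy : 0 < b (S k) < 1) by apply Hirr.
    assert (Hi0 := inv_sq_pos x ltac:(lra)).
    assert (Hc : Prn k (wsing alpha beta delta) (cobr k x) <= 0).
    { eapply Rle_trans; [apply H; unfold cobr; destruct (Rle_dec _ _); lra|].
      destruct (Rlt_dec _ _) as [Hlt|]; [exfalso | lra].
      assert (Rabs (cobr k x - b k) < Rabs (b k - 1/2)).
      { eapply Rlt_le_trans; [exact Hlt | apply Rmin_r]. }
      unfold cobr in H0; destruct (Rle_dec _ _).
      - rewrite (Rabs_minus_sym (b k)) in H0. rewrite !Rabs_pos_eq in H0 by lra. lra.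
      - rewrite (Rabs_minus_sym (f10 x)) in H0. rewrite !Rabs_pos_eq in H0 by lra. lra. }
    assert (Hbr : / (1 + x) ^ 2 * Prn k (wsing alpha beta delta) (br k x) <=
       if Rlt_dec (Rabs (x - b (S k))) e then Bsing (S k) x else 0).
    { assert (Hr : 0 < br k x <= 1) by (unfold br; destruct (Rle_dec _ _); lra).
      specialize (H (br k x) Hr). rewrite <- (Bsing_step k x) by lra.
      pose proof (Bsing_pos k (br k x)).
      destruct (Rlt_dec (Rabs (br k x - b k)) e1) as [Hlt|Hlt].
      - assert (Rabs (x - b (S k)) < e).
        { rewrite (br_next k) in Hlt.
          destruct (branch_dist x (b (S k)) (br k) (br_cases k)) as [_ Hbd]; [lra | lra |].
          pose proof (Rmin_l (e / 4) (Rabs (b k - 1/2))). fold e1 in H1. lra. }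
        destruct (Rlt_dec _ _); [|lra]. apply Rmult_le_compat_l; lra.
      - apply Rle_trans with 0; [nra|].
        destruct (Rlt_dec _ _); [|lra]. apply Rmult_le_pos; lra. }
    nra.
Qed.

(* The value at the orbit point itself only has to exceed every admissible threshold. *)
Definition irr_err (n : nat) (x : R) : R :=
  if Req_dec_T x (orb beta n) then 1
  else ln (INR n) * (Rpower (denS beta n) (2 * alpha - 2) * Rpower (Rabs (x - orb beta n)) (- alpha)).

(** At preimages of [x >= a] the denominators are comparable to [S_], so [Bsing] is of order
    [S_^(2 alpha - 2)] times the power of the distance. The opposite preimage is covered too,
    because [1 - x b >= |x - b|]. *)
Let Pr_Bsing_bound a n x : 0 < a -> a <= x <= 1 -> x <> b (S n) ->
  Pr (Bsing n) x <= 64 * Rpower (a / 2) (alpha - 2) *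
     (Rpower (S_ (S n)) (2 * alpha - 2) * Rpower (Rabs (x - b (S n))) (- alpha)).
Proof.
  intros Ha Hx Hne.
  assert (Hb : 0 < b n < 1) by apply Hirr. assert (Hb' : 0 < b (S n) < 1) by apply Hirr.
  assert (HS : S_ (S n) <= 2 * S_ n).
  { unfold S_; rewrite denS_step. pose proof (denD_le_S beta n); lra. }
  assert (HS1 : 1 <= S_ n) by (pose proof (denS_ge beta n); pose proof (pos_INR n); unfold S_; lra).
  assert (HS2 : 1 <= S_ (S n)) by (pose proof (denS_ge beta (S n)); pose proof (pos_INR (S n)); unfold S_; lra).
  set (d := Rabs (x - b (S n))). assert (Hd : 0 < d) by (apply Rabs_pos_lt; lra).
  assert (Hz : forall z, a / 2 <= z <= 1 -> d / 4 <= Rabs (z - b n) ->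
     Bsing n z <= 32 * (Rpower (a / 2) (alpha - 2) * (Rpower (S_ (S n)) (2 * alpha - 2) * Rpower d (- alpha)))).
  { intros z Hz Hzd. destruct (den_bounds n z ltac:(lra)) as (B1 & B2 & B3 & B4).
    destruct (den_bounds n (b n) ltac:(lra)) as (_ & B2' & _ & B4').
    assert (E1 : Rpower (C n * z + D n) (alpha - 2) <= Rpower (a / 2) (alpha - 2) * Rpower (S_ n) (alpha - 2)).
    { rewrite Rpower_mult_distr by lra. replace (alpha - 2) with (- (2 - alpha)) by ring.
      apply Rpower_anti; [|lra]. split; [apply Rmult_lt_0_compat; lra | nra]. }
    assert (E2 : Rpower (C n * b n + D n) alpha <= Rpower (S_ n) alpha) by (apply Rle_Rpower_l; lra).
    assert (E3 : sing alpha (z - b n) <= 4 * Rpower d (- alpha)).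
    { eapply Rle_trans; [apply (sing_le alpha _ (d * (1/4))); lra|].
      rewrite <- Rpower_mult_distr by lra. pose proof (Rpower_pos d (- alpha)). nra. }
    assert (E4 : Rpower (S_ n) (alpha - 2) * Rpower (S_ n) alpha <= 4 * Rpower (S_ (S n)) (2 * alpha - 2)).
    { rewrite <- Rpower_plus. replace (alpha - 2 + alpha) with (- (2 - 2 * alpha)) by ring.
      replace (2 * alpha - 2) with (- (2 - 2 * alpha)) by ring.
      eapply Rle_trans; [apply (Rpower_anti (S_ (S n) * /2)); lra|].
      rewrite <- Rpower_mult_distr by lra. rewrite Rmult_comm.
      apply Rmult_le_compat_r; [left; apply Rpower_pos|].
      unfold Rpower; rewrite ln_Rinv by lra.
      replace (- (2 - 2 * alpha) * - ln 2) with ((2 - 2 * alpha) * ln 2) by ring.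
      change (Rpower 2 (2 - 2 * alpha) <= 4).
      replace 4 with (Rpower 2 2). { apply Rle_Rpower; lra. }
      replace 2 with (INR 2) at 2 by (simpl; ring). rewrite Rpower_pow; lra. }
    unfold Bsing. pose proof (sing_pos alpha (z - b n)).
    pose proof (Rpower_pos (C n * z + D n) (alpha - 2)). pose proof (Rpower_pos (C n * b n + D n) alpha).
    pose proof (Rpower_pos (a / 2) (alpha - 2)). pose proof (Rpower_pos (S_ n) alpha).
    pose proof (Rpower_pos (S_ n) (alpha - 2)). pose proof (Rpower_pos d (- alpha)).
    pose proof (Rpower_pos (S_ (S n)) (2 * alpha - 2)).
    apply Rle_trans with (Rpower (a / 2) (alpha - 2) * Rpower (S_ n) (alpha - 2) * Rpower (S_ n) alpha * (4 * Rpower d (- alpha))).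
    { apply Rmult_le_compat; auto; [nra|]. apply Rmult_le_compat; lra. }
    replace (Rpower (a / 2) (alpha - 2) * Rpower (S_ n) (alpha - 2) * Rpower (S_ n) alpha * (4 * Rpower d (- alpha)))
      with (4 * (Rpower (a / 2) (alpha - 2) * Rpower d (- alpha)) * (Rpower (S_ n) (alpha - 2) * Rpower (S_ n) alpha)) by ring.
    apply Rle_trans with (4 * (Rpower (a / 2) (alpha - 2) * Rpower d (- alpha)) * (4 * Rpower (S_ (S n)) (2 * alpha - 2))).
    { apply Rmult_le_compat_l; auto. nra. }
    assert (0 < Rpower (a / 2) (alpha - 2) * Rpower d (- alpha) * Rpower (S_ (S n)) (2 * alpha - 2))
      by (repeat apply Rmult_lt_0_compat; auto).
    nra. }
  assert (Hbr2 : forall z, z = f10 x \/ z = f11 x -> a / 2 <= z <= 1).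
  { pose proof (f10_range x ltac:(lra)); pose proof (f11_range x ltac:(lra)).
    intros z [->| ->]; [|lra]. split; [|lra].
    apply Rle_trans with (x / 2); [lra|].
    unfold f10; apply Rmult_le_compat_l; [lra|]. apply Rinv_le_contravar; lra. }
  rewrite (Pr_br _ n).
  assert (G0 : Bsing n (br n x) <= 32 * (Rpower (a / 2) (alpha - 2) * (Rpower (S_ (S n)) (2 * alpha - 2) * Rpower d (- alpha)))).
  { apply Hz; [apply Hbr2; unfold br; destruct (Rle_dec _ _); auto|].
    rewrite (br_next n). destruct (branch_dist x (b (S n)) (br n) (br_cases n)) as [_ Hbd]; [lra | lra |].
    fold d in Hbd; lra. }
  assert (G1 : Bsing n (cobr n x) <= 32 * (Rpower (a / 2) (alpha - 2) * (Rpower (S_ (S n)) (2 * alpha - 2) * Rpower d (- alpha)))).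
  { apply Hz; [apply Hbr2; unfold cobr; destruct (Rle_dec _ _); auto|].
    apply cobr_far; [lra|]. unfold d.
    apply Rabs_le_between; nra. }
  assert (Hi := inv_sq_le1 x ltac:(lra)). assert (Hi0 := inv_sq_pos x ltac:(lra)).
  pose proof (Bsing_pos n (br n x)). pose proof (Bsing_pos n (cobr n x)). nra.
Qed.

Theorem irrational_Sing_ok : (exists B, forall n, bsum Mk n <= B) -> Sing_ok alpha beta irr_err.
Proof.
  intros [B HB] a eps Ha He.
  destruct Prn_Bsing as (K1 & HK1 & HP).
  destruct (bsum_tail Mk B ltac:(intros; left; apply Rpower_pos) HB (eps * a / 2 / K1)) as [K HK].
  { apply Rdiv_lt_0_compat; nra. }
  destruct (localize K 1 ltac:(lra)) as (delta & Hd & Hloc).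
  set (ca := 64 * Rpower (a / 2) (alpha - 2)).
  assert (Hca : 0 < ca) by (unfold ca; pose proof (Rpower_pos (a / 2) (alpha - 2)); lra).
  (* The bound 1/2 excludes orbit points, where the error is 1; [eps / 2 / ca] controls the last
     unexpanded step. *)
  exists delta, (K + 1)%nat, (Rmin (1/2) (eps / 2 / ca)); split; [auto|split].
  { apply Rmin_glb_lt; [lra|]. apply Rdiv_lt_0_compat; lra. }
  intros n Hn x Hx Herr.
  pose proof (Rmin_l (1/2) (eps / 2 / ca)); pose proof (Rmin_r (1/2) (eps / 2 / ca)).
  unfold irr_err in Herr; destruct (Req_dec_T x (orb beta n)) as [E|E]; [lra|].
  set (j := (n - K - 1)%nat). specialize (HP j K x ltac:(lra)).
  replace (K + j + 1)%nat with n in HP by (unfold j; lia).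
  assert (Hloc' : Prn n (wsing alpha beta delta) x <= Prn (S j) (Bsing K) x).
  { replace n with (S j + K)%nat by (unfold j; lia). rewrite Prn_add. apply Prn_le; [|lra].
    intros y Hy; eapply Rle_trans; [apply Hloc; auto|].
    destruct (Rlt_dec _ _); [lra | apply Bsing_pos]. }
  assert (En : n = S (K + j)) by (unfold j; lia).
  assert (HPB := Pr_Bsing_bound a (K + j) x Ha Hx).
  rewrite <- En in HPB. specialize (HPB E). fold ca in HPB.
  assert (Hln : 0 <= ln (INR n)) by (rewrite <- ln_1; apply ln_le; [lra | apply (le_INR 1); lia]).
  specialize (HK (K + j)%nat ltac:(lia)).
  assert (HK' : K1 * (bsum Mk (K + j) - bsum Mk K) <= eps * a / 2).
  { apply Rle_trans with (K1 * (eps * a / 2 / K1)); [apply Rmult_le_compat_l; lra | right; field; lra]. }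
  set (er := ln (INR n) * (Rpower (denS beta n) (2 * alpha - 2) * Rpower (Rabs (x - orb beta n)) (- alpha))) in *.
  assert (H1 : ln (INR n) * (x * Pr (Bsing (K + j)) x) <= x * (eps / 2)).
  { apply Rle_trans with (x * (ca * er)).
    - unfold er.
      replace (x * (ca * (ln (INR n) * (Rpower (denS beta n) (2 * alpha - 2) * Rpower (Rabs (x - orb beta n)) (- alpha)))))
        with (ln (INR n) * (x * (ca * (Rpower (denS beta n) (2 * alpha - 2) * Rpower (Rabs (x - orb beta n)) (- alpha))))) by ring.
      apply Rmult_le_compat_l; auto. apply Rmult_le_compat_l; [lra | exact HPB].
    - apply Rmult_le_compat_l; [lra|].
      apply Rle_trans with (ca * (eps / 2 / ca)); [apply Rmult_le_compat_l; lra | right; field; lra]. }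
  assert (H2 : ln (INR n) * (x * Prn n (wsing alpha beta delta) x) <= x * eps).
  { apply Rle_trans with (ln (INR n) * (x * Prn (S j) (Bsing K) x)).
    - apply Rmult_le_compat_l; auto. apply Rmult_le_compat_l; lra.
    - nra. }
  apply Rmult_le_reg_l with x; [lra|]. lra.
Qed.

End Irrational.

(** * Continued fractions and the Farey orbit *)

Lemma is_rational_frac p q : IZR q <> 0 -> is_rational (IZR p / IZR q).
Proof. intros H; exists p, q; split; auto. intros ->; now apply H. Qed.

Lemma T1_rational x : 0 <= x <= 1 -> is_rational (T1 x) -> is_rational x.
Proof.
  intros Hx (p & q & Hq & E). assert (Hq' : IZR q <> 0) by (now apply not_0_IZR).
  pose proof (T1_range x Hx) as HT. rewrite (T1_inv x Hx).
  assert (Hpq : IZR (p + q) <> 0).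
  { rewrite plus_IZR. intros Hn. assert (T1 x = -1) by (rewrite E; replace (IZR p) with (- IZR q) by lra; field; auto). lra. }
  destruct (Rle_dec x (1/2)); rewrite E.
  - replace (f10 (IZR p / IZR q)) with (IZR p / IZR (p + q)); [now apply is_rational_frac|].
    rewrite plus_IZR in *. unfold f10; field; split; auto. rewrite Rplus_comm; auto.
  - replace (f11 (IZR p / IZR q)) with (IZR q / IZR (p + q)); [now apply is_rational_frac|].
    rewrite plus_IZR in *. unfold f11; field; split; auto. rewrite Rplus_comm; auto.
Qed.

Lemma orb_irrational beta k : 0 <= beta <= 1 -> ~ is_rational beta -> ~ is_rational (orb beta k).
Proof.
  intros Hb Hirr; induction k as [|k IH]; auto. intros Hr; apply IH.
  apply T1_rational; auto. now apply orb_range.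
Qed.

Lemma irrational_orbit beta : 0 <= beta <= 1 -> ~ is_rational beta ->
  forall k, 0 < orb beta k < 1 /\ orb beta k <> 1/2.
Proof.
  intros Hb Hirr k. pose proof (orb_irrational beta k Hb Hirr) as H.
  pose proof (orb_range beta k Hb) as Hr.
  assert (orb beta k <> 0) by (intros E; apply H; rewrite E; exists 0%Z, 1%Z; split; [lia | lra]).
  assert (orb beta k <> 1) by (intros E; apply H; rewrite E; exists 1%Z, 1%Z; split; [lia | lra]).
  assert (orb beta k <> 1/2) by (intros E; apply H; rewrite E; exists 1%Z, 2%Z; split; [lia | lra]).
  split; [split|]; lra.
Qed.

Lemma cfval_range l : (forall n, In n l -> (1 <= n)%nat) -> 0 <= cfval l <= 1.
Proof.
  induction l as [|a l IH]; intros H; simpl; [lra|].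
  assert (0 <= cfval l <= 1) by (apply IH; intros; apply H; now right).
  assert (1 <= INR a) by (apply (le_INR 1), H; now left).
  split; [left; apply Rinv_0_lt_compat; lra|].
  rewrite <- Rinv_1. apply Rinv_le_contravar; lra.
Qed.

Lemma cfval_seq_range a m n : (forall n, (1 <= n)%nat -> (1 <= a n)%nat) -> (1 <= m)%nat ->
  0 <= cfval (map a (seq m n)) <= 1.
Proof.
  intros Ha Hm; apply cfval_range; intros k Hk.
  apply in_map_iff in Hk; destruct Hk as (i & <- & Hi). apply in_seq in Hi; apply Ha; lia.
Qed.

(** An expansion is given through the limit of its convergents, so removing a digit is a statement
    about limits: inverting multiplies the distance to the limit by at most [(A + 1) / beta]. *)
Lemma cf_tail beta a : 0 < beta -> is_cf_expansion beta a ->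
  is_cf_expansion (/ beta - INR (a 1%nat)) (fun n => a (S n)) /\ 0 <= / beta - INR (a 1%nat) <= 1.
Proof.
  intros Hb [Ha Hl].
  assert (Ha1 : 1 <= INR (a 1%nat)) by (apply (le_INR 1), Ha; lia).
  set (A := INR (a 1%nat)) in *.
  assert (Hx : forall n, 0 <= cfval (map (fun n => a (S n)) (seq 1 n)) <= 1).
  { intros n; apply cfval_seq_range; [intros; apply Ha; lia | lia]. }
  assert (Hlim : forall eps, 0 < eps -> exists N, forall n, (N <= n)%nat ->
     Rabs (cfval (map (fun n => a (S n)) (seq 1 n)) - (/ beta - A)) < eps).
  { intros eps He. destruct (Hl (eps * beta / (A + 1))) as [N HN].
    { apply Rdiv_lt_0_compat; nra. }
    exists N; intros n Hn. specialize (HN (S n) ltac:(lia)). specialize (Hx n).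
    set (x := cfval (map (fun n => a (S n)) (seq 1 n))) in *.
    assert (Ec : cfval (map a (seq 1 (S n))) = / (A + x)).
    { simpl. unfold x. rewrite <- seq_shift, map_map. reflexivity. }
    rewrite Ec in HN.
    replace (x - (/ beta - A)) with ((/ (A + x) - beta) * (- ((A + x) / beta))) by (field; lra).
    rewrite Rabs_mult, Rabs_Ropp, (Rabs_pos_eq ((A + x) / beta)) by (apply Rdiv_le_0_compat; lra).
    assert (H0 : 0 < (A + x) / beta <= (A + 1) / beta).
    { split; [apply Rdiv_lt_0_compat; lra|]. apply Rmult_le_compat_r; [left; now apply Rinv_0_lt_compat | lra]. }
    apply Rlt_le_trans with (eps * beta / (A + 1) * ((A + x) / beta)).
    - apply Rmult_lt_compat_r; lra.
    - apply Rle_trans with (eps * beta / (A + 1) * ((A + 1) / beta)).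
      + apply Rmult_le_compat_l; [|lra]. apply Rdiv_le_0_compat; nra.
      + right; field; lra. }
  split; [split; [intros; apply Ha; lia | exact Hlim]|].
  split; apply le_epsilon; intros e He; destruct (Hlim e He) as [N HN];
    specialize (HN N ltac:(lia)); specialize (Hx N); apply Rabs_def2 in HN; lra.
Qed.

(** * Inverse branches as fractional linear maps *)

Definition mobval (beta : R) (k : nat) (x : R) : R :=
  (INR (fst (mob beta (1, 0)%nat k)) * x + INR (snd (mob beta (1, 0)%nat k))) /
  (denC beta k * x + denD beta k).

Lemma mobval_0 beta x : mobval beta 0 x = x.
Proof. unfold mobval, denC, denD; simpl. field; lra. Qed.

Lemma mobval_S beta k x : 0 <= x ->
  mobval beta (S k) x = mobval beta k (if Rle_dec (orb beta k) (1/2) then f10 x else f11 x).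
Proof.
  intros Hx; unfold mobval, denC, denD.
  pose proof (denD_ge1 beta k) as Hd; unfold denD in Hd.
  pose proof (denC_pos beta k) as Hc; unfold denC in Hc.
  simpl; destruct (mob beta (0, 1)%nat k) as [c d]; destruct (mob beta (1, 0)%nat k) as [a b].
  simpl in *. destruct (Rle_dec _ _); simpl; rewrite !plus_INR; unfold f10, f11; field; split; nra.
Qed.

Lemma mob_det beta k :
  let (a, b) := mob beta (1, 0)%nat k in let (c, d) := mob beta (0, 1)%nat k in
  (Z.of_nat a * Z.of_nat d - Z.of_nat b * Z.of_nat c = 1 \/
   Z.of_nat a * Z.of_nat d - Z.of_nat b * Z.of_nat c = -1)%Z.
Proof.
  induction k as [|k IH]; simpl; [left; lia|].
  destruct (mob beta (1, 0)%nat k) as [a b]; destruct (mob beta (0, 1)%nat k) as [c d].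
  destruct (Rle_dec _ _); rewrite !Nat2Z.inj_add; destruct IH; [left | right | right | left]; lia.
Qed.

(** At 1 the branch takes the value [(A + B) / (C + D)], which is reduced because the determinant is
    ±1; equal reduced fractions have equal denominators. *)
Lemma cf_denom_mobval beta k l t : cfval l = mobval beta k 1 -> cf_denom l t -> INR t = denS beta k.
Proof.
  intros E (Ht & s & Hg & Es). rewrite Es in E.
  pose proof (mob_det beta k) as Hdet. unfold mobval in E.
  pose proof (denD_ge1 beta k) as HD. pose proof (denC_pos beta k) as HC.
  unfold denS, denC, denD in *.
  destruct (mob beta (1, 0)%nat k) as [a b]; destruct (mob beta (0, 1)%nat k) as [c d]; simpl in *.
  rewrite <- plus_INR. f_equal.
  assert (HtR : 0 < INR t) by (now apply (lt_INR 0)).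
  assert (EZ : (s * Z.of_nat (c + d) = Z.of_nat (a + b) * Z.of_nat t)%Z).
  { apply eq_IZR. rewrite !mult_IZR, <- !INR_IZR_INZ, !plus_INR.
    rewrite !Rmult_1_r in E.
    apply Rmult_eq_reg_r with (/ INR t * / (INR c + INR d)).
    2:{ apply Rmult_integral_contrapositive; split; apply Rinv_neq_0_compat; lra. }
    transitivity (IZR s / INR t); [field; lra|]. rewrite E; field; lra. }
  assert (Hgab : Z.gcd (Z.of_nat (a + b)) (Z.of_nat (c + d)) = 1%Z).
  { apply Z.bezout_1_gcd. destruct Hdet as [H|H].
    - exists (Z.of_nat d), (- Z.of_nat b)%Z. lia.
    - exists (- Z.of_nat d)%Z, (Z.of_nat b). lia. }
  apply Nat2Z.inj, Z.divide_antisym_nonneg; try lia.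
  - apply Z.gauss with s; [|rewrite Z.gcd_comm; exact Hg].
    rewrite EZ; apply Z.divide_factor_r.
  - apply Z.gauss with (Z.of_nat (a + b)); [|rewrite Z.gcd_comm; exact Hgab].
    rewrite <- EZ; apply Z.divide_factor_r.
Qed.

(** A left step lowers the reciprocal of the orbit point by 1, and a right step occurs once it is
    below 2. A digit [a] is thus [a - 1] left steps followed by one right step. *)
Lemma digit_block beta K a g : 0 <= orb beta K <= 1 -> (1 <= a)%nat -> 0 < g < 1 ->
  / orb beta K = INR a + g ->
  (forall i, (i < a)%nat -> orb beta (K + i) = / (INR a + g - INR i) /\
     forall x, 0 <= x -> mobval beta (K + i) x = mobval beta K (x / (1 + INR i * x))) /\
  orb beta (K + a) = g /\
  (forall x, 0 <= x -> mobval beta (K + a) x = mobval beta K (/ (INR a + x))).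
Proof.
  intros Hr Ha Hg HK.
  assert (H1 : forall i, (i < a)%nat -> orb beta (K + i) = / (INR a + g - INR i) /\
     forall x, 0 <= x -> mobval beta (K + i) x = mobval beta K (x / (1 + INR i * x))).
  { induction i as [|i IH]; intros Hi.
    - rewrite Nat.add_0_r; simpl INR; split.
      + rewrite Rminus_0_r, <- HK, Rinv_inv; reflexivity.
      + intros x Hx; f_equal; field.
    - destruct (IH ltac:(lia)) as [E Em].
      assert (Hia : INR i + 2 <= INR a).
      { replace (INR i + 2) with (INR (i + 2)) by (rewrite plus_INR; simpl; ring). apply le_INR; lia. }
      assert (Hle : orb beta (K + i) <= 1/2).
      { rewrite E. replace (1/2) with (/2) by lra. apply Rinv_le_contravar; lra. }
      rewrite Nat.add_succ_r, S_INR; split.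
      + change (orb beta (S (K + i))) with (T1 (orb beta (K + i))). unfold T1.
        destruct (Rle_dec _ _); [|lra]. rewrite E; field; lra.
      + intros x Hx. rewrite mobval_S by auto. destruct (Rle_dec _ _); [|lra].
        pose proof (pos_INR i).
        rewrite Em by (unfold f10; apply Rdiv_le_0_compat; lra).
        f_equal. unfold f10; field. split; nra. }
  split; [exact H1|].
  destruct (H1 (a - 1)%nat ltac:(lia)) as [E Em].
  rewrite minus_INR in E, Em by auto. simpl (INR 1) in E, Em.
  replace (K + a)%nat with (S (K + (a - 1))) by lia.
  assert (Hgt : ~ orb beta (K + (a - 1)) <= 1/2).
  { rewrite E. replace (INR a + g - (INR a - 1)) with (1 + g) by ring. apply Rlt_not_le.
    replace (1/2) with (/2) by lra. apply Rinv_lt_contravar; lra. }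
  split.
  - change (orb beta (S (K + (a - 1)))) with (T1 (orb beta (K + (a - 1)))). unfold T1.
    destruct (Rle_dec _ _); [lra|]. rewrite E; field; lra.
  - intros x Hx. rewrite mobval_S by auto. destruct (Rle_dec _ _); [lra|].
    assert (1 <= INR a) by (apply (le_INR 1); auto).
    rewrite Em by (unfold f11; apply Rdiv_le_0_compat; lra).
    f_equal. unfold f11; field. split; [|nra].
    nra.
Qed.

(** The number of Farey steps that consume the first [n] digits. *)
Fixpoint dsum (a : nat -> nat) (n : nat) : nat :=
  match n with O => O | S m => (dsum a m + a (S m))%nat end.

Lemma irrational_inv_neq x (m : nat) : ~ is_rational x -> (0 < m)%nat -> / x <> INR m.
Proof.
  intros Hx Hm E; apply Hx. rewrite <- (Rinv_inv x), E, INR_IZR_INZ.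
  replace (/ IZR (Z.of_nat m)) with (IZR 1 / IZR (Z.of_nat m)) by (unfold Rdiv; ring).
  apply is_rational_frac, not_0_IZR; lia.
Qed.

Section Expansion.
Variables (beta : R) (a : nat -> nat).
Hypothesis Hbeta : 0 <= beta <= 1.
Hypothesis Hirr : ~ is_rational beta.
Hypothesis Hcf : is_cf_expansion beta a.

Let Ha n : (1 <= n)%nat -> (1 <= a n)%nat.
Proof. apply Hcf. Qed.

Let next_digit n : is_cf_expansion (orb beta (dsum a n)) (fun i => a (n + i)%nat) ->
  exists g, 0 < g < 1 /\ / orb beta (dsum a n) = INR (a (S n)) + g /\
    is_cf_expansion g (fun i => a (S n + i)%nat).
Proof.
  intros H. destruct (irrational_orbit beta Hbeta Hirr (dsum a n)) as [Hr _].
  destruct (cf_tail _ _ (proj1 Hr) H) as [Ht Hran].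
  replace (n + 1)%nat with (S n) in Ht, Hran by lia.
  pose proof (orb_irrational beta (dsum a n) Hbeta Hirr) as Hio.
  assert (N0 := irrational_inv_neq _ (a (S n)) Hio ltac:(pose proof (Ha (S n)); lia)).
  assert (N1 := irrational_inv_neq _ (a (S n) + 1) Hio ltac:(lia)).
  rewrite plus_INR in N1; simpl (INR 1) in N1.
  exists (/ orb beta (dsum a n) - INR (a (S n))); split; [lra|split; [ring|]].
  split; [intros; apply Ha; lia|].
  intros eps He. destruct (proj2 Ht eps He) as [N HN]. exists N; intros k Hk.
  specialize (HN k Hk).
  rewrite (map_ext (fun i => a (S n + i)%nat) (fun i => a (n + S i)%nat)); auto.
  intros i; f_equal; lia.
Qed.

Let orbit_cf n : is_cf_expansion (orb beta (dsum a n)) (fun i => a (n + i)%nat) /\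
  forall l, 0 <= cfval l -> cfval (map a (seq 1 n) ++ l) = mobval beta (dsum a n) (cfval l).
Proof.
  induction n as [|n [IH1 IH2]].
  - split; [exact Hcf|]. intros l Hl; simpl; now rewrite mobval_0.
  - destruct (next_digit n IH1) as (g & Hg & E & Hcg).
    destruct (digit_block beta (dsum a n) (a (S n)) g) as (_ & Ho & Hm); auto.
    { now apply orb_range. } { apply Ha; lia. }
    simpl dsum. split; [rewrite Ho; exact Hcg|].
    intros l Hl. rewrite seq_S, map_app, <- app_assoc. simpl app.
    assert (1 <= INR (a (S n))) by (apply (le_INR 1), Ha; lia).
    rewrite IH2 by (simpl; left; apply Rinv_0_lt_compat; lra).
    simpl cfval. now rewrite Hm.
Qed.

(** After [n] complete digits and [j] left steps the branch sends 1 to [[0; a_1, ..., a_n, j + 1]].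
    So the intermediate denominators are exactly the numbers [denS], in the order of the orbit. *)
Lemma denS_cf_denom n j t : (j < a (S n))%nat -> cf_denom (cf_nj a (S n) (S j)) t ->
  INR t = denS beta (dsum a n + j).
Proof.
  intros Hj; apply cf_denom_mobval. destruct (orbit_cf n) as [H1 H2].
  destruct (next_digit n H1) as (g & Hg & E & _).
  destruct (digit_block beta (dsum a n) (a (S n)) g) as (Hi & _ & _); auto.
  { now apply orb_range. } { apply Ha; lia. }
  unfold cf_nj. replace (S n - 1)%nat with n by lia.
  pose proof (pos_INR j).
  rewrite H2.
  - rewrite (proj2 (Hi j Hj)) by lra. f_equal. cbn [cfval]. rewrite S_INR. field; lra.
  - cbn [cfval]. rewrite S_INR; left; apply Rinv_0_lt_compat; lra.
Qed.

Lemma dsum_ge n : (n <= dsum a n)%nat.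
Proof. induction n as [|n IH]; simpl; [lia|]. pose proof (Ha (S n)); lia. Qed.

End Expansion.

(** * From the intermediate type to a summable series along the orbit *)

Lemma bsum_add f n m : bsum f (n + m) = bsum f n + bsum (fun i => f (n + i)%nat) m.
Proof.
  induction m as [|m IH]; simpl; [rewrite Nat.add_0_r; ring|].
  rewrite Nat.add_succ_r; simpl; rewrite IH; ring.
Qed.

Lemma bsum_ext f g n : (forall i, (i < n)%nat -> f i = g i) -> bsum f n = bsum g n.
Proof.
  intros H; induction n as [|n IH]; simpl; auto. rewrite IH, H; auto.
Qed.

Lemma bsum_le f g n : (forall i, f i <= g i) -> bsum f n <= bsum g n.
Proof. intros H; induction n as [|n IH]; simpl; [lra|]. specialize (H n); lra. Qed.

Lemma sum_f_R0_bsum f n : sum_f_R0 f n = bsum f (S n).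
Proof. induction n as [|n IH]; simpl; [ring|]. now rewrite IH. Qed.

(** The extra term on the left carries the induction. A left step matches term by term; a right step
    consumes the carried [D]-term and replaces it by [S_n], which is the new [D]. The 1 is the
    initial [D]-term. *)
Lemma bsum_denM beta sigma n :
  bsum (fun k => Rpower (denM beta k) (- sigma)) n + Rpower (denD beta n) (- sigma) <=
  1 + bsum (fun k => Rpower (denS beta k) (- sigma)) n.
Proof.
  induction n as [|n IH].
  - simpl; unfold denD; simpl. rewrite Rpower_one_base; lra.
  - simpl. destruct (den_step beta n) as [H0 H1]. unfold denM at 2.
    destruct (Rle_dec (orb beta n) (1/2)) as [H|H].
    + destruct (H0 H) as [_ ->]; lra.
    + destruct (H1 H) as [_ ->]. fold (denS beta n); lra.
Qed.

Theorem intermediate_type_summable alpha beta : 0 < alpha < 1 -> 0 <= beta <= 1 ->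
  ~ is_rational beta -> intermediate_type alpha beta ->
  exists eta, 0 < eta /\ alpha + eta < 1 /\
    exists B, forall n, bsum (fun k => Rpower (denM beta k) (- (2 - 2 * alpha - eta))) n <= B.
Proof.
  intros Ha Hb Hirr (a & Hcf & eps & He & t & Ht & B & HB).
  (* [eta <= eps] compares the exponents of the two series, and [eta <= (1 - alpha) / 2] keeps
     [alpha + eta] below 1. *)
  set (eta := Rmin eps ((1 - alpha) / 2)).
  assert (Heta : 0 < eta) by (apply Rmin_glb_lt; lra).
  assert (Heta1 : eta <= eps) by apply Rmin_l.
  assert (Heta2 : eta <= (1 - alpha) / 2) by apply Rmin_r.
  exists eta; split; [auto|split; [lra|]]. exists (1 + B). intros n.
  assert (Ha1 : forall n, (1 <= a (S n))%nat) by (intros; apply Hcf; lia).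
  assert (HS : forall k, 1 <= denS beta k).
  { intros k; pose proof (denS_ge beta k); pose proof (pos_INR k); lra. }
  assert (Hsum : forall N, bsum (fun k => Rpower (denS beta k) (-2 * (1 - alpha) + eps)) (dsum a N) =
     bsum (fun n => sum_f_R0 (fun j => Rpower (INR (t (S n) (S j))) (-2 * (1 - alpha) + eps)) (a (S n) - 1)) N).
  { induction N as [|N IH]; auto. simpl. rewrite bsum_add, IH. f_equal.
    rewrite sum_f_R0_bsum. replace (S (a (S N) - 1)) with (a (S N)) by (pose proof (Ha1 N); lia).
    apply bsum_ext; intros j Hj. f_equal. symmetry.
    apply (denS_cf_denom beta a Hb Hirr Hcf); auto. apply Ht; lia. }
  pose proof (bsum_denM beta (2 - 2 * alpha - eta) n) as Hm.
  pose proof (Rpower_pos (denD beta n) (- (2 - 2 * alpha - eta))).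
  assert (bsum (fun k => Rpower (denS beta k) (- (2 - 2 * alpha - eta))) n <= B); [|lra].
  apply Rle_trans with (bsum (fun k => Rpower (denS beta k) (-2 * (1 - alpha) + eps)) n).
  { apply bsum_le; intros k; apply Rle_Rpower; [apply HS | lra]. }
  apply Rle_trans with (bsum (fun k => Rpower (denS beta k) (-2 * (1 - alpha) + eps)) (dsum a (S n))).
  { apply bsum_incr; [intros; left; apply Rpower_pos|].
    pose proof (dsum_ge beta a Hcf (S n)); lia. }
  rewrite Hsum, <- sum_f_R0_bsum. apply HB.
Qed.

(** * The exceptional set *)

Lemma Rpower_small s e : 0 < s -> 0 < e ->
  exists N : nat, forall n, (N <= n)%nat -> Rpower (INR n + 1) (- s) <= e.
Proof.
  intros Hs He. destruct (INR_unbounded (Rpower e (- / s))) as [N HN].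
  exists N; intros n Hn. apply le_INR in Hn.
  apply Rle_trans with (Rpower (Rpower e (- / s)) (- s)).
  - apply Rpower_anti; [|lra]. split; [apply Rpower_pos | lra].
  - rewrite Rpower_mult. replace (- / s * - s) with 1 by (field; lra). rewrite Rpower_1; lra.
Qed.

Lemma Rpower_ge1 x s : 1 <= x -> 0 <= s -> 1 <= Rpower x s.
Proof.
  intros Hx Hs. apply Rle_trans with (Rpower x 0); [rewrite Rpower_O; lra | now apply Rle_Rpower].
Qed.

(** The covering half of Borel-Cantelli: every tail of the intervals covers a limsup set.
    [delta / 4] keeps the lengths [2 r n] strictly below [delta]. *)
Lemma hausdorff_dim0_tails (c r : nat -> R) (E : R -> Prop) :
  (forall n, 0 < r n) ->
  (forall x N, E x -> exists n, (N <= n)%nat /\ Rabs (x - c n) <= r n) ->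
  (forall delta, 0 < delta -> exists N, forall n, (N <= n)%nat -> r n <= delta) ->
  (forall s eps, 0 < s -> 0 < eps -> exists N0, forall N m, (N0 <= N)%nat ->
     bsum (fun i => Rpower (r (N + i)%nat) s) m <= eps) ->
  hausdorff_dim0 E.
Proof.
  intros Hr HE Hd Hs s delta eps Hs0 Hd0 He.
  destruct (Hd (delta / 4) ltac:(lra)) as [N1 HN1].
  destruct (Hs s (eps / Rpower 2 s) Hs0) as [N2 HN2].
  { apply Rdiv_lt_0_compat; [auto | apply Rpower_pos]. }
  set (N := (N1 + N2)%nat).
  exists (fun i => c (N + i)%nat - r (N + i)%nat), (fun i => c (N + i)%nat + r (N + i)%nat).
  split; [|split].
  - intros i. specialize (Hr (N + i)%nat). specialize (HN1 (N + i)%nat ltac:(unfold N; lia)). lra.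
  - intros x Hx. destruct (HE x N Hx) as (n & Hn & Hxn). exists (n - N)%nat.
    replace (N + (n - N))%nat with n by lia. apply Rabs_le_between in Hxn; lra.
  - intros m. rewrite sum_f_R0_bsum.
    specialize (HN2 N (S m) ltac:(unfold N; lia)).
    assert (E1 : forall k, bsum (fun i => Rpower (c (N + i)%nat + r (N + i)%nat - (c (N + i)%nat - r (N + i)%nat)) s) k =
      Rpower 2 s * bsum (fun i => Rpower (r (N + i)%nat) s) k).
    { induction k as [|k IH]; cbn [bsum]; [ring|]. rewrite IH.
      replace (c (N + k)%nat + r (N + k)%nat - (c (N + k)%nat - r (N + k)%nat)) with (2 * r (N + k)%nat) by ring.
      rewrite <- Rpower_mult_distr by (auto; lra). ring. }
    rewrite E1.
    pose proof (Rpower_pos 2 s).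
    apply Rle_trans with (Rpower 2 s * (eps / Rpower 2 s)); [apply Rmult_le_compat_l; lra | right; field; lra].
Qed.

(** Covers consist of nondegenerate intervals, so even the empty set needs lengths whose powers are
    summable, here at most [eps (1/2)^(i+1)]. *)
Lemma hausdorff_dim0_empty : hausdorff_dim0 (fun _ => False).
Proof.
  intros s delta eps Hs Hd He.
  set (w := fun i : nat => Rmin (delta / 2) (Rpower (eps * (1/2) ^ (i + 1)) (/ s))).
  assert (Hp : forall i, 0 < eps * (1/2) ^ (i + 1)).
  { intros i; apply Rmult_lt_0_compat; auto. apply pow_lt; lra. }
  assert (Hw : forall i, 0 < w i <= delta / 2).
  { intros i; split; [|apply Rmin_l]. apply Rmin_glb_lt; [lra | apply Rpower_pos]. }
  exists (fun _ => 0), w; split; [|split; [tauto|]].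
  - intros i; specialize (Hw i); lra.
  - intros N. apply Rle_trans with (eps - eps * (1/2) ^ (N + 1)).
    2:{ specialize (Hp N); lra. }
    assert (Hterm : forall i, Rpower (w i - 0) s <= eps * (1/2) ^ (i + 1)).
    { intros i; rewrite Rminus_0_r. destruct (Hw i).
      eapply Rle_trans; [apply (Rle_Rpower_l _ (Rpower (eps * (1/2) ^ (i + 1)) (/ s))); [lra|]|].
      - split; [auto | apply Rmin_r].
      - rewrite Rpower_mult, Rinv_l, Rpower_1 by (auto; lra). lra. }
    induction N as [|N IH].
    + cbn [sum_f_R0]. specialize (Hterm 0%nat). simpl in *; lra.
    + cbn [sum_f_R0]. specialize (Hterm (S N)).
      replace ((1/2) ^ (N + 1)) with (2 * (1/2) ^ (S N + 1)) in IH by (simpl; field). lra.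
Qed.

Section Exceptional.
Variables (alpha beta : R).
Hypothesis Halpha : 0 < alpha < 1.
Hypothesis Hirr : forall k, 0 < orb beta k < 1 /\ orb beta k <> 1/2.

Let b := orb beta.
Let SD n := denS beta n * denD beta n.
(** Since [SD <= S^2], this exponent gives [SD^(p alpha) <= S^(1 - alpha)], half of the decay
    [S^(2 alpha - 2)]; the other half absorbs the logarithm. *)
Let p := (1 - alpha) / (2 * alpha).
Let r n := Rpower (SD n) (- p) * exp (- / b n).

Let p_pos : 0 < p.
Proof. apply Rdiv_lt_0_compat; lra. Qed.

Let S_ge1 n : INR n + 1 <= denS beta n /\ 1 <= denS beta n /\ 1 <= denD beta n <= denS beta n.
Proof.
  pose proof (denS_ge beta n); pose proof (pos_INR n); pose proof (denD_ge1 beta n);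
  pose proof (denD_le_S beta n); lra.
Qed.

Let SD_ge n : denS beta n <= SD n.
Proof. destruct (S_ge1 n) as (_ & H1 & H2); unfold SD; nra. Qed.

Let r_pos n : 0 < r n.
Proof. unfold r; apply Rmult_lt_0_compat; [apply Rpower_pos | apply exp_pos]. Qed.

(* [SD ^ -q * (K - exp (- s / b))] decreases along the orbit by at least a multiple of
   [SD ^ -q * exp (- s / b)]: a left step lowers [/ b] by one, a right step doubles [SD]. *)
Let tail_bound s q : 0 < s -> 0 < q -> exists K, 0 < K /\ forall N m,
  bsum (fun i => Rpower (SD (N + i)%nat) (- q) * exp (- (s * / b (N + i)%nat))) m <=
  K * Rpower (SD N) (- q).
Proof.
  intros Hs Hq.
  assert (H2q : Rpower 2 (- q) < 1).
  { unfold Rpower. rewrite <- exp_0. apply exp_increasing.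
    assert (0 < ln 2) by (rewrite <- ln_1; apply ln_increasing; lra). nra. }
  (* [K (1 - 2^-q) = 2] leaves at least 1 at a right step after subtracting [ex n <= 1]; a left step
     gains [exp s - 1 >= s]. Hence the common rate [c = Rmin s 1]. *)
  set (K := 2 / (1 - Rpower 2 (- q))).
  assert (HK : 0 < K) by (apply Rdiv_lt_0_compat; lra).
  assert (HK2 : K - Rpower 2 (- q) * K = 2) by (unfold K; field; lra).
  pose proof (Rpower_pos 2 (- q)) as H2p.
  assert (HK1 : 1 <= K) by nra.
  set (c := Rmin s 1). assert (Hc : 0 < c) by (apply Rmin_glb_lt; lra).
  assert (Hcs : c <= s) by apply Rmin_l. assert (Hc1 : c <= 1) by apply Rmin_r.
  set (ex := fun n => exp (- (s * / b n))).
  set (V := fun n => Rpower (SD n) (- q) * (K - ex n)).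
  assert (Hex : forall n, 0 < ex n <= 1).
  { intros n; split; [apply exp_pos|]. unfold ex. rewrite <- exp_0.
    left; apply exp_increasing. destruct (Hirr n) as [Hb _]; fold (b n) in Hb.
    assert (0 < / b n) by (apply Rinv_0_lt_compat; lra). nra. }
  assert (Hstep : forall n, c * (Rpower (SD n) (- q) * ex n) <= V n - V (S n)).
  { intros n. destruct (Hirr n) as [Hb _]; fold (b n) in Hb.
    destruct (S_ge1 n) as (_ & HS & HD).
    pose proof (Rpower_pos (SD n) (- q)) as HP.
    assert (HSD0 : 0 < SD n) by (unfold SD; nra).
    destruct (den_step beta n) as [G0 G1]. fold (b n) in G0, G1.
    pose proof (Hex n) as He; pose proof (Hex (S n)) as He'.
    destruct (Rle_dec (b n) (1/2)) as [Hl|Hl].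
    - assert (HSD : SD n <= SD (S n)).
      { unfold SD; rewrite denS_step; destruct (G0 Hl) as [_ ->]; nra. }
      assert (HR : Rpower (SD (S n)) (- q) <= Rpower (SD n) (- q)) by (apply Rpower_anti; lra).
      assert (Ee : ex (S n) = ex n * exp s).
      { unfold ex; rewrite <- exp_plus; f_equal.
        change (b (S n)) with (T1 (b n)). unfold T1; destruct (Rle_dec _ _); [|lra]. field; lra. }
      assert (Hes := exp_ineq1_le s).
      unfold V. apply Rle_trans with (Rpower (SD n) (- q) * (K - ex n) - Rpower (SD n) (- q) * (K - ex (S n))).
      2:{ assert (0 <= K - ex (S n)) by lra. nra. }
      rewrite Ee. replace (Rpower (SD n) (- q) * (K - ex n) - Rpower (SD n) (- q) * (K - ex n * exp s))
        with ((exp s - 1) * (Rpower (SD n) (- q) * ex n)) by ring.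
      apply Rmult_le_compat_r; nra.
    - assert (HSD : SD n * 2 <= SD (S n)).
      { unfold SD; rewrite denS_step; destruct (G1 Hl) as [_ ->]; fold (denS beta n); nra. }
      assert (HR : Rpower (SD (S n)) (- q) <= Rpower (SD n) (- q) * Rpower 2 (- q)).
      { rewrite Rpower_mult_distr by lra. apply Rpower_anti; lra. }
      unfold V. apply Rle_trans with (Rpower (SD n) (- q) * (K - ex n) - Rpower (SD n) (- q) * Rpower 2 (- q) * K).
      2:{ pose proof (Rpower_pos (SD (S n)) (- q)).
          assert (Rpower (SD (S n)) (- q) * (K - ex (S n)) <= Rpower (SD (S n)) (- q) * K) by nra.
          nra. }
      replace (Rpower (SD n) (- q) * (K - ex n) - Rpower (SD n) (- q) * Rpower 2 (- q) * K)
        with (Rpower (SD n) (- q) * ((K - Rpower 2 (- q) * K) - ex n)) by ring.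
      rewrite HK2. replace (c * (Rpower (SD n) (- q) * ex n)) with (Rpower (SD n) (- q) * (c * ex n)) by ring.
      apply Rmult_le_compat_l; nra. }
  exists (K / c); split; [now apply Rdiv_lt_0_compat|]. intros N m.
  apply Rmult_le_reg_l with c; auto.
  replace (c * (K / c * Rpower (SD N) (- q))) with (Rpower (SD N) (- q) * K) by (field; lra).
  apply Rle_trans with (V N - V (N + m)%nat).
  - induction m as [|m IH]; cbn [bsum]; [rewrite Nat.add_0_r; lra|].
    rewrite Nat.add_succ_r. specialize (Hstep (N + m)%nat). unfold ex in Hstep at 1. lra.
  - pose proof (Rpower_pos (SD N) (- q)). pose proof (Rpower_pos (SD (N + m)) (- q)).
    pose proof (Hex N). pose proof (Hex (N + m)%nat). unfold V. nra.
Qed.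

Definition exceptional (x : R) : Prop :=
  forall N, exists n, (N <= n)%nat /\ Rabs (x - b n) <= r n.

Lemma exceptional_dim0 : hausdorff_dim0 exceptional.
Proof.
  apply (hausdorff_dim0_tails b r); [exact r_pos | intros x N H; apply H | |].
  - intros delta Hd. destruct (Rpower_small p delta p_pos Hd) as [N HN].
    exists N; intros n Hn. eapply Rle_trans; [|apply (HN n Hn)].
    destruct (S_ge1 n) as (H1 & H2 & _). pose proof (SD_ge n). pose proof (pos_INR n).
    assert (Rpower (SD n) (- p) <= Rpower (INR n + 1) (- p)) by (apply Rpower_anti; lra).
    destruct (Hirr n) as [Hb _]; fold (b n) in Hb.
    assert (0 < / b n) by (apply Rinv_0_lt_compat; lra).
    assert (exp (- / b n) <= 1) by (rewrite <- exp_0; left; apply exp_increasing; lra).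
    pose proof (exp_pos (- / b n)). pose proof (Rpower_pos (SD n) (- p)). unfold r. nra.
  - intros s eps Hs He.
    destruct (tail_bound s (p * s) Hs ltac:(nra)) as (K & HK & HB).
    destruct (Rpower_small (p * s) (eps / K) ltac:(nra)) as [N0 HN0].
    { now apply Rdiv_lt_0_compat. }
    exists N0; intros N m HN.
    assert (E : bsum (fun i => Rpower (r (N + i)%nat) s) m =
      bsum (fun i => Rpower (SD (N + i)%nat) (- (p * s)) * exp (- (s * / b (N + i)%nat))) m).
    { apply bsum_ext; intros i _. unfold r.
      rewrite <- Rpower_mult_distr by (try apply Rpower_pos; apply exp_pos).
      rewrite Rpower_mult. f_equal; [f_equal; ring|].
      unfold Rpower; rewrite ln_exp; f_equal; ring. }
    rewrite E. eapply Rle_trans; [apply HB|].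
    apply Rle_trans with (K * (eps / K)); [|right; field; lra].
    apply Rmult_le_compat_l; [lra|]. eapply Rle_trans; [|apply (HN0 N HN)].
    destruct (S_ge1 N) as (H1 & H2 & _). pose proof (SD_ge N). pose proof (pos_INR N).
    apply Rpower_anti; [lra | nra].
Qed.

(** [ln n] is at most [S^s / s] with [s = (1 - alpha) / 2], and the exponents [s], [2 alpha - 2] and
    [1 - alpha] add up to [- s]. *)
Lemma irr_err_small X kappa : 0 < X -> 0 < kappa -> exists N, forall n, (N <= n)%nat -> forall x,
  x <> orb beta n -> Rpower (Rabs (x - orb beta n)) (- alpha) <= X * Rpower (denS beta n) (1 - alpha) ->
  irr_err alpha beta n x <= kappa.
Proof.
  intros HX Hk. set (s := (1 - alpha) / 2). assert (Hs : 0 < s) by (unfold s; lra).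
  destruct (Rpower_small s (kappa * s / X) Hs) as [N HN].
  { apply Rdiv_lt_0_compat; nra. }
  exists (N + 1)%nat; intros n Hn x Hx Hle.
  unfold irr_err; destruct (Req_dec_T _ _); [easy|].
  specialize (HN n ltac:(lia)).
  destruct (S_ge1 n) as (H1 & H2 & _). pose proof (pos_INR n).
  assert (Hn1 : 1 <= INR n) by (apply (le_INR 1); lia).
  assert (Hln : ln (INR n) <= Rpower (denS beta n) s / s).
  { eapply Rle_trans; [|apply ln_le_Rpower; lra]. apply ln_le; lra. }
  assert (Hln0 : 0 <= ln (INR n)) by (rewrite <- ln_1; apply ln_le; lra).
  set (S_ := denS beta n) in *.
  pose proof (Rpower_pos S_ (2 * alpha - 2)). pose proof (Rpower_pos S_ (1 - alpha)).
  pose proof (Rpower_pos (Rabs (x - orb beta n)) (- alpha)). pose proof (Rpower_pos S_ s).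
  apply Rle_trans with (Rpower S_ s / s * (Rpower S_ (2 * alpha - 2) * (X * Rpower S_ (1 - alpha)))).
  { apply Rmult_le_compat; auto; [nra|]. apply Rmult_le_compat_l; lra. }
  replace (Rpower S_ s / s * (Rpower S_ (2 * alpha - 2) * (X * Rpower S_ (1 - alpha)))) with
    (X / s * (Rpower S_ s * Rpower S_ (2 * alpha - 2) * Rpower S_ (1 - alpha))) by (field; lra).
  rewrite <- !Rpower_plus. replace (s + (2 * alpha - 2) + (1 - alpha)) with (- s) by (unfold s; field).
  assert (Rpower S_ (- s) <= Rpower (INR n + 1) (- s)) by (apply Rpower_anti; lra).
  apply Rle_trans with (X / s * (kappa * s / X)); [|right; field; lra].
  apply Rmult_le_compat_l; [|lra]. left; now apply Rdiv_lt_0_compat.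
Qed.

Lemma irr_err_far d kappa : 0 < d -> 0 < kappa -> exists N, forall n, (N <= n)%nat -> forall x,
  d <= Rabs (x - orb beta n) -> irr_err alpha beta n x <= kappa.
Proof.
  intros Hd Hk.
  destruct (irr_err_small (Rpower d (- alpha)) kappa (Rpower_pos _ _) Hk) as [N HN].
  exists N; intros n Hn x Hx. apply HN; auto.
  - intros ->. rewrite Rminus_diag, Rabs_R0 in Hx; lra.
  - assert (1 <= Rpower (denS beta n) (1 - alpha)).
    { apply Rpower_ge1; [apply S_ge1 | lra]. }
    assert (Rpower (Rabs (x - orb beta n)) (- alpha) <= Rpower d (- alpha)) by (apply Rpower_anti; lra).
    pose proof (Rpower_pos d (- alpha)). nra.
Qed.

(** Orbit points below [x / 2] are at distance at least [x / 2] from [x]. For the others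
    [1 / b n <= 2 / x], so the exponential factor of the radius is bounded; [X] adds the two
    constants. *)
Lemma irr_err_not_exceptional x kappa : 0 < x <= 1 -> ~ exceptional x -> 0 < kappa ->
  exists N, forall n, (N <= n)%nat -> x <> orb beta n /\ irr_err alpha beta n x <= kappa.
Proof.
  intros Hx HE Hk.
  apply not_all_ex_not in HE; destruct HE as [N1 HN1].
  set (X := exp (alpha * (2 / x)) + Rpower (x / 2) (- alpha)).
  pose proof (exp_pos (alpha * (2 / x))) as HX1. pose proof (Rpower_pos (x / 2) (- alpha)) as HX2.
  destruct (irr_err_small X kappa ltac:(unfold X; lra) Hk) as [N2 HN2].
  exists (N1 + N2)%nat; intros n Hn.
  assert (Hr : r n < Rabs (x - b n)).
  { apply Rnot_le_lt; intros Hle; apply HN1; exists n; split; [lia | auto]. }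
  assert (Hne : x <> orb beta n).
  { intros E. fold (b n) in E. rewrite E, Rminus_diag, Rabs_R0 in Hr. pose proof (r_pos n); lra. }
  split; auto. apply HN2; [lia | auto |]. fold (b n).
  destruct (S_ge1 n) as (_ & HS & HD).
  assert (HS1 : 1 <= Rpower (denS beta n) (1 - alpha)).
  { apply Rpower_ge1; lra. }
  destruct (Hirr n) as [Hb _]; fold (b n) in Hb.
  destruct (Rle_dec (x / 2) (b n)) as [Hl|Hl].
  - apply Rle_trans with (Rpower (r n) (- alpha)).
    { apply Rpower_anti; [|lra]. split; [apply r_pos | lra]. }
    assert (Er : Rpower (r n) (- alpha) = Rpower (SD n) (p * alpha) * exp (alpha * / b n)).
    { unfold r. rewrite <- Rpower_mult_distr by (try apply Rpower_pos; apply exp_pos).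
      rewrite Rpower_mult. f_equal; [f_equal; ring|]. unfold Rpower; rewrite ln_exp; f_equal; ring. }
    rewrite Er.
    assert (A1 : Rpower (SD n) (p * alpha) <= Rpower (denS beta n) (1 - alpha)).
    { replace (1 - alpha) with (p * alpha + p * alpha) by (unfold p; field; lra).
      rewrite Rpower_plus, Rpower_mult_distr by lra.
      apply Rle_Rpower_l; [pose proof p_pos; nra|]. unfold SD; split; nra. }
    assert (A2 : exp (alpha * / b n) <= exp (alpha * (2 / x))).
    { assert (/ b n <= 2 / x).
      { replace (2 / x) with (/ (x / 2)) by (field; lra). apply Rinv_le_contravar; lra. }
      assert (alpha * / b n <= alpha * (2 / x)) by (apply Rmult_le_compat_l; lra).
      destruct H0 as [H0| ->]; [left; now apply exp_increasing | lra]. }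
    pose proof (exp_pos (alpha * / b n)). pose proof (Rpower_pos (SD n) (p * alpha)).
    rewrite Rmult_comm. apply Rmult_le_compat; try lra. unfold X; lra.
  - apply Rle_trans with (Rpower (x / 2) (- alpha)).
    { apply Rpower_anti; [|lra]. split; [lra|]. rewrite Rabs_pos_eq; lra. }
    unfold X; nra.
Qed.

End Exceptional.

(** * Limit points of the orbit *)

(** By Bolzano-Weierstrass, points violating ever weaker requirements accumulate at some [l] in [K],
    which would have to be 0 or a limit point of the orbit. *)
Lemma compact_away (K : R -> Prop) beta : compact K ->
  (forall x, K x -> 0 < x < 1 /\ ~ Omega1 beta x) ->
  exists (d : R) (N : nat), 0 < d /\ forall x, K x -> d <= x /\
    forall n, (N <= n)%nat -> d <= Rabs (x - orb beta n).
Proof.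
  intros HK HO. apply NNPP; intros Hn.
  assert (Hd : forall N : nat, 0 < / (INR N + 1)).
  { intros N; apply Rinv_0_lt_compat; pose proof (pos_INR N); lra. }
  assert (Hbad : forall N : nat, exists x, K x /\ (x < / (INR N + 1) \/
     exists n, (N <= n)%nat /\ Rabs (x - orb beta n) < / (INR N + 1))).
  { intros N; apply NNPP; intros Hc; apply Hn. exists (/ (INR N + 1)), N; split; auto.
    intros x Hx; split; [|intros n Hn']; apply Rnot_lt_le; intros Hlt; apply Hc; exists x; split; eauto. }
  set (u := fun N => proj1_sig (constructive_indefinite_description _ (Hbad N))).
  assert (Hu : forall N, K (u N) /\ (u N < / (INR N + 1) \/
     exists n, (N <= n)%nat /\ Rabs (u N - orb beta n) < / (INR N + 1))).
  { intros N; unfold u; apply proj2_sig. }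
  destruct (Bolzano_Weierstrass u K HK (fun N => proj1 (Hu N))) as [l Hl].
  assert (HKl : K l).
  { apply NNPP; intros Hnl. pose proof (compact_P2 K HK l Hnl) as Hnb.
    destruct (Hl (complementary K) 0%nat Hnb) as (q & _ & Hq). apply Hq, Hu. }
  destruct (HO l HKl) as [Hl0 HOl].
  apply HOl; intros k eps He.
  (* [e <= l / 2] excludes that the nearby point [u q] violates [d <= x], leaving closeness to the
     orbit. *)
  set (e := Rmin (eps / 2) (l / 2)). assert (He0 : 0 < e) by (apply Rmin_glb_lt; lra).
  assert (He1 : e <= eps / 2) by apply Rmin_l. assert (He2 : e <= l / 2) by apply Rmin_r.
  destruct (INR_unbounded (/ e)) as [N1 HN1].
  destruct (Hl (disc l (mkposreal e He0)) (k + N1)%nat) as (q & Hq & Hdq).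
  { exists (mkposreal e He0); intros y Hy; exact Hy. }
  unfold disc in Hdq; simpl in Hdq.
  assert (Hqe : / (INR q + 1) < e).
  { rewrite <- (Rinv_inv e). apply Rinv_lt_contravar.
    - pose proof (pos_INR q). apply Rmult_lt_0_compat; [now apply Rinv_0_lt_compat | lra].
    - assert (INR N1 <= INR q) by (apply le_INR; lia). lra. }
  destruct (Hu q) as [_ [Hs|(n & Hn' & Hs)]].
  - apply Rabs_def2 in Hdq; lra.
  - exists n; split; [lia|]. change (Nat.iter n T1 beta) with (orb beta n).
    replace (orb beta n - l) with (- (u q - orb beta n) + (u q - l)) by ring.
    eapply Rle_lt_trans; [apply Rabs_triang|]. rewrite Rabs_Ropp. lra.
Qed.

Lemma orb_add beta n k : orb beta (n + k) = orb (orb beta n) k.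
Proof.
  unfold orb; induction k as [|k IH]; simpl; [now rewrite Nat.add_0_r|].
  rewrite Nat.add_succ_r; simpl; now rewrite IH.
Qed.

Lemma orb_zero k : orb 0 k = 0.
Proof.
  induction k as [|k IH]; [reflexivity|]. change (orb 0 (S k)) with (T1 (orb 0 k)).
  rewrite IH. unfold T1; destruct (Rle_dec _ _); lra.
Qed.

Lemma is_period_1 beta N x : (forall n, (N <= n)%nat -> orb beta n = x) -> is_period beta 1.
Proof.
  intros H; split; auto. exists N; intros k.
  change (orb beta (N + k) = orb beta (N + 1 + k)). rewrite !H; auto; lia.
Qed.

Lemma orb_separated_finite beta x M :
  exists d, 0 < d /\ forall l, (l < M)%nat -> orb beta l = x \/ d <= Rabs (x - orb beta l).
Proof.
  induction M as [|M (d & Hd & H)]; [exists 1; split; [lra | lia]|].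
  set (d' := if Req_dec_T (orb beta M) x then 1 else Rabs (x - orb beta M)).
  assert (Hd' : 0 < d') by (unfold d'; destruct (Req_dec_T _ _); [lra | apply Rabs_pos_lt; lra]).
  exists (Rmin d d'); split; [now apply Rmin_glb_lt|].
  pose proof (Rmin_l d d'); pose proof (Rmin_r d d'). intros l Hl.
  destruct (Nat.eq_dec l M) as [->|Hne].
  - unfold d' in *; destruct (Req_dec_T _ _); [now left | right; lra].
  - destruct (H l ltac:(lia)); [now left | right; lra].
Qed.

(** A pre-periodic orbit has finitely many values, so a point that it approaches it also hits, and
    the other orbit points stay at a fixed distance. *)
Lemma orb_separated beta m x : is_period beta m ->
  exists d, 0 < d /\ forall l, orb beta l = x \/ d <= Rabs (x - orb beta l).
Proof.
  intros (Hm & n0 & Hp). destruct (orb_separated_finite beta x (n0 + m)) as (d & Hd & H).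
  exists d; split; auto. intros l; induction l as [l IH] using lt_wf_ind.
  destruct (le_lt_dec (n0 + m) l) as [Hl|Hl]; [|now apply H].
  specialize (IH (l - m)%nat ltac:(lia)). specialize (Hp (l - m - n0)%nat).
  replace (n0 + (l - m - n0))%nat with (l - m)%nat in Hp by lia.
  replace (n0 + m + (l - m - n0))%nat with l in Hp by lia.
  fold (orb beta (l - m)) in Hp. fold (orb beta l) in Hp. now rewrite Hp in IH.
Qed.

(** Brings the two cases into one form. A rational orbit ends at 0, so there the error function is 0
    and the exceptional set is empty. *)
Lemma orbit_control alpha beta : 0 < alpha < 1 -> 0 < beta <= 1 ->
  (is_rational beta \/ (~ is_rational beta /\ intermediate_type alpha beta)) ->
  exists err, Sing_ok alpha beta err /\
    (forall d kappa, 0 < d -> 0 < kappa -> exists N : nat, forall n, (N <= n)%nat -> forall x,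
       d <= Rabs (x - orb beta n) -> err n x <= kappa) /\
    (exists E, hausdorff_dim0 E /\ forall x kappa, 0 < x <= 1 -> ~ E x -> 0 < kappa ->
       exists N : nat, forall n, (N <= n)%nat -> x <> orb beta n /\ err n x <= kappa).
Proof.
  intros Ha Hb [Hr|[Hirr Ht]].
  - exists (fun _ _ => 0); split; [|split].
    + apply rational_Sing_ok; auto; lra.
    + intros d kappa Hd Hk; exists 0%nat; intros; lra.
    + exists (fun _ => False); split; [apply hausdorff_dim0_empty|].
      intros x kappa Hx _ Hk. destruct (rational_orbit beta ltac:(lra) Hr) as [m Hm].
      exists m; intros n Hn; split; [|lra].
      replace n with (m + (n - m))%nat by lia. rewrite orb_add, Hm, orb_zero; lra.
  - pose proof (irrational_orbit beta ltac:(lra) Hirr) as Ho.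
    destruct (intermediate_type_summable alpha beta Ha ltac:(lra) Hirr Ht) as (eta & He1 & He2 & Hsum).
    exists (irr_err alpha beta); split; [|split].
    + now apply (irrational_Sing_ok alpha beta eta).
    + intros d kappa; now apply irr_err_far.
    + exists (exceptional alpha beta); split; [now apply exceptional_dim0|].
      intros x kappa Hx HE Hk; now apply irr_err_not_exceptional.
Qed.

Theorem theorem3p2 :
  forall (alpha beta : R) (v : R -> ER),
    0 < alpha < 1 ->
    0 < beta <= 1 ->
    (is_rational beta \/ (~ is_rational beta /\ intermediate_type alpha beta)) ->
    in_U beta alpha v ->
    exists I : R, integral_v v beta I /\
      (* uniform convergence on compact subsets of (0,1) \ Omega_1(beta) *)
      (forall K : R -> Prop, compact K ->
         (forall x, K x -> 0 < x < 1 /\ ~ Omega1 beta x) ->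
         forall eps, 0 < eps -> exists N : nat, forall n : nat, (N <= n)%nat ->
           forall x, K x -> exists r, lnP n v x = Fin r /\ Rabs (r - I * h1 x) < eps) /\
      (* pointwise convergence outside a set of Hausdorff dimension 0 *)
      (exists E : R -> Prop, hausdorff_dim0 E /\
         forall x, 0 < x <= 1 -> ~ E x ->
           forall eps, 0 < eps -> exists N : nat, forall n : nat, (N <= n)%nat ->
             exists r, lnP n v x = Fin r /\ Rabs (r - I * h1 x) < eps) /\
      (* pre-periodic, period length > 1 *)
      (forall m : nat, period_length beta m -> (1 < m)%nat ->
         forall x, Omega1 beta x ->
           (* liminf = I * h1 x *)
           (forall eps, 0 < eps ->
              (exists N : nat, forall n : nat, (N <= n)%nat -> ER_gt (lnP n v x) (I * h1 x - eps)) /\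
              (forall N : nat, exists n : nat, (N <= n)%nat /\ ER_lt (lnP n v x) (I * h1 x + eps))) /\
           (* limsup = +oo *)
           (forall M : R, forall N : nat, exists n : nat, (N <= n)%nat /\ ER_ge (lnP n v x) M)) /\
      (* pre-periodic, period length 1 *)
      (period_length beta 1 ->
         forall x, Omega1 beta x ->
           forall M : R, exists N : nat, forall n : nat, (N <= n)%nat -> ER_ge (lnP n v x) M).
Proof.
  intros alpha beta v Ha Hb Htype HU.
  destruct (singular_reduction alpha beta v Ha Hb HU) as (I & HI & Hlow & Hup).
  destruct (orbit_control alpha beta Ha Hb Htype) as (err & Hsing & Hfar & E & HE & HEc).
  specialize (Hup err Hsing).
  set (vr := fun x => ER_real (v x)) in *.
  assert (Hfin : forall n x, 0 <= x <= 1 -> orb beta n <> x ->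
    lnP n v x = Fin (ln (INR n) * Prn n vr x)).
  { intros n x Hx Hne; unfold lnP.
    rewrite (P1n_fin v beta n (in_U_finite alpha beta v HU)); auto. }
  assert (Hinf : forall n, lnP n v (orb beta n) = PInf).
  { intros n; unfold lnP; rewrite P1n_inf; auto; [now apply (in_U_PInf alpha)|lra]. }
  exists I; split; [exact HI|split; [|split; [|split]]].
  - intros K HK HO eps He.
    destruct (compact_away K beta HK HO) as (d & N0 & Hd & HKd).
    destruct (Hlow d eps Hd He) as [N1 HN1].
    destruct (Hup d eps Hd He) as (N2 & kappa & Hk & HN2).
    destruct (Hfar d kappa Hd Hk) as [N3 HN3].
    exists (N0 + N1 + N2 + N3)%nat; intros n Hn x Hx.
    destruct (HO x Hx) as [Hx01 _]. destruct (HKd x Hx) as [Hdx Hdn].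
    specialize (Hdn n ltac:(lia)).
    assert (Hne : orb beta n <> x) by (intros Eq; rewrite Eq, Rminus_diag, Rabs_R0 in Hdn; lra).
    eexists; split; [apply Hfin; [lra | auto]|].
    specialize (HN1 n ltac:(lia) x ltac:(lra)).
    specialize (HN2 n ltac:(lia) x ltac:(lra) (HN3 n ltac:(lia) x Hdn)).
    unfold h1; apply Rabs_def1; lra.
  - exists E; split; [exact HE|]. intros x Hx HEx eps He.
    destruct (Hlow x eps ltac:(lra) He) as [N1 HN1].
    destruct (Hup x eps ltac:(lra) He) as (N2 & kappa & Hk & HN2).
    destruct (HEc x kappa Hx HEx Hk) as [N3 HN3].
    exists (N1 + N2 + N3)%nat; intros n Hn.
    destruct (HN3 n ltac:(lia)) as [Hne Herr].
    eexists; split; [apply Hfin; [lra | auto]|].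
    specialize (HN1 n ltac:(lia) x ltac:(lra)).
    specialize (HN2 n ltac:(lia) x ltac:(lra) Herr).
    unfold h1; apply Rabs_def1; lra.
  - intros m [Hper Hmin] Hm x Hx.
    destruct (orb_separated beta m x Hper) as (d & Hd & Hsep).
    assert (Hhit : forall N, exists n, (N <= n)%nat /\ orb beta n = x).
    { intros N. destruct (Hx N d Hd) as (l & Hl & Hlx). exists l; split; auto.
      destruct (Hsep l) as [?|H]; auto. rewrite Rabs_minus_sym in H. unfold orb in H; lra. }
    assert (Hnp : ~ is_period beta 1) by (intros H1; specialize (Hmin 1%nat H1); lia).
    assert (Hx0 : 0 < x <= 1).
    { destruct (Hhit 0%nat) as (l & _ & Hl). pose proof (orb_range beta l ltac:(lra)).
      (* 0 is a fixed point, so an orbit through it has period length one. *)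
      destruct (Req_dec x 0) as [Ex|]; [exfalso | lra].
      apply Hnp, (is_period_1 beta l 0). intros n Hn.
      replace n with (l + (n - l))%nat by lia. rewrite orb_add, Hl, Ex; apply orb_zero. }
    split.
    + intros eps He; split.
      * destruct (Hlow x eps ltac:(lra) He) as [N1 HN1]. exists N1; intros n Hn.
        destruct (Req_dec (orb beta n) x) as [<-|Hne]; [rewrite Hinf; exact Logic.I|].
        rewrite Hfin by (auto; lra). apply HN1; auto; lra.
      * intros N.
        destruct (Hup x eps ltac:(lra) He) as (N2 & kappa & Hk & HN2).
        destruct (Hfar d kappa Hd Hk) as [N3 HN3].
        (* Were [x] hit at all large times, the orbit would be eventually constant. At the other
           times [x] keeps distance [d] from the orbit and the upper bound applies. *)
        assert (exists n, (N + N2 + N3 <= n)%nat /\ orb beta n <> x) as (n & Hn & Hne).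
        { apply NNPP; intros Hno. apply Hnp, (is_period_1 beta (N + N2 + N3) x).
          intros n Hn; apply NNPP; intros Hne; apply Hno; eauto. }
        exists n; split; [lia|]. rewrite Hfin by (auto; lra).
        apply HN2; [lia | lra |]. apply HN3; [lia|]. destruct (Hsep n); [easy | auto].
    + intros M N. destruct (Hhit N) as (n & Hn & <-). exists n; split; auto.
      rewrite Hinf; exact Logic.I.
  - intros [(_ & n0 & Hp) _] x Hx M.
    assert (Hc : forall k, orb beta (n0 + k) = orb beta n0).
    { induction k as [|k IH]; [now rewrite Nat.add_0_r|].
      rewrite <- IH. specialize (Hp k). replace (n0 + 1 + k)%nat with (n0 + S k)%nat in Hp by lia.
      symmetry; exact Hp. }
    (* The orbit is constant from [n0] on, so this constant is its only limit point, and all later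
       iterates are infinite there. *)
    assert (Ex : x = orb beta n0).
    { apply NNPP; intros Hne.
      destruct (Hx n0 (Rabs (orb beta n0 - x)) ltac:(apply Rabs_pos_lt; lra)) as (l & Hl & Hlt).
      specialize (Hc (l - n0)%nat). replace (n0 + (l - n0))%nat with l in Hc by lia.
      fold (orb beta l) in Hlt. rewrite Hc in Hlt; lra. }
    exists n0; intros n Hn. specialize (Hc (n - n0)%nat). replace (n0 + (n - n0))%nat with n in Hc by lia.
    rewrite Ex, <- Hc, Hinf; exact Logic.I.
Qed.
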